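(* Let $n\ge 4$. The $(n+1)$-dimensional Myers-Perry metrics $g$ admit a conformal completion which includes a point $i_0$ at spatial infinity, so that past and future null infinities $\mathscr{I}^{\pm}$ form the null cone emanating from this point, with a conformally rescaled metric which is of $C^{n-3,1}$ differentiability class near $i_0$. Thus, all derivatives of the rescaled metric of order less than $n-3$ extend continuously to $i_0$ and $\mathscr{I}$, while the derivatives of the metric of order $n-3$ remain bounded as $i_0$ is approached, but do not necessarily extend to functions which are continuous at $i_0$.
   Context: Conformal completion: the region of the spacetime near spacelike infinity is embedded in a larger manifold containing additional points (here the point $i_0$ and the null boundaries $\mathscr{I}^{\pm}$, with $\mathscr{I}=\mathscr{I}^+\cup\mathscr{I}^-$), such that for a suitable function $\Omega>0$ on the spacetime, vanishing at the added points, the conformally rescaled metric $\tilde g=\Omega^2 g$ extends to the added points. The differentiability class referred to is that of $\tilde g$. Differentiability classes: a function $f$ is Hölder continuous with exponent $\alpha>0$ if there is a constant $C\ge 0$ with $|f(x)-f(y)|\le C|x-y|^\alpha$ for all $x,y$ in its domain; $f\in C^{k,\alpha}$ if $f$ and all its partial derivatives up to and including order $k$ are Hölder continuous with exponent $\alpha$. Myers-Perry metrics in Kerr-Schild-type coordinates: put $\epsilon=0$ if $n=2d$ is even and $\epsilon=1$ if $n=2d+1$ is odd. The coordinates are $(t,x_1,y_1,\dots,x_d,y_d)$ for $n$ even and $(t,x_1,y_1,\dots,x_d,y_d,z)$ for $n$ odd (terms multiplied by $\epsilon$ below are absent for $n$ even). The Minkowski metric is $\eta=-dt^2+\sum_{i=1}^d(dx_i^2+dy_i^2)+\epsilon\,dz^2$.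 Given real constants $m$ and $a_1,\dots,a_d$, the function $\hat r$ is defined implicitly by $$\sum_{i=1}^d\frac{x_i^2+y_i^2}{\hat r^2+a_i^2}+\epsilon\frac{z^2}{\hat r^2}=1,$$ and one sets $$k=dt+\sum_{i=1}^d\frac{\hat r(x_i\,dx_i+y_i\,dy_i)+a_i(x_i\,dy_i-y_i\,dx_i)}{\hat r^2+a_i^2}+\epsilon\frac{z\,dz}{\hat r},$$ $$F=1-\sum_{i=1}^d\frac{a_i^2(x_i^2+y_i^2)}{(\hat r^2+a_i^2)^2},\qquad \Pi=\prod_{i=1}^d(\hat r^2+a_i^2),\qquad h=\frac{2m\,\hat r^{2-\epsilon}}{\Pi F}.$$ The covector $k$ is null for $\eta$, and the Myers-Perry metric is $g=\eta+h\,k\otimes k$, considered here at large $r$, where $r^2=\sum_{i=1}^d(x_i^2+y_i^2)+\epsilon z^2$.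
   Formalization: Since C^{n-3,1} makes all derivatives of order up to n-3 Lipschitz, those of order n-3 do extend continuously to i_0; the claim that derivatives remain bounded but need not extend continuously to i_0 is instead made at order n-2. *)

(* Defs.v *)
From mathcomp Require Export all_boot all_order all_algebra.
From mathcomp Require Export all_classical all_reals all_analysis.

Set Implicit Arguments.
Unset Strict Implicit.
Unset Printing Implicit Defensive.

Export Order.TTheory GRing.Theory Num.Theory.
Export numFieldNormedType.Exports.

Local Open Scope classical_set_scope.
Local Open Scope ring_scope.

Section DifferentiabilityClasses.
Variables (R : realType) (N : nat).
Implicit Types (U D A : set 'rV[R]_N.+1) (f : 'rV[R]_N.+1 -> R).

Definition basis (i : 'I_N.+1) : 'rV[R]_N.+1 := delta_mx 0 i.

(* [pder [:: i1; ..; ij] f] is d_{i1} ... d_{ij} f; the order is [size s]. *)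
Definition pder (s : seq 'I_N.+1) f : 'rV[R]_N.+1 -> R :=
  foldr (fun i g x => 'D_(basis i) g x) f s.

(* The iterated partial derivatives of order up to k exist at the points of U:
   needed because ['D_v] is a total operator. *)
Definition pder_exist (k : nat) U f : Prop :=
  forall s i x, (size s < k)%N -> U x -> derivable (pder s f) x (basis i).

Definition Ck_on (k : nat) U f : Prop :=
  pder_exist k U f /\
  forall s x, (size s <= k)%N -> U x -> {for x, continuous (pder s f)}.

Definition smooth_on U f : Prop := forall k, Ck_on k U f.

(* The norm on row vectors is the sup norm; being equivalent to the Euclidean
   one, it gives the same Hölder functions. *)
Definition holder_on (alpha : R) U f : Prop :=
  exists2 C : R, 0 <= C &
    forall x y, U x -> U y -> `|f x - f y| <= C * `|x - y| `^ alpha.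

Definition Ck_holder_on (k : nat) (alpha : R) U f : Prop :=
  pder_exist k U f /\
  forall s, (size s <= k)%N -> holder_on alpha U (pder s f).

(* f, given on D, extends to D `|` A by a function which is continuous at the
   points of A. *)
Definition extends_continuously D A f : Prop :=
  exists F : 'rV[R]_N.+1 -> R,
    (forall y, D y -> F y = f y) /\
    forall p, A p -> F @ within (D `|` A) (nbhs p) --> F p.

Definition bounded_near D (p : 'rV[R]_N.+1) f : Prop :=
  exists M : R, \forall y \near p, D y -> `|f y| <= M.

End DifferentiabilityClasses.

Section LorentzianMetrics.
Variables (R : realType) (N : nat).
(* Vectors and covectors are rows of components; index 0 is time. *)
Implicit Types (G : 'rV[R]_N.+1 -> 'M[R]_N.+1) (U : set 'rV[R]_N.+1).

Definition minkowski : 'M[R]_N.+1 :=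
  diag_mx (\row_j (if j == ord0 then -1 else 1)).

Definition lorentzian (A : 'M[R]_N.+1) : Prop :=
  A^T = A /\ exists2 P : 'M[R]_N.+1, P \in unitmx & P *m A *m P^T = minkowski.

Definition christoffel G (y : 'rV[R]_N.+1) (l i j : 'I_N.+1) : R :=
  2^-1 * \sum_(s < N.+1) invmx (G y) l s *
    ('D_(basis R i) (fun x => G x j s) y
     + 'D_(basis R j) (fun x => G x i s) y
     - 'D_(basis R s) (fun x => G x i j) y).

(* Affinely parametrized geodesic in (U, G), defined on the open interval
   ]a, b[. *)
Definition geodesic G U (gam : R -> 'rV[R]_N.+1) (a b : R) : Prop :=
  forall s, a < s -> s < b ->
    [/\ U (gam s),
        derivable gam s 1,
        derivable (derive1 gam) s 1 &
        forall l, derive1 (derive1 gam) s 0 l =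
          - \sum_(i < N.+1) \sum_(j < N.+1)
              christoffel G (gam s) l i j
              * derive1 gam s 0 i * derive1 gam s 0 j].

Definition null_vector (A : 'M[R]_N.+1) (v : 'rV[R]_N.+1) : Prop :=
  v != 0 /\ v *m A *m v^T = 0.

(* The null cone emanating from p in (U, G), both its future and past halves,
   with the vertex p removed: the points lying on null geodesics issued
   from p. *)
Definition null_cone G U (p : 'rV[R]_N.+1) : set 'rV[R]_N.+1 :=
  [set q | exists (gam : R -> 'rV[R]_N.+1) (a b s : R),
     [/\ a < 0, 0 < s, s < b & geodesic G U gam a b] /\
     [/\ gam 0 = p, null_vector (G p) (derive1 gam 0) & gam s = q]].

End LorentzianMetrics.

Section MyersPerry.
Variables (R : realType) (n : nat) (m : R) (a : 'I_n./2 -> R).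
Implicit Types (v : 'rV[R]_n.+1) (i : 'I_n./2).

(* With d = n./2, the coordinates (t, x_1, y_1, .., x_d, y_d[, z]) have indices
   0, 1, 2, .., 2d - 1, 2d[, n]. *)
Definition xidx i : 'I_n.+1 := inord i.*2.+1.
Definition yidx i : 'I_n.+1 := inord i.*2.+2.
Definition zidx : 'I_n.+1 := ord_max.

Definition tc v : R := v 0 ord0.
Definition xc v i : R := v 0 (xidx i).
Definition yc v i : R := v 0 (yidx i).
Definition zc v : R := v 0 zidx.

(* For n even [zc] is y_d, but it only occurs multiplied by [eps] = 0. *)
Definition eps : R := (odd n)%:R.

Definition rad v : R :=
  Num.sqrt (\sum_(i < n./2) (xc v i ^+ 2 + yc v i ^+ 2) + eps * zc v ^+ 2).

(* The implicit equation also determines -s; the positive root is meant. *)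
Definition is_rhat v (s : R) : Prop :=
  0 < s /\
  \sum_(i < n./2) (xc v i ^+ 2 + yc v i ^+ 2) / (s ^+ 2 + a i ^+ 2)
    + eps * (zc v ^+ 2 / s ^+ 2) = 1.

(* It contains all the points with rad v larger than every |a i|. *)
Definition mp_domain : set 'rV[R]_n.+1 := [set v | exists s, is_rhat v s].

(* The left-hand side of the equation is decreasing in s > 0, so that there is
   exactly one such s for v in [mp_domain]. *)
Definition rhat v : R := xget 0 [set s | is_rhat v s].

Definition mp_k v : 'rV[R]_n.+1 :=
  basis R ord0
  + \sum_(i < n./2) (rhat v ^+ 2 + a i ^+ 2)^-1 *:
      (rhat v *: (xc v i *: basis R (xidx i) + yc v i *: basis R (yidx i))
       + a i *: (xc v i *: basis R (yidx i) - yc v i *: basis R (xidx i)))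
  + eps *: ((zc v / rhat v) *: basis R zidx).

Definition mp_F v : R :=
  1 - \sum_(i < n./2) a i ^+ 2 * (xc v i ^+ 2 + yc v i ^+ 2)
                      / (rhat v ^+ 2 + a i ^+ 2) ^+ 2.

Definition mp_Pi v : R := \prod_(i < n./2) (rhat v ^+ 2 + a i ^+ 2).

Definition mp_h v : R :=
  2 * m * rhat v ^+ (2 - odd n) / (mp_Pi v * mp_F v).

Definition myers_perry v : 'M[R]_n.+1 :=
  minkowski R n + mp_h v *: ((mp_k v)^T *m mp_k v).

End MyersPerry.

(* Data of a completion near spacelike infinity. Only a neighbourhood of i0 in
   the larger manifold matters, hence it is given in one coordinate chart, as a
   subset of R^(n+1). *)
Record completion (R : realType) (n : nat) := Completion {
  region : set 'rV[R]_n.+1;              (* in the spacetime *)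
  manifold : set 'rV[R]_n.+1;            (* larger manifold, in the chart *)
  emb : 'rV[R]_n.+1 -> 'rV[R]_n.+1;      (* region -> manifold *)
  i0 : 'rV[R]_n.+1;
  Omega : 'rV[R]_n.+1 -> R;              (* on manifold *)
  gtilde : 'rV[R]_n.+1 -> 'M[R]_n.+1     (* on manifold *)
}.

Section ConformalCompletion.
Variables (R : realType) (n : nat) (dom : set 'rV[R]_n.+1)
  (g : 'rV[R]_n.+1 -> 'M[R]_n.+1) (C : completion R n).

Definition physical : set 'rV[R]_n.+1 := emb C @` region C.

Definition added : set 'rV[R]_n.+1 :=
  manifold C `&` (closure physical `\` physical).

Definition scri_plus : set 'rV[R]_n.+1 :=
  [set p | [/\ added p, p != i0 C & forall A : R,
     \forall q \near p, forall x, region C x -> emb C x = q -> A < tc x]].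

Definition scri_minus : set 'rV[R]_n.+1 :=
  [set p | [/\ added p, p != i0 C & forall A : R,
     \forall q \near p, forall x, region C x -> emb C x = q -> tc x < A]].

Definition scri : set 'rV[R]_n.+1 := scri_plus `|` scri_minus.

(* [smooth_embedding] and [conformal] force 'J (emb C) to be invertible, so
   that [emb C] is a diffeomorphism onto its open image. Row i of 'J is the
   image of the i-th basis vector, so [conformal] says that the pullback of
   gtilde is Omega^2 g. *)
Record conformal_completion : Prop := {
  region_open : open (region C);
  region_dom : region C `<=` dom;
  manifold_open : open (manifold C);
  emb_manifold : physical `<=` manifold C;
  emb_inj : {in region C &, injective (emb C)};
  smooth_embedding : forall j, smooth_on (region C) (fun x => emb C x 0 j);
  physical_open : open physical;
  i0_added : added (i0 C);
  added_points : added = [set i0 C] `|` scri;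
  (* The region contains all points sufficiently far in spacelike directions,
     and these approach i0. *)
  spatial_infinity : forall V, nbhs (i0 C) V -> exists r0 : R,
    forall x, `|tc x| + r0 < rad x -> region C x /\ V (emb C x);
  Omega_continuous : forall p, manifold C p -> {for p, continuous (Omega C)};
  Omega_pos : forall y, physical y -> 0 < Omega C y;
  Omega_added : forall p, added p -> Omega C p = 0;
  gtilde_lorentzian : forall y, manifold C y -> lorentzian (gtilde C y);
  conformal : forall x, region C x ->
    'J (emb C) x *m gtilde C (emb C x) *m ('J (emb C) x)^T =
    (Omega C (emb C x)) ^+ 2 *: g x
}.

End ConformalCompletion.

(* Main.v *)
Require Import Defs.
From mathcomp Require Import ring lra zify.
Set Implicit Arguments.
Unset Strict Implicit.
Unset Printing Implicit Defensive.
Local Open Scope classical_set_scope.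
Local Open Scope ring_scope.

(* Invert the coordinates, y = x / eta(x, x), and take Omega = eta(y, y). With
   w = eta(y, y), the function R = w rhat solves the defining equation with a_i
   replaced by a_i w, in which w = 0 is no longer singular; hence the rescaled
   metric is eta + H q (x) q, where all of R, H, q are obtained from y and w by
   algebraic operations and one implicit equation, and where each of them behaves
   like a homogeneous function of y: its j-th derivatives are O(|y|^(p - j)).
   Counting degrees, H q (x) q has p = n - 2, which gives C^(n-3,1) at y = 0.
   The implicit equation degenerates on the time axis only, where it is modified
   by a term sigma that vanishes to high order on the light cone.
   For null v, q.v and its gradient vanish along the ray y = s v, so that these
   rays are affine geodesics; they are the only ones issued from i0 since the
   Christoffel symbols are Lipschitz.
   For a = 0, the (n-2)-nd time derivative of the time-time component is a
   nonconstant polynomial in t / |x|, hence has no limit at i0. *)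
(** * Functions whose derivatives are O(omega^(p - j)) *)

(** The chart has to be a full neighbourhood of [i0], so the rescaled metric must also be defined on
    the timelike side of the cone, where the spacetime prescribes nothing; near the time axis the
    positive root of the equation for R is lost, which is what forces a correction there. The
    correction only enters through the covector K, and the argument on null rays uses nothing about
    K beyond its regularity: it rests on the shape q = w K - 2 (K.y) y, with the index of the last y
    lowered. The weights are 1 for R, 0 for K, 2 for q and n - 6 for H. The weighted classes control
    the punctured ball only, since omega vanishes at the origin. Positive weight is what carries
    information across the puncture: a function of weight 2 has zero derivative there, and one of
    weight 1 has a bounded gradient and vanishes in the limit, hence is Lipschitz on the whole ball.
    The orders n - 3 and n - 2 in the theorem are those where the weight n - 2 of the perturbation
    has dropped to 1 and to 0. *)

Section Caratheodory.
Variables (R : realType) (V : normedModType R).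

(** The difference quotient of [f] inherits the factorization of its increment and passes to the
    limit termwise. Only directional derivatives of the [u j] are needed, no Fréchet
    differentiability; this serves both as a chain rule and as an implicit function theorem. *)
Lemma is_derive_caratheodory (J : finType) (f : V -> R) (c u : J -> V -> R)
    (x v : V) :
  (\forall y \near x, f y - f x = \sum_j c j y * (u j y - u j x)) ->
  (forall j, {for x, continuous (c j)}) ->
  (forall j, derivable (u j) x v) ->
  is_derive x v f (\sum_j c j x * 'D_v (u j) x).
Proof.
move=> fE cc ud.
have line : h *: v + x @[h --> (0 : R)] --> x.
  rewrite -[X in _ --> X]add0r -(scale0r v).
  by apply: cvgD; [apply: cvgZr_tmp; exact: cvg_id | exact: cvg_cst].
suff lim : h^-1 *: ((f \o shift x) (h *: v) - f x) @[h --> 0^'] -->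
    (\sum_j c j x * 'D_v (u j) x : R^o).
  by split; [apply/cvg_ex; eexists; exact: lim | exact: cvg_lim lim].
apply: (@cvg_trans _ ((\sum_j c j (h *: v + x) *
    (h^-1 *: ((u j \o shift x) (h *: v) - u j x))) @[h --> 0^'])).
  apply: near_eq_cvg; apply: cvg_within.
  have : \forall h \near (0 : R), f (h *: v + x) - f x =
      \sum_j c j (h *: v + x) * (u j (h *: v + x) - u j x) by exact: line fE.
  apply: filterS => h /= ->; rewrite scaler_sumr; apply: eq_bigr => j _.
  by rewrite /= -!/(_ * _) mulrCA.
apply: cvg_big; [exact: add_continuous|move=> j _; apply: cvgM].
  apply: cvg_within_filter.
  by apply: cvg_comp line _; exact: cc.
exact: ud.
Qed.

End Caratheodory.

Section SymbolClass.
Variables (R : realType) (N : nat).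
Local Notation V := 'rV[R]_N.+1.
Variables (U : set V) (omega : V -> R).
Hypothesis openU : open U.
Hypothesis omega_gt0 : forall x, U x -> 0 < omega x.
Implicit Types (f g : V -> R) (k : nat) (p q : int).

(** Continuity is demanded separately, because the mere existence of partial derivatives does not
    give it. *)
Definition sym_base p f : Prop :=
  (exists C, forall x, U x -> `|f x| <= C * omega x ^ p) /\
  (forall x, U x -> {for x, continuous f}).

(* [sym k p f] : f is k times differentiable on U and its derivatives of order
   j <= k are O(omega ^ (p - j)). *)
Fixpoint sym k p f : Prop :=
  sym_base p f /\
  match k with
  | 0 => True
  | k'.+1 => forall i, (forall x, U x -> derivable f x (basis R i)) /\
                       sym k' (p - 1) ('D_(basis R i) f)
  end.

Lemma sym_sym_base k p f : sym k p f -> sym_base p f.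
Proof. by case: k => [|k] []. Qed.

Lemma sym_bound k p f : sym k p f ->
  exists2 C, 0 < C & forall x, U x -> `|f x| <= C * omega x ^ p.
Proof.
move=> /sym_sym_base [[C HC] _].
exists (`|C| + 1); first by rewrite ltr_wpDl.
move=> x Ux; apply: le_trans (HC x Ux) _; apply: ler_wpM2r.
  by rewrite exprz_ge0 // ltW // omega_gt0.
by rewrite (le_trans (ler_norm C)) // lerDl.
Qed.

Lemma sym_continuous k p f x : sym k p f -> U x -> {for x, continuous f}.
Proof. by move=> /sym_sym_base [_]; apply. Qed.

Lemma sym_derivable k p f i x : sym k.+1 p f -> U x -> derivable f x (basis R i).
Proof. by case=> _ H; apply: (H i).1. Qed.

Lemma sym_D k p f i : sym k.+1 p f -> sym k (p - 1) ('D_(basis R i) f).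
Proof. by case=> _ H; apply: (H i).2. Qed.

Lemma near_eqU f g x : (forall y, U y -> f y = g y) -> U x ->
  \forall y \near x, f y = g y.
Proof.
move=> fg Ux; have := open_nbhs_nbhs (conj openU Ux).
by apply: filterS => y /fg.
Qed.

Lemma continuous_eqU f g x : (forall y, U y -> f y = g y) -> U x ->
  {for x, continuous f} -> {for x, continuous g}.
Proof.
move=> fg Ux; rewrite /prop_for /continuous_at -fg //.
move=> H A /H fA; apply: filterS2 (near_eqU fg Ux) (fA) => y /= E.
by rewrite /preimage /= E.
Qed.

Lemma sym_eq k p f g : (forall x, U x -> f x = g x) -> sym k p f -> sym k p g.
Proof.
have Hb q h h' : (forall x, U x -> h x = h' x) -> sym_base q h -> sym_base q h'.
  move=> hh' [[C HC] Hc]; split; first by exists C => x Ux; rewrite -hh' // HC.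
  by move=> x Ux; apply: continuous_eqU (Hc x Ux).
elim: k p f g => [|k IH] p f g fg [Hbf H]; (split=> //; first exact: Hb Hbf).
move=> i; split=> [x Ux|].
  by apply: near_eq_derivable ((H i).1 x Ux); exact: (near_eqU fg Ux).
by apply: IH (H i).2 => x Ux; apply: near_eq_derive; exact: (near_eqU fg Ux).
Qed.

Lemma symS k p f : sym k.+1 p f -> sym k p f.
Proof.
elim: k p f => [|k IH] p f [Hb H]; split=> // i.
by split; [exact: (H i).1 | exact: IH (H i).2].
Qed.

Lemma symW k k' p f : (k' <= k)%N -> sym k p f -> sym k' p f.
Proof.
elim: k => [|k IH]; first by rewrite leqn0 => /eqP ->.
by rewrite leq_eqVlt => /predU1P [->//|/IH H /symS].
Qed.

Lemma sym0 k p : sym k p (fun _ => 0).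
Proof.
have Hb q : sym_base q (fun _ => 0).
  by split=> [|x _]; [exists 0 => x _; rewrite normr0 mul0r | exact: cst_continuous].
elim: k p => [|k IH] p; split=> // i; split=> [x _|]; first exact: derivable_cst.
by apply: sym_eq (IH _) => x _; rewrite derive_cst.
Qed.

Lemma sym_cst k c : sym k 0 (fun _ => c).
Proof.
have Hb : sym_base 0 (fun _ => c).
  split=> [|x _]; last exact: cst_continuous.
  by exists `|c| => x _; rewrite expr0z mulr1.
case: k => [|k]; split=> // i; split=> [x _|]; first exact: derivable_cst.
by apply: sym_eq (sym0 _ _) => x _; rewrite derive_cst.
Qed.

Lemma symD k p f g : sym k p f -> sym k p g -> sym k p (fun x => f x + g x).
Proof.
have Hb q h h' : sym_base q h -> sym_base q h' -> sym_base q (fun x => h x + h' x).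
  move=> [[C HC] Hc] [[C' HC'] Hc']; split=> [|x Ux].
    exists (C + C') => x Ux; rewrite mulrDl; apply: le_trans (ler_normD _ _) _.
    by rewrite lerD // (HC, HC').
  by apply: continuousD; [exact: Hc | exact: Hc'].
elim: k p f g => [|k IH] p f g [Hbf H] [Hbg H']; (split=> //; first exact: Hb).
move=> i; split=> [x Ux|].
  by apply: derivableD; [exact: (H i).1 | exact: (H' i).1].
apply: sym_eq (IH _ _ _ (H i).2 (H' i).2) => x Ux.
by rewrite deriveD //; [exact: (H i).1 | exact: (H' i).1].
Qed.

Lemma symM k p q f g : sym k p f -> sym k q g -> sym k (p + q) (fun x => f x * g x).
Proof.
have Hb p' q' h h' : sym_base p' h -> sym_base q' h' ->
    sym_base (p' + q') (fun x => h x * h' x).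
  move=> [[C HC] Hc] [[C' HC'] Hc']; split=> [|x Ux].
    exists (C * C') => x Ux; rewrite normrM expfzDr ?gt_eqF ?omega_gt0 //.
    by rewrite mulrACA; apply: ler_pM => //; rewrite (HC, HC').
  by apply: continuousM; [exact: Hc | exact: Hc'].
elim: k p q f g => [|k IH] p q f g Hf Hg;
  (split=> //; first exact: Hb (sym_sym_base Hf) (sym_sym_base Hg)).
move=> i; split=> [x Ux|].
  by apply: derivableM; [exact: sym_derivable Hf _ | exact: sym_derivable Hg _].
have H1 := IH _ _ _ _ (symS Hf) (sym_D i Hg).
have H2 := IH _ _ _ _ (symS Hg) (sym_D i Hf).
have e1 : p + (q - 1) = p + q - 1 by rewrite addrA.
have e2 : q + (p - 1) = p + q - 1 by rewrite addrA (addrC q).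
rewrite e1 in H1; rewrite e2 in H2.
apply: sym_eq (symD H1 H2) => x Ux.
by rewrite deriveM //; [exact: sym_derivable Hf _ | exact: sym_derivable Hg _].
Qed.

Lemma symZ k p c f : sym k p f -> sym k p (fun x => c * f x).
Proof. by move=> H; rewrite -[p]add0r; apply: symM => //; apply: sym_cst. Qed.

Lemma symN k p f : sym k p f -> sym k p (fun x => - f x).
Proof. by move=> H; apply: sym_eq (symZ (-1) H) => x _; rewrite mulN1r. Qed.

Lemma symB k p f g : sym k p f -> sym k p g -> sym k p (fun x => f x - g x).
Proof. by move=> Hf Hg; apply: symD => //; apply: symN. Qed.

Lemma sym_sum (I : Type) (r : seq I) (P : pred I) k p (f : I -> V -> R) :
  (forall i, P i -> sym k p (f i)) -> sym k p (fun x => \sum_(i <- r | P i) f i x).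
Proof.
move=> H; elim: r => [|i r IH].
  by apply: sym_eq (sym0 k p) => x _; rewrite big_nil.
case Pi : (P i); last by apply: sym_eq IH => x _; rewrite big_cons Pi.
by apply: sym_eq (symD (H i Pi) IH) => x _; rewrite big_cons Pi.
Qed.

Lemma sym_prod (I : Type) (r : seq I) k p (f : I -> V -> R) :
  (forall i, sym k p (f i)) ->
  sym k (p *+ size r) (fun x => \prod_(i <- r) f i x).
Proof.
move=> H; elim: r => [|i r IH].
  by apply: sym_eq (sym_cst k 1) => x _; rewrite big_nil.
rewrite mulrS.
by apply: sym_eq (symM (H i) IH) => x _; rewrite big_cons.
Qed.

Lemma symX k p f j : sym k p f -> sym k (p *+ j) (fun x => f x ^+ j).
Proof.
move=> H; elim: j => [|j IH]; first exact: sym_cst.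
by rewrite mulrS; apply: sym_eq (symM H IH) => x _; rewrite exprS.
Qed.

(** The lower bound is an ellipticity condition at the exact weight of [f]. The derivative of the
    inverse contains the inverse itself, with one derivative less to control, and the weights add up
    to -p - p + (p - 1). *)
Lemma symV k p f c : 0 < c -> (forall x, U x -> c * omega x ^ p <= `|f x|) ->
  sym k p f -> sym k (- p) (fun x => (f x)^-1).
Proof.
move=> c0 fc; have f0 x : U x -> f x != 0.
  move=> Ux; rewrite -normr_gt0; apply: lt_le_trans (fc x Ux).
  by rewrite mulr_gt0 // exprz_gt0 // omega_gt0.
have Hb : sym_base p f -> sym_base (- p) (fun x => (f x)^-1).
  move=> [_ Hc]; split=> [|x Ux].
    exists c^-1 => x Ux; rewrite normfV -invr_expz -invfM lef_pV2 ?fc //.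
      by rewrite posrE normr_gt0 f0.
    by rewrite posrE mulr_gt0 // exprz_gt0 // omega_gt0.
  by apply: continuousV; [exact: f0 | exact: Hc].
elim: k => [|k IH] Hf; (split=> //; first exact: Hb (sym_sym_base Hf)).
move=> i; split=> [x Ux|].
  by apply: derivableV; [exact: f0 | exact: sym_derivable Hf Ux].
have H1 := IH (symS Hf).
have H2 := symN (symM (symM H1 H1) (sym_D i Hf)).
have e : - p - p + (p - 1) = - p - 1 by rewrite addrA subrK.
rewrite e in H2; apply: sym_eq H2 => x Ux.
rewrite deriveV ?f0 //; last exact: sym_derivable Hf Ux.
by rewrite -exprVn expr2 -[_ *: _]/(_ * _) mulNr.
Qed.

Lemma sym_coord k j : (forall x, U x -> `|x 0 j| <= omega x) ->
  sym k 1 (fun x : V => x 0 j).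
Proof.
move=> H.
have D i x : is_derive x (basis R i) (fun x : V => x 0 j) ((basis R i) 0 j).
  have Hd : derivable (id : V -> V) x (basis R i) by exact: derivable_id.
  split; first exact: ((derivable_mxP id x (basis R i)).1 Hd 0 j).
  have /matrixP /(_ 0 j) := derive_mx Hd; rewrite [RHS]mxE => <-.
  by rewrite derive_id.
have Hb : sym_base 1 (fun x : V => x 0 j).
  split=> [|x Ux]; last exact: coord_continuous.
  by exists 1 => x Ux; rewrite expr1z mul1r H.
case: k => [|k]; split=> // i; split=> [x Ux|]; first by case: (D i x).
by rewrite subrr; apply: sym_eq (sym_cst k (basis R i 0 j)) => x Ux; rewrite derive_val.
Qed.

(* The derivatives may be expressed through f itself, as for an implicit
   function: the regularity then improves by bootstrapping. *)
Lemma sym_bootstrap k p f (G : 'I_N.+1 -> V -> R) :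
  sym 0 p f ->
  (forall i x, U x -> is_derive x (basis R i) f (G i x)) ->
  (forall k', (k' < k)%N -> sym k' p f -> forall i, sym k' (p - 1) (G i)) ->
  sym k p f.
Proof.
move=> H0 HD HG; elim: k HG => [//|k IH] HG.
have Hf : sym k p f by apply: IH => k' kk'; apply: HG; apply: ltnW.
have [Hb _] := H0; split=> // i; split=> [x Ux|]; first by case: (HD i x Ux).
by apply: sym_eq (HG k (leqnn _) Hf i) => x Ux; have [_ ->] := HD i x Ux.
Qed.

Lemma sym_pder k p f s : (size s <= k)%N -> sym k p f ->
  sym (k - size s) (p - (size s)%:Z) (pder s f).
Proof.
(* The last index of [s] is the derivative applied first, so the list is peeled from the right. *)
elim/last_ind: s k p f => [|s i IH] k p f; first by rewrite subn0 subr0.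
rewrite size_rcons; case: k => // k sk H.
rewrite /pder foldr_rcons -/(pder s _) subSS.
have := IH _ _ _ sk (sym_D i H).
by rewrite intS opprD addrA.
Qed.

Hypothesis omega_le1 : forall x, U x -> omega x <= 1.

Lemma omega_exp_le p q x : (q <= p)%R -> U x -> omega x ^ p <= omega x ^ q.
Proof.
move=> qp Ux; have x0 := omega_gt0 Ux.
have -> : p = q + `|p - q|%N by rewrite gez0_abs ?subr_ge0 // addrCA subrr addr0.
rewrite expfzDr ?gt_eqF //; apply: ler_piMr; first by rewrite exprz_ge0 // ltW.
by rewrite -exprnP; apply: exprn_ile1; [exact: ltW | exact: omega_le1].
Qed.

(** Since [omega <= 1], a larger weight is a stronger condition; terms of higher order can thus be
    absorbed in sums. *)
Lemma sym_le k p q f : (q <= p)%R -> sym k p f -> sym k q f.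
Proof.
have Hb p' q' h : (q' <= p')%R -> sym_base p' h -> sym_base q' h.
  move=> qp [[C HC] Hc]; split=> //; exists `|C| => x Ux.
  apply: le_trans (HC x Ux) _; apply: (@le_trans _ _ (`|C| * omega x ^ p')).
    by apply: ler_wpM2r; [rewrite exprz_ge0 // ltW // omega_gt0 | exact: ler_norm].
  by apply: ler_wpM2l => //; apply: omega_exp_le.
elim: k p q f => [|k IH] p q f qp [Hbf H]; (split=> //; first exact: Hb Hbf).
by move=> i; split; [exact: (H i).1 | apply: IH (H i).2; rewrite lerD2r].
Qed.

End SymbolClass.

Lemma sym_sub (R : realType) (N : nat) (U U' : set 'rV[R]_N.+1) (omega : 'rV[R]_N.+1 -> R)
    k p (f : 'rV[R]_N.+1 -> R) :
  U `<=` U' -> sym U' omega k p f -> sym U omega k p f.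
Proof.
move=> UU'; elim: k p f => [|k IH] p f [[[C HC] Hc] H];
  (split=> //; first by split; [exists C => x /UU' /HC | move=> x /UU' /Hc]).
by move=> i; split; [move=> x /UU'; exact: (H i).1 | exact: IH (H i).2].
Qed.

(** * Chain rule, truncated powers and square roots *)

Section Composition.
Variables (R : realType) (V : normedModType R).

(** The Carathéodory slope of [phi], composed with [f], is a continuous coefficient for the
    increment of the composite. *)
Lemma is_derive_comp1 (phi : R -> R) (f : V -> R) (x v : V) a :
  is_derive (f x) 1 phi a -> {for x, continuous f} -> derivable f x v ->
  is_derive x v (phi \o f) (a * 'D_v f x).
Proof.
move=> /is_derive1_caratheodory [g [gE gc <-]] fc fd.
have := @is_derive_caratheodory R V unit (phi \o f) (fun _ => g \o f)
  (fun _ => f) x v.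
rewrite big_const card_unit /= addr0; apply=> [|_|//].
  by apply: nearW => y; rewrite big_const card_unit /= addr0.
exact: continuous_comp.
Qed.

(** [|u| - u] is twice the negative part of [u]; a power at least 2 of it is differentiable also at
    0, where its slope is again such a power, with exponent one less, times -2. *)
Lemma is_derive_negpow (N : nat) (x : R) :
  is_derive x 1 (fun u : R => (`|u| - u) ^+ N.+2)
    (- (2 * N.+2%:R) * (`|x| - x) ^+ N.+1).
Proof.
have [x0|x0|->] := ltgtP x 0.
- apply: (@near_eq_is_derive _ _ _ (fun u : R => (-2 * u) ^+ N.+2)).
    have : \forall u \near x, u < 0 by apply: lt_nbhsl.
    by apply: filterS => u u0; rewrite ltr0_norm //; congr (_ ^+ _); ring.
  rewrite ltr0_norm //.
  have -> : (fun u : R => (-2 * u) ^+ N.+2) = ((-2 : R) *: (id : R -> R)) ^+ N.+2.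
    by apply/funext => u; rewrite exprfctE.
  have H := is_deriveX N.+2 (is_deriveZ (-2 : R) (is_derive_id x (1 : R))).
  apply: (is_derive_eq H).
  have -> : - x - x = -2 * x by ring.
  transitivity ((N.+2%:R * (-2 * x) ^+ N.+1) * (-2 * 1)); first by [].
  by move: N.+2%:R ((-2 * x) ^+ N.+1) => u w; ring.
- apply: (@near_eq_is_derive _ _ _ (fun _ : R => 0)).
    have : \forall u \near x, 0 < u by apply: lt_nbhsr.
    by apply: filterS => u u0; rewrite gtr0_norm // subrr expr0n.
  by rewrite gtr0_norm // subrr expr0n /= mulr0; exact: is_derive_cst.
- apply/is_derive1_caratheodory; exists (fun z => -2 * (`|z| - z) ^+ N.+1).
  split; last by rewrite normr0 subrr expr0n /= !mulr0.
    move=> z; rewrite normr0 !subr0 expr0n /= subr0 exprS.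
    have [z0|z0] := leP 0 z; first by rewrite ger0_norm // subrr !expr0n /= !(mulr0,mul0r).
    by rewrite ltr0_norm //; ring.
  apply: continuousM; first exact: cst_continuous.
  apply: (@continuous_comp _ _ _ (fun z : R => `|z| - z) (fun z => z ^+ N.+1)).
    by apply: continuousB; [exact: norm_continuous | exact: cvg_id].
  exact: exprn_continuous.
Qed.

End Composition.

Section SymbolComposition.
Variables (R : realType) (N : nat).
Local Notation V := 'rV[R]_N.+1.
Variables (U : set V) (omega : V -> R).
Hypothesis openU : open U.
Hypothesis omega_gt0 : forall x, U x -> 0 < omega x.
Implicit Types (f g : V -> R) (k : nat) (p q : int).
Local Notation sym := (sym U omega).

(** Each differentiation lowers the exponent by one, and [k < j] keeps it at least 2 whenever a
    further derivative is taken. *)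
Lemma sym_negpow k p f j : (k < j)%N -> sym k p f ->
  sym k (p *+ j.+1) (fun x => (`|f x| - f x) ^+ j.+1).
Proof.
have Hb i f' : sym 0 p f' -> sym_base U omega (p *+ i) (fun x => (`|f' x| - f' x) ^+ i).
  move=> Hf; split=> [|x Ux].
    have [C C0 HC] := sym_bound omega_gt0 Hf.
    exists ((2 * C) ^+ i) => x Ux; rewrite normrX.
    have -> : omega x ^ (p *+ i) = (omega x ^ p) ^+ i.
      by rewrite exprnP exprz_exp -mulr_natr natz.
    have w0 : 0 <= omega x ^ p by rewrite exprz_ge0 // ltW // omega_gt0.
    rewrite -exprMn -mulrA; apply: lerXn2r; rewrite ?nnegrE ?mulr_ge0 ?(ltW C0) //.
    apply: le_trans (ler_normB _ _) _; rewrite normr_id mulr_natl mulr2n.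
    by rewrite lerD ?HC.
  apply: (@continuous_comp _ _ _ (fun z => `|f' z| - f' z) (fun z => z ^+ i)).
    have fc := sym_continuous Hf Ux.
    apply: continuousB => //.
    by apply: (@continuous_comp _ _ _ f' (fun z => `|z|)) => //; exact: norm_continuous.
  exact: exprn_continuous.
elim: k p f j Hb => [|k IH] p f j Hb kj Hf.
  by split=> //; apply: Hb.
split; first by apply: Hb; apply: symW Hf.
case: j kj => // j kj i.
have D x : U x -> is_derive x (basis R i) (fun x => (`|f x| - f x) ^+ j.+2)
   (- (2 * j.+2%:R) * (`|f x| - f x) ^+ j.+1 * 'D_(basis R i) f x).
  move=> Ux; apply: (is_derive_comp1 (phi := fun u => (`|u| - u) ^+ j.+2)).
  - exact: is_derive_negpow.
  - exact: sym_continuous Hf Ux.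
  - exact: sym_derivable Hf Ux.
split=> [x Ux|]; first by case: (D x Ux).
have H1 := IH p f j Hb kj (symS Hf).
have H2 := symZ openU omega_gt0 (- (2 * j.+2%:R))
  (symM openU omega_gt0 H1 (sym_D i Hf)).
have e : p *+ j.+1 + (p - 1) = p *+ j.+2 - 1 by rewrite addrA -mulrSr.
rewrite e in H2; apply: sym_eq H2 => // x Ux.
by have [_ ->] := D x Ux; rewrite mulrA.
Qed.

(** The derivative is [(2 * Num.sqrt (f x))^-1] times that of [f], so regularity of the root at one
    order yields the next by [sym_bootstrap]. *)
Lemma sym_sqrt k p f c : 0 < c ->
  (forall x, U x -> c * omega x ^ (p + p) <= f x) ->
  sym k (p + p) f -> sym k p (fun x => Num.sqrt (f x)).
Proof.
move=> c0 fc Hf.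
have f0 x : U x -> 0 < f x.
  by move=> Ux; apply: lt_le_trans (fc x Ux); rewrite mulr_gt0 // exprz_gt0 // omega_gt0.
have sq x : U x -> Num.sqrt (omega x ^ (p + p)) = omega x ^ p.
  move=> Ux; rewrite expfzDr ?gt_eqF ?omega_gt0 // -expr2 sqrtr_sqr.
  by rewrite ger0_norm // exprz_ge0 // ltW // omega_gt0.
have lb x : U x -> Num.sqrt c * omega x ^ p <= Num.sqrt (f x).
  by move=> Ux; rewrite -sq // -sqrtrM ?(ltW c0) //; apply/ler_wsqrtr/fc.
pose G i x := (2 * Num.sqrt (f x))^-1 * 'D_(basis R i) f x.
have H0 : sym 0 p (fun x => Num.sqrt (f x)).
  split=> //; split=> [|x Ux].
    have [C C0 HC] := sym_bound omega_gt0 Hf; exists (Num.sqrt C) => x Ux.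
    rewrite ger0_norm ?sqrtr_ge0 // -sq // -sqrtrM ?(ltW C0) //; apply: ler_wsqrtr.
    exact: le_trans (ler_norm _) (HC x Ux).
  apply: (@continuous_comp _ _ _ f Num.sqrt); last exact: sqrt_continuous.
  exact: sym_continuous Hf Ux.
case: k Hf => [//|k] Hf.
apply: (sym_bootstrap openU (G := G)) => //.
  move=> i x Ux; apply: (is_derive_comp1 (phi := Num.sqrt)).
  - by apply: is_derive1_sqrt; exact: f0.
  - exact: sym_continuous Hf Ux.
  - exact: sym_derivable Hf Ux.
move=> k' kk' Hs i.
have Hi : sym k' (- p) (fun x => (Num.sqrt (f x))^-1).
  apply: (symV openU omega_gt0 (c := Num.sqrt c)) => //; first by rewrite sqrtr_gt0.
  by move=> x Ux; rewrite ger0_norm ?sqrtr_ge0 // lb.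
have Hd : sym k' (p + p - 1) ('D_(basis R i) f).
  by apply: symW (sym_D i Hf); rewrite -ltnS.
have := symZ openU omega_gt0 2^-1 (symM openU omega_gt0 Hi Hd).
have -> : - p + (p + p - 1) = p - 1 by rewrite !addrA addNr add0r.
by apply: sym_eq => // x Ux; rewrite /G invfM mulrA.
Qed.

End SymbolComposition.

(** * The implicit radial function *)

Lemma continuous_sum (R : realType) (V : normedModType R) (J : finType)
    (f : J -> V -> R) (x : V) :
  (forall j, {for x, continuous (f j)}) ->
  {for x, continuous (fun y => \sum_j f j y)}.
Proof.
move=> fc; rewrite /prop_for /continuous_at; apply: cvg_big => [|j _].
  exact: add_continuous.
exact: fc.
Qed.

Section SecularEquation.
Variables (R : realType) (m : nat).
Implicit Types (r b : 'I_m -> R) (s t : R).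

(** The unknown [s] is the square of the radius. The form is that of the secular equation for a
    rank-one perturbation of a diagonal matrix. *)
Definition secular r b s : R := \sum_j r j / (s + b j).

Lemma sum_gt0_ex r : (forall j, 0 <= r j) -> 0 < \sum_j r j ->
  exists j, 0 < r j.
Proof.
move=> r0 sr; apply/existsP; apply: contraLR sr => /existsPn H.
by rewrite -leNgt; apply: sumr_le0 => j _; rewrite leNgt.
Qed.

Lemma secular_lt r b s t : (forall j, 0 <= r j) -> (forall j, 0 <= b j) ->
  0 < \sum_j r j -> 0 < s -> s < t -> secular r b t < secular r b s.
Proof.
move=> r0 b0 /(sum_gt0_ex r0) [i ri] s0 st.
have t0 := lt_trans s0 st.
have D u j : 0 < u -> 0 < u + b j by move=> u0; rewrite ltr_wpDr.
rewrite /secular (bigD1 i) //= [ltRHS](bigD1 i) //=; apply: ltr_leD.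
  by rewrite ltr_pM2l // ltf_pV2 ?posrE ?D // ltrD2r.
apply: ler_sum => j _; apply: ler_wpM2l => //.
by rewrite lef_pV2 ?posrE ?D // lerD2r ltW.
Qed.

Lemma secular_inj r b s t : (forall j, 0 <= r j) -> (forall j, 0 <= b j) ->
  0 < \sum_j r j -> 0 < s -> 0 < t -> secular r b t = secular r b s -> s = t.
Proof.
move=> r0 b0 sr s0 t0 E; apply/eqP; case: ltgtP => // H.
  by have := secular_lt r0 b0 sr s0 H; rewrite E ltxx.
by have := secular_lt r0 b0 sr t0 H; rewrite E ltxx.
Qed.

(** With S the sum of the [r j], the value 1 lies between the values at S and at S / 2: at S the
    denominators are at least S, and at S / 2 they are at most S by the bound on [b]. *)
Lemma secular_root r b : (forall j, 0 <= r j) -> (forall j, 0 <= b j) ->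
  0 < \sum_j r j -> (forall j, b j <= (\sum_j r j) / 2) ->
  exists s, [/\ (\sum_j r j) / 2 <= s, s <= \sum_j r j & secular r b s = 1].
Proof.
move=> r0 b0; set S := \sum_j r j => S0 bS.
have S20 : 0 < S / 2 by rewrite divr_gt0.
have SS : S / 2 <= S by move: S0; lra.
have D u j : 0 < u -> 0 < u + b j by move=> u0; rewrite ltr_wpDr.
have E1 : \sum_j r j / S = 1 by rewrite -mulr_suml divff // gt_eqF.
have [||s] := @IVT R (secular r b) _ _ 1 SS.
- apply: (@continuous_in_subspaceT _ _ `[S / 2, S]) => s.
  rewrite inE /= in_itv /= => /andP[s0 _].
  apply: (@continuous_sum R R) => j.
  apply: continuousM; first exact: cst_continuous.
  apply: continuousV; first by rewrite gt_eqF // D // (lt_le_trans S20).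
  by apply: continuousD; [exact: cvg_id | exact: cst_continuous].
- have H1 : 1 <= secular r b (S / 2).
    rewrite -[leLHS]E1; apply: ler_sum => j _.
    apply: ler_wpM2l => //; rewrite lef_pV2 ?posrE ?D //.
    by have := bS j; lra.
  have H2 : secular r b S <= 1.
    rewrite -[leRHS]E1; apply: ler_sum => j _.
    by apply: ler_wpM2l => //; rewrite lef_pV2 ?posrE ?D // lerDl.
  by rewrite ge_min le_max H1 H2 orbT.
rewrite in_itv /= => /andP[H1 H2] H3; exists s; split=> //.
Qed.

End SecularEquation.

(** * Regularity of the root of the secular equation *)

Section ImplicitRoot.
Variables (R : realType) (N m : nat).
Local Notation V := 'rV[R]_N.+1.
Variables (U : set V) (omega : V -> R).
Hypothesis openU : open U.
Hypothesis omega_gt0 : forall x, U x -> 0 < omega x.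
Local Notation sym := (sym U omega).
Variables (k : nat) (r b : 'I_m -> V -> R) (B : V -> R).
Hypothesis sym_r : forall j, sym k 2 (r j).
Hypothesis sym_b : forall j, sym k 2 (b j).
Hypothesis r_ge0 : forall j x, U x -> 0 <= r j x.
Hypothesis b_ge0 : forall j x, U x -> 0 <= b j x.
Variables (c C : R).
Hypothesis c_gt0 : 0 < c.
Hypothesis B_ge : forall x, U x -> c * omega x ^ 2 <= B x.
Hypothesis B_le : forall x, U x -> B x <= C * omega x ^ 2.
Hypothesis B_root : forall x, U x -> secular (r ^~ x) (b ^~ x) (B x) = 1.

Let B_gt0 x : U x -> 0 < B x.
Proof.
by move=> Ux; apply: lt_le_trans (B_ge Ux); rewrite mulr_gt0 // exprz_gt0 // omega_gt0.
Qed.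

Let D_gt0 x y j : U x -> U y -> 0 < B x + b j y.
Proof. by move=> Ux Uy; rewrite ltr_wpDr ?b_ge0 ?B_gt0. Qed.

Let r_sum x : U x -> 0 < \sum_j r j x.
Proof.
move=> Ux; rewrite lt0r sumr_ge0 ?andbT; last by move=> j _; apply: r_ge0.
apply/negP => /eqP H.
have := B_root Ux; rewrite /secular big1 => [/eqP|j _]; first by rewrite eq_sym oner_eq0.
have -> : r j x = 0; last by rewrite mul0r.
by move: H => /psumr_eq0P; apply=> // i _; apply: r_ge0.
Qed.

Lemma secular_continuous x s : U x -> 0 < s ->
  {for x, continuous (fun y => secular (r ^~ y) (b ^~ y) s)}.
Proof.
move=> Ux s0; apply: continuous_sum => j.
apply: continuousM; first exact: sym_continuous (sym_r j) Ux.
apply: continuousV; first by rewrite gt_eqF // ltr_wpDr // b_ge0.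
by apply: continuousD; [exact: cst_continuous | exact: sym_continuous (sym_b j) Ux].
Qed.

(** By strict monotonicity the secular function is on opposite sides of 1 at [B x - e'] and
    [B x + e']. For fixed argument it is continuous in the parameters, so this persists for [y] near
    [x] and traps [B y]. The minimum with [B x / 2] keeps the lower argument positive. *)
Lemma root_continuous x : U x -> {for x, continuous B}.
Proof.
move=> Ux; rewrite /prop_for /continuous_at; apply/(@cvgrPdist_lt _ _ _ (nbhs x)) => e e0.
pose e' := Num.min e (B x / 2).
have B0 := B_gt0 Ux.
have e'0 : 0 < e' by rewrite lt_min e0 divr_gt0.
have e'B : 0 < B x - e'.
  rewrite subr_gt0; apply: (@le_lt_trans _ _ (B x / 2)); first by rewrite ge_min lexx orbT.
  by move: B0; lra.
have r0 y : U y -> forall j, 0 <= r j y by move=> Uy j; apply: r_ge0.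
have b0 y : U y -> forall j, 0 <= b j y by move=> Uy j; apply: b_ge0.
have H1 : \forall y \near x, secular (r ^~ y) (b ^~ y) (B x + e') < 1.
  have := @secular_continuous x (B x + e') Ux (addr_gt0 B0 e'0).
  move/cvgr_lt; apply; rewrite -(B_root Ux).
  by apply: (secular_lt (r0 x Ux) (b0 x Ux) (r_sum Ux) B0); rewrite ltrDl.
have H2 : \forall y \near x, 1 < secular (r ^~ y) (b ^~ y) (B x - e').
  have := @secular_continuous x (B x - e') Ux e'B.
  move/cvgr_gt; apply; rewrite -(B_root Ux).
  by apply: (secular_lt (r0 x Ux) (b0 x Ux) (r_sum Ux) e'B); rewrite gtrBl.
have := open_nbhs_nbhs (conj openU Ux).
apply: filterS3 H1 H2 => y H1 H2 Uy.
have mono := secular_lt (r0 y Uy) (b0 y Uy) (r_sum Uy).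
apply: (@lt_le_trans _ _ e'); last by rewrite ge_min lexx.
have L1 : B x - e' < B y.
  rewrite ltNge; apply/negP; rewrite le_eqVlt => /predU1P[E|L].
    by move: H2; rewrite -E B_root // ltxx.
  by have := lt_trans H2 (mono _ _ (B_gt0 Uy) L); rewrite B_root // ltxx.
have L2 : B y < B x + e'.
  rewrite ltNge; apply/negP; rewrite le_eqVlt => /predU1P[E|L].
    by move: H1; rewrite E B_root // ltxx.
  by have := lt_trans (mono _ _ (addr_gt0 B0 e'0) L) H1; rewrite B_root // ltxx.
rewrite ltr_norml; apply/andP; split; lra.
Qed.

(** A divided difference: [Q x x] is minus the derivative of the secular function at its root. *)
Let Q x y := \sum_j r j x / ((B y + b j y) * (B x + b j x)).

Let Q_gt0 x y : U x -> U y -> 0 < Q x y.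
Proof.
move=> Ux Uy; have [i ri] := sum_gt0_ex (fun j => r_ge0 j Ux) (r_sum Ux).
rewrite /Q (bigD1 i) //= ltr_pwDl //.
  by rewrite divr_gt0 // mulr_gt0 // D_gt0.
by apply: sumr_ge0 => j _; rewrite divr_ge0 ?r_ge0 // mulr_ge0 // ltW // D_gt0.
Qed.

Let cf x (j : 'I_m + 'I_m) y :=
  match j with
  | inl j => (B y + b j y)^-1 / Q x y
  | inr j => - (r j x / ((B y + b j y) * (B x + b j x))) / Q x y
  end.

Let uf (j : 'I_m + 'I_m) := match j with inl j => r j | inr j => b j end.

(** The equations at [x] and [y] are subtracted and solved for [B y - B x]. The identity is exact,
    with coefficients continuous in [y], as [is_derive_caratheodory] requires. *)
Let increment x y : U x -> U y ->
  B y - B x = \sum_j cf x j y * (uf j y - uf j x).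
Proof.
move=> Ux Uy; apply: (mulIf (lt0r_neq0 (Q_gt0 Ux Uy))).
rewrite big_sumType /= [in RHS]mulrDl !mulr_suml.
have q0 := lt0r_neq0 (Q_gt0 Ux Uy).
rewrite -big_split /=.
have -> : (B y - B x) * Q x y =
    \sum_j (B y - B x) * (r j x / ((B y + b j y) * (B x + b j x))).
  by rewrite /Q mulr_sumr.
have : \sum_j (r j y / (B y + b j y) - r j x / (B x + b j x)) = 0.
  by rewrite sumrB; have := B_root Ux; have := B_root Uy; rewrite /secular => -> ->; rewrite subrr.
move=> E; rewrite -[LHS]addr0 -[X in _ + X = _]E -big_split /=; apply: eq_bigr => j _.
have := lt0r_neq0 (D_gt0 j Ux Ux); have := lt0r_neq0 (D_gt0 j Uy Uy) => h1 h2.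
field.
by rewrite q0 h1 h2.
Qed.

Let cf_continuous x j : U x -> {for x, continuous (cf x j)}.
Proof.
move=> Ux.
have Dc i : {for x, continuous (fun y => B y + b i y)}.
  by apply: continuousD; [exact: root_continuous | exact: sym_continuous (sym_b i) Ux].
have Dc2 i : {for x, continuous (fun y => r i x / ((B y + b i y) * (B x + b i x)))}.
  apply: continuousM; first exact: cst_continuous.
  apply: continuousV; first by rewrite lt0r_neq0 // mulr_gt0 // D_gt0.
  by apply: continuousM; [exact: Dc | exact: cst_continuous].
have Qc : {for x, continuous (fun y => (Q x y)^-1)}.
  apply: continuousV; first by rewrite lt0r_neq0 // Q_gt0.
  by apply: continuous_sum => i; exact: Dc2.
case: j => j; apply: continuousM => //.
  by apply: continuousV; [rewrite lt0r_neq0 // D_gt0 | exact: Dc].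
by apply: continuousN; exact: Dc2.
Qed.

(** The gradient of the root is an algebraic expression in [B], [r], [b] and the gradients of [r]
    and [b]; its weight is 1 as soon as [B] has weight 2 at the same order, so [sym_bootstrap]
    applies. *)
Lemma sym_secular_root : sym k 2 B.
Proof.
have H0 : sym 0 2 B.
  split=> //; split=> [|x Ux]; last exact: root_continuous.
  by exists C => x Ux; rewrite ger0_norm ?B_le // ltW // B_gt0.
have near_inc x : U x -> \forall y \near x,
    B y - B x = \sum_j cf x j y * (uf j y - uf j x).
  move=> Ux; have := open_nbhs_nbhs (conj openU Ux).
  by apply: filterS => y Uy; apply: increment.
case: k sym_r sym_b => [//|k0] Hr Hb.
pose G i x := \sum_j cf x j x * 'D_(basis R i) (uf j) x.
apply: (sym_bootstrap openU (G := G)) => //.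
  move=> i x Ux; apply: is_derive_caratheodory; first exact: near_inc.
    by move=> j; apply: cf_continuous.
  by move=> [j|j]; [exact: sym_derivable (Hr j) Ux | exact: sym_derivable (Hb j) Ux].
move=> k' kk' HB i.
have HD j : sym k' 2 (fun x => B x + b j x).
  by apply: symD => //; apply: symW (Hb j); apply: ltnW.
have HDV j : sym k' (- 2) (fun x => (B x + b j x)^-1).
  apply: (symV openU omega_gt0 c_gt0 _ (HD j)) => x Ux.
  rewrite ger0_norm ?(ltW (D_gt0 _ _ _)) //.
  by apply: le_trans (B_ge Ux) _; rewrite lerDl b_ge0.
have HQ : sym k' (- 2) (fun x => Q x x).
  apply: sym_sum => // j _.
  have Hj : sym k' 2 (r j) by apply: symW (Hr j); apply: ltnW.
  have := symM openU omega_gt0 Hj (symM openU omega_gt0 (HDV j) (HDV j)).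
  by apply: sym_eq => // x Ux; rewrite invfM.
have [Cb Cb0 HCb] : exists2 Cb, 0 < Cb & forall j x, U x -> B x + b j x <= Cb * omega x ^ 2.
  have H j := sym_bound omega_gt0 (HD j).
  have [f Hf] := choice (fun j => (let: ex_intro2 c0 h1 h2 := H j in ex_intro (fun c0 => 0 < c0 /\ _) c0 (conj h1 h2))).
  exists (1 + \sum_j f j).
    by rewrite ltr_pwDl // sumr_ge0 // => j _; apply: ltW; apply: (Hf j).1.
  move=> j x Ux; apply: le_trans (ler_norm _) _; apply: le_trans ((Hf j).2 x Ux) _.
  apply: ler_wpM2r; first by rewrite exprz_ge0 // ltW // omega_gt0.
  rewrite (bigD1 j) //= addrCA lerDl addr_ge0 // sumr_ge0 // => l _.
  by apply: ltW; apply: (Hf l).1.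
(* By the equation the numbers r_j / (B + b_j) are weights of sum 1, and [Q x x] is the
   corresponding mean of the 1 / (B + b_j); it is therefore at least the inverse of the common upper
   bound [Cb * omega x ^ 2]. *)
have HQV : sym k' 2 (fun x => (Q x x)^-1).
  rewrite -[2]opprK; apply: (symV openU omega_gt0 (c := Cb^-1) _ _ HQ).
    by rewrite invr_gt0.
  move=> x Ux; rewrite ger0_norm ?(ltW (Q_gt0 Ux Ux)) // -invr_expz -invfM.
  rewrite -[leLHS]mul1r -(B_root Ux) /secular mulr_suml /Q; apply: ler_sum => j _.
  rewrite [X in _ <= _ * X]invfM [leRHS]mulrA; apply: ler_wpM2l.
    by rewrite divr_ge0 ?r_ge0 // ltW // D_gt0.
  have w0 : 0 < omega x ^ 2 by rewrite exprz_gt0 // omega_gt0.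
  by rewrite lef_pV2 ?posrE; [exact: HCb | exact: mulr_gt0 | exact: D_gt0].
have Hr1 j : sym k' 1 ('D_(basis R i) (r j)).
  by have := sym_D i (Hr j); apply: symW; rewrite -ltnS.
have Hb1 j : sym k' 1 ('D_(basis R i) (b j)).
  by have := sym_D i (Hb j); apply: symW; rewrite -ltnS.
have Hj j : sym k' 2 (r j) by apply: symW (Hr j); apply: ltnW.
have S1 : sym k' 1 (fun x => \sum_j (B x + b j x)^-1 * (Q x x)^-1 * 'D_(basis R i) (r j) x).
  apply: sym_sum => // j _.
  exact: (symM openU omega_gt0 (symM openU omega_gt0 (HDV j) HQV) (Hr1 j)).
have S2 : sym k' 1 (fun x => \sum_j - (r j x * ((B x + b j x)^-1 * (B x + b j x)^-1)) * (Q x x)^-1 * 'D_(basis R i) (b j) x).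
  apply: sym_sum => // j _.
  have Hn := symN openU omega_gt0
    (symM openU omega_gt0 (Hj j) (symM openU omega_gt0 (HDV j) (HDV j))).
  exact: (symM openU omega_gt0 (symM openU omega_gt0 Hn HQV) (Hb1 j)).
have := symD openU S1 S2; apply: sym_eq => // x Ux.
rewrite /G big_sumType /=; congr (_ + _); apply: eq_bigr => j _.
by rewrite invfM.
Qed.

End ImplicitRoot.

(** * The rescaled metric in inverted coordinates *)

Section Coordinates.
Variables (R : realType) (n : nat).
Local Notation V := 'rV[R]_n.+1.
Implicit Types (u v y : V).

Lemma sum_pairs (g : nat -> R) (d : nat) :
  \sum_(0 <= j < d.*2.+1) g j =
  g 0%N + \sum_(i < d) (g i.*2.+1 + g i.*2.+2).
Proof.
elim: d => [|d IH]; first by rewrite big_nat1 big_ord0 addr0.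
rewrite doubleS 2?big_nat_recr //= IH big_ord_recr /= -!addrA.
by [].
Qed.

(** For [n] even the last index is that of y_d, already counted among the pairs, and [eps] removes
    the extra term. *)
Lemma sum_coords (f : 'I_n.+1 -> R) :
  \sum_j f j =
  f ord0 + \sum_(i < n./2) (f (xidx i) + f (yidx i)) + eps R n * f (zidx n).
Proof.
have -> : \sum_j f j = \sum_(0 <= j < n.+1) f (inord j).
  by rewrite big_mkord; apply: eq_bigr => j _; rewrite inord_val.
have e0 : f (inord 0) = f ord0 by congr f; apply: val_inj; rewrite /= inordK.
rewrite /eps -{1}(odd_double_half n).
case E: (odd n) => /=; last by rewrite add0n sum_pairs mul0r addr0 e0.
rewrite add1n big_nat_recr //= sum_pairs mul1r e0; congr (_ + f _).
apply: val_inj; rewrite /= inordK.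
all: have := odd_double_half n; rewrite E; lia.
Qed.

Definition sgn (j : 'I_n.+1) : R := if j == ord0 then -1 else 1.

Definition lower v : V := \row_j (sgn j * v 0 j).

Definition dot u v : R := \sum_j u 0 j * v 0 j.

(** The Minkowski square, positive on spacelike vectors; it serves as the conformal factor. *)
Definition sep v : R := \sum_j sgn j * v 0 j ^+ 2.

Definition esq v : R := \sum_j v 0 j ^+ 2.

Definition rho (i : 'I_n./2) v : R := xc v i ^+ 2 + yc v i ^+ 2.

Definition spat v : R := \sum_i rho i v + eps R n * zc v ^+ 2.

Lemma esqE v : esq v = tc v ^+ 2 + spat v.
Proof. by rewrite /esq sum_coords /spat addrA. Qed.

Lemma sep_esq v : sep v = esq v - 2 * tc v ^+ 2.
Proof.
rewrite /sep /esq (bigD1 ord0) //= [in RHS](bigD1 ord0) //= /sgn eqxx /tc.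
rewrite (eq_bigr (fun i => v 0 i ^+ 2)); last first.
  by move=> j /negbTE ->; rewrite mul1r.
by ring.
Qed.

Lemma sepE v : sep v = spat v - tc v ^+ 2.
Proof. by rewrite sep_esq esqE; ring. Qed.

Lemma rho_ge0 i v : 0 <= rho i v.
Proof. by rewrite addr_ge0 // sqr_ge0. Qed.

Lemma eps_ge0 : 0 <= eps R n. Proof. exact: ler0n. Qed.

Lemma spat_ge0 v : 0 <= spat v.
Proof.
apply: addr_ge0; first by apply: sumr_ge0 => i _; exact: rho_ge0.
by apply: mulr_ge0; [exact: eps_ge0 | exact: sqr_ge0].
Qed.

Lemma coord_le_norm v j : `|v 0 j| <= `|v|.
Proof.
rewrite [leRHS]/Num.Def.normr /= mx_normrE.
exact: (le_bigmax _ (fun ij => `|v ij.1 ij.2|) (0, j)).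
Qed.

Lemma norm_attained v : v != 0 -> exists j, `|v| = `|v 0 j|.
Proof.
move=> v0; have : mx_norm v != 0.
  by move: v0; rewrite -normr_eq0.
move=> /mx_norm_neq0 [[i j] /= E]; exists j.
by rewrite [LHS]/Num.Def.normr /= E (ord1 i).
Qed.

Lemma esq_ge_norm v : `|v| ^+ 2 <= esq v.
Proof.
have [->|v0] := eqVneq v 0.
  by rewrite normr0 expr0n /=; apply: sumr_ge0 => j _; rewrite sqr_ge0.
have [j ->] := norm_attained v0.
rewrite /esq (bigD1 j) //= real_normK ?num_real // lerDl sumr_ge0 // => l _.
by rewrite sqr_ge0.
Qed.

Lemma esq_le_norm v : esq v <= n.+1%:R * `|v| ^+ 2.
Proof.
rewrite mulr_natl -[X in _ *+ X]card_ord -sumr_const; apply: ler_sum => j _.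
rewrite -(real_normK (num_real (v 0 j))) lerXn2r ?nnegrE //.
exact: coord_le_norm.
Qed.

Lemma esq_gt0 v : v != 0 -> 0 < esq v.
Proof.
by move=> v0; apply: lt_le_trans (esq_ge_norm v); rewrite exprn_gt0 // normr_gt0.
Qed.

Lemma sep_le_esq v : `|sep v| <= esq v.
Proof.
have := spat_ge0 v; have := sqr_ge0 (tc v).
rewrite sepE esqE ler_norml => h1 h2; apply/andP; split; lra.
Qed.

End Coordinates.

Section RescaledMetric.
Variables (R : realType) (n : nat) (m : R) (a : 'I_n./2 -> R).
Local Notation V := 'rV[R]_n.+1.
Implicit Types (u v y : V).

(* Vanishes on {sep >= 0}, hence on the spacetime and on its boundary; keeps
   [spat + sigma] of the size of |y|^2 near the time axis. *)
Definition sigma y : R := (`|sep y| - sep y) ^+ n.+1 / esq y ^+ n.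

Lemma sigma_eq0 y : 0 <= sep y -> sigma y = 0.
Proof. by move=> s0; rewrite /sigma ger0_norm // subrr expr0n /= mul0r. Qed.

Lemma esq_ge0 y : 0 <= esq y.
Proof. by apply: sumr_ge0 => j _; rewrite sqr_ge0. Qed.

Lemma sigma_ge0 y : 0 <= sigma y.
Proof. by rewrite divr_ge0 ?exprn_ge0 ?esq_ge0 // subr_ge0 ler_norm. Qed.

(** If [sep y >= - esq y / 2], then the squared time is at most 3/4 of [esq y] and [spat y]
    suffices. Otherwise [|sep y| - sep y] exceeds [esq y], and then so does [sigma y]. *)
Lemma spat_sigma_ge y : y != 0 -> esq y / 4 <= spat y + sigma y.
Proof.
move=> y0; have E0 := esq_gt0 y0.
have [h|h] := leP (- (esq y / 2)) (sep y).
  have := sigma_ge0 y; move: h; rewrite sep_esq esqE => h1 h2; lra.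
have H : esq y <= `|sep y| - sep y.
  by rewrite ltr0_norm; lra.
have : esq y <= sigma y.
  by rewrite /sigma ler_pdivlMr ?exprn_gt0 // -exprS lerXn2r // nnegrE ?ltW // (lt_le_trans E0).
have := spat_ge0 y; lra.
Qed.

(** Index 0 collects the terms with no rotation parameter: the z-term of odd [n] and the correction
    [sigma]. The other indices are the rotation planes. *)
Definition rfam (j : 'I_(n./2).+1) y : R :=
  if unlift ord0 j is Some i then rho i y else eps R n * zc y ^+ 2 + sigma y.

Definition bfam (j : 'I_(n./2).+1) y : R :=
  if unlift ord0 j is Some i then a i ^+ 2 * sep y ^+ 2 else 0.

Lemma rfam_ge0 j y : 0 <= rfam j y.
Proof.
rewrite /rfam; case: unlift => [i|]; first exact: rho_ge0.
by rewrite addr_ge0 ?sigma_ge0 // mulr_ge0 ?sqr_ge0 ?eps_ge0.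
Qed.

Lemma bfam_ge0 j y : 0 <= bfam j y.
Proof. by rewrite /bfam; case: unlift => [i|//]; rewrite mulr_ge0 ?sqr_ge0. Qed.

Lemma sum_rfam y : \sum_j rfam j y = spat y + sigma y.
Proof.
rewrite big_ord_recl /rfam unlift_none.
under eq_bigr do rewrite liftK.
by rewrite /spat; ring.
Qed.

Lemma secular_fam y s : secular (rfam ^~ y) (bfam ^~ y) s =
  \sum_i rho i y / (s + a i ^+ 2 * sep y ^+ 2)
  + (eps R n * zc y ^+ 2 + sigma y) / s.
Proof.
rewrite /secular big_ord_recl /rfam /bfam unlift_none addr0.
under eq_bigr do rewrite liftK.
by rewrite addrC.
Qed.

(** The square of the overview's R. At the origin there is no root and the default 0 is taken; this
    is harmless because [qvec] vanishes there anyway. *)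
Definition Broot y : R :=
  xget 0 [set s | 0 < s /\ secular (rfam ^~ y) (bfam ^~ y) s = 1].

Definition Rroot y : R := Num.sqrt (Broot y).

(** The components of k at the inverse point: inserting [rhat = Rroot / sep] and x = y / [sep]
    leaves an expression without negative powers of [sep]. *)
Definition Kvec y : V :=
  basis R ord0
  + \sum_(i < n./2) (Broot y + a i ^+ 2 * sep y ^+ 2)^-1 *:
      (Rroot y *: (xc y i *: basis R (xidx i) + yc y i *: basis R (yidx i))
       + (a i * sep y) *: (xc y i *: basis R (yidx i) - yc y i *: basis R (xidx i)))
  + eps R n *: ((zc y / Rroot y) *: basis R (zidx n)).

(* Omega^2 times the pull-back of k by the inversion; the factor removes the
   poles at Omega = 0. *)
Definition qvec y : V := sep y *: Kvec y - (2 * dot (Kvec y) y) *: lower y.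

Definition Fhat y : R :=
  1 - \sum_i a i ^+ 2 * sep y ^+ 2 * rho i y
             / (Broot y + a i ^+ 2 * sep y ^+ 2) ^+ 2.

Definition Pihat y : R := \prod_i (Broot y + a i ^+ 2 * sep y ^+ 2).

(** At the inverse point, h is this function times [sep y ^+ 2]. In all, h carries [sep] to the
    power n - 2; two of these factors are used up by the normalization of [qvec], and n - 4
    remain. *)
Definition Hhat y : R :=
  2 * m * Rroot y ^+ (2 - odd n) * sep y ^+ (n - 4) / (Pihat y * Fhat y).

Definition gres y : 'M[R]_n.+1 :=
  minkowski R n + Hhat y *: ((qvec y)^T *m qvec y).

(** Chosen so that [a i ^+ 2 * sep y ^+ 2 <= esq y / 8] on the ball, which is at most half of
    [spat y + sigma y], as [secular_root] requires. The factors [n.+1%:R] pay for comparing [esq]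
    with the sup norm. *)
Definition radius0 : R := (1 + 8 * n.+1%:R ^+ 2 * \sum_i a i ^+ 2)^-1.

Lemma radius0_gt0 : 0 < radius0.
Proof.
rewrite invr_gt0 ltr_pwDl // !mulr_ge0 ?exprn_ge0 ?ler0n //.
by rewrite sumr_ge0 // => i _; rewrite sqr_ge0.
Qed.

Lemma radius0_le1 : radius0 <= 1.
Proof.
rewrite invf_le1 ?lerDl; last by rewrite -invr_gt0 radius0_gt0.
rewrite !mulr_ge0 ?exprn_ge0 ?ler0n //.
by rewrite sumr_ge0 // => i _; rewrite sqr_ge0.
Qed.

Definition pball : set V := [set y | y != 0 /\ `|y| < radius0].

Lemma bfam_le j y : pball y -> bfam j y <= (\sum_l rfam l y) / 2.
Proof.
move=> [y0 yr].
have S := spat_sigma_ge y0; have E0 := esq_gt0 y0.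
rewrite sum_rfam /bfam; case: unlift => [i|]; last first.
  by move: S E0; lra.
have ai : a i ^+ 2 <= \sum_i a i ^+ 2.
  by rewrite (bigD1 i) //= lerDl sumr_ge0 // => l _; rewrite sqr_ge0.
set A := \sum_i a i ^+ 2 in ai *.
have A0 : 0 <= A by apply: le_trans ai; rewrite sqr_ge0.
have N1 : 1 <= n.+1%:R :> R by rewrite ler1n.
have n0 : 0 <= `|y| by [].
have s2 : sep y ^+ 2 <= esq y ^+ 2.
  by rewrite -(real_normK (num_real (sep y))) lerXn2r ?nnegrE ?esq_ge0 // sep_le_esq.
have r1 : 8 * n.+1%:R ^+ 2 * A * radius0 <= 1.
  rewrite /radius0 -/A ler_pdivrMr; last by rewrite -invr_gt0 radius0_gt0.
  by rewrite mul1r lerDr.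
have yy : `|y| ^+ 2 <= radius0.
  have := radius0_le1; have := radius0_gt0; rewrite expr2 => h1 h2.
  apply: le_trans (ltW yr); rewrite ler_piMr //.
  exact: le_trans (ltW yr) h2.
have e1 := esq_le_norm y.
have H : 8 * A * esq y <= 1.
  apply: le_trans r1.
  have -> : 8 * n.+1%:R ^+ 2 * A * radius0 = 8 * A * (n.+1%:R ^+ 2 * radius0) by ring.
  apply: ler_wpM2l; first by rewrite mulr_ge0.
  apply: le_trans e1 _; apply: ler_pM => //; rewrite ?exprn_ge0 //.
  by rewrite expr2 ler_peMr // (le_trans ler01).
have : a i ^+ 2 * sep y ^+ 2 <= A * esq y ^+ 2.
  by apply: ler_pM => //; rewrite sqr_ge0.
have : A * esq y ^+ 2 <= esq y / 8.
  have -> : A * esq y ^+ 2 = (8 * A * esq y) * (esq y / 8) by field.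
  by rewrite ler_piMl // divr_ge0 // ltW.
move: S; lra.
Qed.

Lemma Broot_spec y : pball y ->
  [/\ 0 < Broot y, secular (rfam ^~ y) (bfam ^~ y) (Broot y) = 1,
      esq y / 8 <= Broot y & Broot y <= spat y + sigma y].
Proof.
move=> Uy; have [y0 yr] := Uy.
have S := spat_sigma_ge y0; have E0 := esq_gt0 y0.
have S0 : 0 < \sum_j rfam j y by rewrite sum_rfam; lra.
have [s [s1 s2 s3]] := secular_root (rfam_ge0 ^~ y) (bfam_ge0 ^~ y) S0 (fun j => bfam_le j Uy).
have s0 : 0 < s by rewrite sum_rfam in s1; lra.
have [b0 b1] : 0 < Broot y /\ secular (rfam ^~ y) (bfam ^~ y) (Broot y) = 1.
  by apply: (@xgetPex _ 0 [set s | 0 < s /\ secular (rfam ^~ y) (bfam ^~ y) s = 1]); exists s.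
have -> : Broot y = s.
  apply: (secular_inj (rfam_ge0 ^~ y) (bfam_ge0 ^~ y) S0) => //.
  by rewrite b1 s3.
by split=> //; rewrite sum_rfam in s1 s2; lra.
Qed.

End RescaledMetric.

Lemma exprz_2n (R : realType) (x : R) (j : nat) : x ^ (2 *+ j) = (x ^+ 2) ^+ j.
Proof.
have -> : (2 *+ j : int) = (2 * j)%N by lia.
by rewrite -exprnP exprM.
Qed.

(** The weight of [Hhat]: c = 2 - eps from the power of [Rroot], 2 b with b = n - 4 from that of
    [sep], and - 2 d from [Pihat], where o = eps and d = [n./2]. *)
Lemma weight_count (c b d o n : nat) :
  (c + o = 2)%N -> (b + 4 = n)%N -> (o + d * 2 = n)%N ->
  1 * c%:Z + 2 * b%:Z + - (2 * d%:Z) = n%:Z - 6.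
Proof. by lia. Qed.

(** * Weights of the ingredients of the rescaled metric *)

Section SymbolOrders.
Variables (R : realType) (n : nat) (m : R) (a : 'I_n./2 -> R).
Hypothesis n_ge4 : (4 <= n)%N.
Local Notation V := 'rV[R]_n.+1.
Implicit Types (u v y : V).
Local Notation U := (pball a).
Local Notation omega := (fun y : V => `|y|).

Lemma open_norm_lt (r : R) : open [set y : V | `|y| < r].
Proof.
have := @open_comp V R (fun y => `|y|) [set x : R | x < r].
by apply; [move=> x _; exact: norm_continuous | exact: open_lt].
Qed.

Lemma open_norm_gt (r : R) : open [set y : V | r < `|y|].
Proof.
have := @open_comp V R (fun y => `|y|) [set x : R | r < x].
by apply; [move=> x _; exact: norm_continuous | exact: open_gt].
Qed.

Lemma open_pball : open U.
Proof.
have -> : U = [set y | 0 < `|y|] `&` [set y | `|y| < radius0 a].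
  by apply/seteqP; split=> y [/=]; rewrite normr_gt0.
by apply: openI; [exact: open_norm_gt | exact: open_norm_lt].
Qed.

Lemma norm_pball_gt0 y : U y -> 0 < omega y.
Proof. by case; rewrite normr_gt0. Qed.

Lemma norm_pball_le1 y : U y -> omega y <= 1.
Proof. by case=> _ /ltW h; apply: le_trans h (radius0_le1 a). Qed.

Local Notation sym := (sym U omega).
Let oU := open_pball.
Let oG := norm_pball_gt0.
Let oL := norm_pball_le1.

Variable k : nat.

Lemma sym_coord1 j : sym k 1 (fun y : V => y 0 j).
Proof. by apply: sym_coord => // y _; exact: coord_le_norm. Qed.

Lemma sym_coord_sqr j : sym k 2 (fun y : V => y 0 j ^+ 2).
Proof. by have := symX oU oG 2 (sym_coord1 j). Qed.

Lemma sym_sep : sym k 2 (@sep R n).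
Proof. by apply: sym_sum => // j _; apply: symZ => //; exact: sym_coord_sqr. Qed.

Lemma sym_esq : sym k 2 (@esq R n).
Proof. by apply: sym_sum => // j _; exact: sym_coord_sqr. Qed.

Lemma sym_rho i : sym k 2 (@rho R n i).
Proof. by apply: symD => //; exact: sym_coord_sqr. Qed.

Lemma sym_spat : sym k 2 (@spat R n).
Proof.
apply: symD => //; first by apply: sym_sum => // i _; exact: sym_rho.
by apply: symZ => //; exact: sym_coord_sqr.
Qed.

Hypothesis k_lt_n : (k < n)%N.

(** The weight is 2 (n + 1) - 2 n, and [k < n] is the range of orders in which the truncated power
    can be differentiated. *)
Lemma sym_sigma : sym k 2 (@sigma R n).
Proof.
have H1 := sym_negpow oU oG k_lt_n sym_sep.
have H2 : sym k (- (2 *+ n)) (fun y => (esq y ^+ n)^-1).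
  apply: (symV oU oG (c := 1)) => //; last by have := symX oU oG n sym_esq.
  move=> y Uy; rewrite mul1r ger0_norm ?exprn_ge0 ?esq_ge0 //.
  by rewrite exprz_2n lerXn2r ?nnegrE ?exprn_ge0 ?esq_ge0 // esq_ge_norm.
have := symM oU oG H1 H2.
by rewrite mulrS addrK.
Qed.

Lemma sym_rfam j : sym k 2 (@rfam R n j).
Proof.
rewrite /rfam; case: unlift => [i|]; first exact: sym_rho.
by apply: symD => //; [apply: symZ => //; exact: sym_coord_sqr | exact: sym_sigma].
Qed.

Lemma sym_bi i : sym k 4 (fun y => a i ^+ 2 * sep y ^+ 2).
Proof. by apply: symZ => //; have := symX oU oG 2 sym_sep. Qed.

Lemma sym_bfam j : sym k 2 (bfam a j).
Proof.
rewrite /bfam; case: unlift => [i|]; last exact: sym0.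
exact: sym_le oG oL _ _ _ _ _ (sym_bi i).
Qed.

Lemma Broot_ge y : U y -> 8^-1 * omega y ^ 2 <= Broot a y.
Proof.
move=> Uy; have [_ _ h _] := Broot_spec Uy; apply: le_trans h.
by rewrite mulrC ler_wpM2r ?invr_ge0 // esq_ge_norm.
Qed.

Lemma Broot_gt0 y : U y -> 0 < Broot a y.
Proof. by move=> /Broot_spec[]. Qed.

Lemma sym_Broot : sym k 2 (Broot a).
Proof.
have HS : sym k 2 (fun y => spat y + sigma y) by apply: symD => //; [exact: sym_spat | exact: sym_sigma].
have [C C0 HC] := sym_bound oG HS.
apply: (sym_secular_root oU oG sym_rfam sym_bfam (fun j y _ => rfam_ge0 j y)
  (fun j y _ => bfam_ge0 a j y) (c := 8^-1) (C := C)) => //.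
- exact: Broot_ge.
- move=> y Uy; have [_ _ _ h] := Broot_spec Uy.
  by apply: le_trans h _; apply: le_trans (ler_norm _) (HC y Uy).
- by move=> y Uy; have [] := Broot_spec Uy.
Qed.

Lemma sym_Rroot : sym k 1 (Rroot a).
Proof.
apply: (sym_sqrt oU oG (c := 8^-1)) => //; first exact: Broot_ge.
exact: sym_Broot.
Qed.

Lemma Rroot_ge y : U y -> Num.sqrt 8^-1 * omega y ^ 1 <= `|Rroot a y|.
Proof.
move=> Uy; rewrite ger0_norm ?sqrtr_ge0 // expr1z -{1}(ger0_norm (normr_ge0 y)).
by rewrite -sqrtr_sqr -sqrtrM // /Rroot; apply/ler_wsqrtr/Broot_ge.
Qed.

Lemma sym_Rroot_inv : sym k (- 1) (fun y => (Rroot a y)^-1).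
Proof.
apply: (symV oU oG _ Rroot_ge sym_Rroot).
by rewrite sqrtr_gt0.
Qed.

Lemma Bi_gt0 i y : U y -> 0 < Broot a y + a i ^+ 2 * sep y ^+ 2.
Proof. by move=> Uy; rewrite ltr_wpDr ?Broot_gt0 // mulr_ge0 ?sqr_ge0. Qed.

Lemma Bi_ge i y : U y ->
  8^-1 * omega y ^ 2 <= `|Broot a y + a i ^+ 2 * sep y ^+ 2|.
Proof.
move=> Uy; rewrite ger0_norm; last exact/ltW/Bi_gt0.
by apply: le_trans (Broot_ge Uy) _; rewrite lerDl mulr_ge0 ?sqr_ge0.
Qed.

Lemma sym_Bi i : sym k 2 (fun y => Broot a y + a i ^+ 2 * sep y ^+ 2).
Proof.
apply: symD => //; first exact: sym_Broot.
by have := sym_le oG oL (_ : (2 <= 4)%R) (sym_bi i); apply.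
Qed.

Lemma sym_Bi_inv i : sym k (- 2) (fun y => (Broot a y + a i ^+ 2 * sep y ^+ 2)^-1).
Proof. by apply: (symV oU oG _ (Bi_ge i) (sym_Bi i)). Qed.

Lemma Kvec_coord y j : Kvec a y 0 j =
  basis R ord0 0 j
  + \sum_i (Broot a y + a i ^+ 2 * sep y ^+ 2)^-1 *
      (Rroot a y * (xc y i * basis R (xidx i) 0 j + yc y i * basis R (yidx i) 0 j)
       + (a i * sep y) * (xc y i * basis R (yidx i) 0 j - yc y i * basis R (xidx i) 0 j))
  + eps R n * ((zc y / Rroot a y) * basis R (zidx n) 0 j).
Proof.
rewrite /Kvec; move: (basis R) => e.
rewrite mxE [in LHS]mxE summxE; congr (_ + _ + _); last by rewrite !mxE.
by apply: eq_bigr => i _; rewrite !mxE.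
Qed.

Lemma sym_coordMr c j : sym k 1 (fun y : V => y 0 j * c).
Proof.
apply: (sym_eq oU (f := fun y : V => c * y 0 j)) => [y _|]; first by rewrite mulrC.
by apply: symZ => //; exact: sym_coord1.
Qed.

Lemma sym_Kvec j : sym k 0 (fun y => Kvec a y 0 j).
Proof.
apply: (sym_eq oU (f := fun y => _)) => [y _|]; first by rewrite Kvec_coord.
apply: symD => //; first apply: symD => //; first exact: sym_cst.
  apply: sym_sum => // i _; rewrite -[0%R](addNr (2 : int)).
  apply: symM => //; first exact: sym_Bi_inv.
  apply: symD => //.
    apply: (symM oU oG (p := 1) (q := 1)); first exact: sym_Rroot.
    by apply: symD => //; exact: sym_coordMr.
  apply: (sym_le oG oL (p := 3)) => //.
  apply: (symM oU oG (p := 2) (q := 1)).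
    by apply: symZ => //; exact: sym_sep.
  by apply: symB => //; exact: sym_coordMr.
apply: symZ => //.
have Hc : sym k 0 (fun _ => basis R (zidx n) 0 j) by exact: sym_cst.
by have := symM oU oG (symM oU oG (sym_coord1 (zidx n)) sym_Rroot_inv) Hc.
Qed.

Lemma sym_dotK : sym k 1 (fun y => dot (Kvec a y) y).
Proof.
apply: sym_sum => // j _; rewrite -[1%R](add0r (1 : int)).
by apply: symM => //; [exact: sym_Kvec | exact: sym_coord1].
Qed.

Lemma qvec_coord y j :
  qvec a y 0 j = sep y * Kvec a y 0 j - 2 * dot (Kvec a y) y * (sgn R j * y 0 j).
Proof. by rewrite /qvec !mxE. Qed.

Lemma sym_qvec j : sym k 2 (fun y => qvec a y 0 j).
Proof.
apply: (sym_eq oU (f := fun y => _)) => [y _|]; first by rewrite qvec_coord.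
apply: symB => //.
  by have := symM oU oG sym_sep (sym_Kvec j).
apply: (symM oU oG (p := 1) (q := 1)).
  by apply: symZ => //; exact: sym_dotK.
by apply: symZ => //; exact: sym_coord1.
Qed.

Lemma sym_Pihat : sym k (2 *+ n./2) (Pihat a).
Proof.
have H := sym_prod oU oG (enum 'I_n./2) sym_Bi; rewrite size_enum_ord in H.
by apply: (sym_eq oU _ H) => y _; rewrite big_enum.
Qed.

Lemma Pihat_gt0 y : U y -> 0 < Pihat a y.
Proof. by move=> Uy; apply: prodr_gt0 => i _; exact: Bi_gt0. Qed.

Lemma Pihat_ge y : U y -> 8^-1 ^+ n./2 * omega y ^ (2 *+ n./2) <= `|Pihat a y|.
Proof.
move=> Uy.
rewrite exprz_2n -exprMn -[X in _ ^+ X]card_ord -prodr_const /Pihat normr_prod.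
apply: ler_prod => i _; rewrite mulr_ge0 ?invr_ge0 ?exprn_ge0 //=.
exact: Bi_ge.
Qed.

Lemma sym_Fhat : sym k 0 (Fhat a).
Proof.
apply: symB => //; first exact: sym_cst.
apply: sym_sum => // i _.
apply: (sym_le oG oL (p := 2)) => //.
apply: (sym_eq oU (f := fun y => a i ^+ 2 * sep y ^+ 2 * rho i y *
  ((Broot a y + a i ^+ 2 * sep y ^+ 2)^-1) ^+ 2)) => [y _|]; first by rewrite exprVn.
have := symM oU oG (symM oU oG (sym_bi i) (sym_rho i)) (symX oU oG 2 (sym_Bi_inv i)).
by [].
Qed.

(* B Q = F, where Q = sum_j r_j / (B + b_j)^2 is minus the derivative of the
   secular function at its root B. *)
Lemma Fhat_ge y : U y -> 2 / 9 <= Fhat a y.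
Proof.
move=> Uy; have [B0 B1 _ B2] := Broot_spec Uy.
set B := Broot a y in B0 B1 B2.
set S := \sum_j rfam j y; have SB : B <= S by rewrite /S sum_rfam.
have D0 j : 0 < B + bfam a j y by rewrite ltr_wpDr ?bfam_ge0.
(* The 1 in [Fhat] is replaced by the secular sum: r / (B + b) - b r / (B + b)^2 = r B / (B + b)^2.
   Index 0 contributes nothing to [Fhat] since its b is 0. *)
have FE : Fhat a y = \sum_j rfam j y * B / (B + bfam a j y) ^+ 2.
  transitivity (1 - \sum_j bfam a j y * rfam j y / (B + bfam a j y) ^+ 2).
    rewrite /Fhat [in RHS]big_ord_recl /bfam /rfam unlift_none !mul0r add0r.
    by under [in RHS]eq_bigr do rewrite liftK.
  rewrite -B1 /secular -sumrB; apply: eq_bigr => j _.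
  by have := lt0r_neq0 (D0 j) => h; field.
have lb j : B + bfam a j y <= 3 / 2 * S by have := bfam_le j Uy; rewrite -/S; lra.
have S0 : 0 < S by exact: lt_le_trans SB.
have Q1 : (3 / 2 * S)^-1 <= \sum_j rfam j y / (B + bfam a j y) ^+ 2.
  have : 0 < 3 / 2 * S by rewrite mulr_gt0.
  move: (3 / 2 * S) lb => M lb M0.
  rewrite -[leLHS]mul1r -B1 /secular mulr_suml; apply: ler_sum => j _.
  rewrite expr2 [X in _ <= _ * X]invfM [leRHS]mulrA; apply: ler_wpM2l.
    by rewrite divr_ge0 ?rfam_ge0 // ltW.
  by rewrite lef_pV2 ?posrE.
(* [Broot_spec] bounds the root below only by [esq]; the sharper bound in terms of S comes from
   identifying it with the root of [secular_root]. Together with [B + b <= 3 / 2 * S] this gives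
   1/3, which exceeds 2/9. *)
have B3 : S / 2 <= B.
  have S0' : 0 < \sum_j rfam j y by [].
  have [s [s1 s2 s3]] := secular_root (fun j => rfam_ge0 j y) (fun j => bfam_ge0 a j y) S0' (fun j => bfam_le j Uy).
  have s0 : 0 < s by apply: lt_le_trans s1; rewrite divr_gt0.
  suff -> : B = s by [].
  by apply: (secular_inj (fun j => rfam_ge0 j y) (fun j => bfam_ge0 a j y) S0') => //; rewrite s3 B1.
have -> : Fhat a y = B * \sum_j rfam j y / (B + bfam a j y) ^+ 2.
  by rewrite FE mulr_sumr; apply: eq_bigr => j _; rewrite mulrCA mulrA.
apply: (@le_trans _ _ (S / 2 * (3 / 2 * S)^-1)).
  have -> : S / 2 * (3 / 2 * S)^-1 = 3^-1 by field; rewrite gt_eqF.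
  lra.
by apply: ler_pM => //; rewrite ?invr_ge0 ltW // ?mulr_gt0 // divr_gt0.
Qed.

Lemma Fhat_gt0 y : U y -> 0 < Fhat a y.
Proof. by move=> Uy; apply: lt_le_trans (Fhat_ge Uy); lra. Qed.

Lemma sym_Hhat : sym k (n%:Z - 6) (Hhat m a).
Proof.
have H1 : sym k (- (2 *+ n./2)) (fun y => (Pihat a y)^-1).
  by apply: (symV oU oG _ Pihat_ge sym_Pihat); rewrite exprn_gt0.
have H2 : sym k (- 0) (fun y => (Fhat a y)^-1).
  apply: (symV oU oG (c := 2 / 9) _ _ sym_Fhat); first by lra.
  by move=> y Uy; rewrite expr0z mulr1 ger0_norm ?Fhat_ge // ltW // Fhat_gt0.
have H3 := symX oU oG (2 - odd n) sym_Rroot.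
have H4 := symX oU oG (n - 4) sym_sep.
have H := symM oU oG (symM oU oG (symZ oU oG (2 * m) H3) H4) (symM oU oG H1 H2).
have e : 1 *+ (2 - odd n) + 2 *+ (n - 4) + (- (2 *+ n./2) + - 0) = n%:Z - 6.
  have h1 : ((2 - odd n) + odd n = 2)%N by case: (odd n).
  have h2 : ((n - 4) + 4 = n)%N by rewrite subnK.
  have h3 : (odd n + n./2 * 2 = n)%N by rewrite muln2 odd_double_half.
  have en (p : int) (j : nat) : p *+ j = p * j%:Z by rewrite -mulr_natr natz.
  by rewrite oppr0 addr0 (en 1 (2 - odd n)%N) (en 2 (n - 4)%N) (en 2 n./2); exact: (weight_count h1 h2 h3).
rewrite e in H; by apply: (sym_eq oU _ H) => y _; rewrite /Hhat invfM.
Qed.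

Lemma gresE y i j :
  gres m a y i j = minkowski R n i j + Hhat m a y * (qvec a y 0 i * qvec a y 0 j).
Proof. by rewrite /gres !mxE big_ord1 !mxE. Qed.

Lemma sym_Tres i j :
  sym k (n%:Z - 2) (fun y => Hhat m a y * (qvec a y 0 i * qvec a y 0 j)).
Proof.
have := symM oU oG sym_Hhat (symM oU oG (sym_qvec i) (sym_qvec j)).
have -> : n%:Z - 6 + (2 + 2) = n%:Z - 2 by ring.
by [].
Qed.

End SymbolOrders.

(** * Rank-one perturbations and the inversion *)

Section RankOne.
Variables (R : realType) (n : nat).
Local Notation V := 'rV[R]_n.+1.
Local Notation eta := (minkowski R n).
Implicit Types (u v q : V).

Lemma minkowskiE i j : eta i j = sgn R i *+ (i == j).
Proof. by rewrite !mxE. Qed.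

Lemma minkowski_tr : eta^T = eta.
Proof. by rewrite /minkowski tr_diag_mx. Qed.

Lemma sgn_sqr (j : 'I_n.+1) : sgn R j * sgn R j = 1.
Proof. by rewrite /sgn; case: eqP => _; rewrite ?mulrNN mulr1. Qed.

Lemma mul_minkowski v : v *m eta = lower v.
Proof.
apply/rowP => j; rewrite /minkowski mul_mx_diag !mxE mulrC /sgn; by case: eqP.
Qed.

Lemma minkowski_mul v : eta *m v^T = (lower v)^T.
Proof. by rewrite -{1}minkowski_tr -trmx_mul mul_minkowski. Qed.

Lemma minkowski_sqr : eta *m eta = 1%:M.
Proof.
apply/matrixP => i j; rewrite mul_diag_mx mxE minkowskiE [X in X * _]mxE -/(sgn R i).
by rewrite mulrnAr sgn_sqr mxE.
Qed.

Lemma lowerK : involutive (@lower R n).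
Proof. by move=> v; rewrite -!mul_minkowski -mulmxA minkowski_sqr mulmx1. Qed.

Lemma mul_tr_dot u v : u *m v^T = (dot u v)%:M.
Proof. by apply/matrixP => i j; rewrite !ord1 !mxE mulr1n; apply: eq_bigr => l _; rewrite !mxE. Qed.

Lemma dot_lower v : dot (lower v) v = sep v.
Proof. by apply: eq_bigr => j _; rewrite mxE -mulrA -expr2. Qed.

Lemma dotC u v : dot u v = dot v u.
Proof. by apply: eq_bigr => j _; rewrite mulrC. Qed.

Lemma dot_lowerl u v : dot (lower u) v = dot u (lower v).
Proof. by apply: eq_bigr => j _; rewrite !mxE mulrCA mulrA. Qed.

Lemma rank1_mul (p r x y : V) :
  (p^T *m r) *m (x^T *m y) = dot r x *: (p^T *m y).
Proof.
rewrite mulmxA -[p^T *m r *m x^T]mulmxA mul_tr_dot.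
by rewrite mul_mx_scalar scalemxAl.
Qed.

Lemma rank1_minkowski (p r : V) : (p^T *m r) *m eta = p^T *m lower r.
Proof. by rewrite -mulmxA mul_minkowski. Qed.

Lemma minkowski_rank1 (p r : V) : eta *m (p^T *m r) = (lower p)^T *m r.
Proof. by rewrite mulmxA minkowski_mul. Qed.

Lemma rank1_tr (p r : V) : (p^T *m r)^T = r^T *m p.
Proof. by rewrite trmx_mul trmxK. Qed.

Lemma mulmx_1D (N : 'M[R]_n.+1) (e f k : R) : N *m N = k *: N ->
  (1%:M + e *: N) *m (1%:M + f *: N) = 1%:M + (e + f + e * f * k) *: N.
Proof.
move=> NN; rewrite mulmxDl mul1mx mulmxDr mulmx1 -scalemxAl -scalemxAr NN !scalerA.
by rewrite -addrA; congr (_ + _); rewrite -!scalerDl; congr (_ *: _); ring.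
Qed.

(** An explicit congruence [1 + e N] with [N = q^T *m lower q] removes the perturbation. As [N *m N]
    is a multiple of [N], everything reduces to one scalar equation for [e]. *)
Lemma lorentzian_rank1 (H : R) q : 0 < 1 + H * sep q ->
  lorentzian (eta + H *: (q^T *m q)).
Proof.
move=> hk; split.
  by rewrite linearD /= minkowski_tr linearZ /= rank1_tr.
set k := sep q in hk *; set s := Num.sqrt (1 + H * k).
have s0 : 0 < s by rewrite sqrtr_gt0.
have ss : s ^+ 2 = 1 + H * k by rewrite sqr_sqrtr // ltW.
(* The equation is solved by 1 + e k = 1 / s. This is (1 / s - 1) / k in rationalized form, which
   remains meaningful when q is null and k = 0. *)
pose e := - H / (s * (1 + s)).
have s1 : 1 + s != 0 by rewrite gt_eqF // addr_gt0.
have sn0 : s != 0 by rewrite gt_eqF.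
have ek : 1 + e * k = s^-1.
  have -> : e * k = (1 - s ^+ 2) / (s * (1 + s)) by rewrite ss /e; field; rewrite s1 sn0.
  by field; rewrite s1 sn0.
pose N := q^T *m lower q.
pose P := 1%:M + e *: N.
have NN : N *m N = k *: N by rewrite rank1_mul dot_lower.
exists P.
  suff /mulmx1_unit [] : P *m (1%:M - (e * s) *: N) = 1%:M by [].
  rewrite -scaleNr /P (mulmx_1D _ _ NN).
  have -> : e + - (e * s) + e * - (e * s) * k = e * (1 - s * (1 + e * k)) by ring.
  by rewrite ek divff // subrr mulr0 scale0r addr0.
have PA : P *m (eta + H *: (q^T *m q)) = eta + (H + e + e * H * k) *: (q^T *m q).
  rewrite /P mulmxDl mul1mx mulmxDr -scalemxAl -!scalemxAr -scalemxAl.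
  rewrite rank1_minkowski lowerK rank1_mul dot_lower -/k.
  by move: (q^T *m q) => M; apply/matrixP => i j; rewrite !mxE; ring.
have -> : P^T = 1%:M + e *: ((lower q)^T *m q).
  by rewrite /P linearD /= trmx1 linearZ /= rank1_tr.
rewrite PA mulmxDl !mulmxDr !mulmx1 -!scalemxAr -!scalemxAl minkowski_rank1 lowerK.
rewrite rank1_mul dotC dot_lower -/k.
have : (H + e + e * H * k) * (1 + e * k) + e = 0.
  have -> : H + e + e * H * k = H * (1 + e * k) + e by ring.
  rewrite ek; have -> : e = - H / (s * (1 + s)) by [].
  by field; rewrite s1 sn0.
move=> h; move: (q^T *m q) => M; apply/matrixP => i j; rewrite !mxE.
rewrite -[RHS]addr0 -(mul0r (M i j)) -h; ring.
Qed.

(** The Sherman-Morrison formula. *)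
Lemma invmx_rank1 (H : R) q : 1 + H * sep q != 0 ->
  invmx (eta + H *: (q^T *m q)) =
  eta - (H / (1 + H * sep q)) *: ((lower q)^T *m lower q).
Proof.
move=> hk; set B := RHS; set A := eta + _.
suff AB : A *m B = 1%:M.
  have [Au _] := mulmx1_unit AB.
  by rewrite -[LHS]mulmx1 -AB mulKmx.
rewrite /A /B mulmxDl !mulmxDr !mulmxN minkowski_sqr -!scalemxAr -!scalemxAl.
rewrite minkowski_rank1 rank1_minkowski lowerK rank1_mul dotC dot_lower.
move: (sep q) hk (q^T *m lower q) => k hk M; apply/matrixP => i j; rewrite !mxE.
move: (_ *+ _) (M i j) => x y; field.
by [].
Qed.

End RankOne.

(** * The inversion and its Jacobian *)

Section Inversion.
Variables (R : realType) (n : nat).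
Local Notation V := 'rV[R]_n.+1.
Local Notation eta := (minkowski R n).
Implicit Types (x y : V).

Definition inversion x : V := (sep x)^-1 *: x.

Lemma sepZ (c : R) x : sep (c *: x) = c ^+ 2 * sep x.
Proof.
by rewrite /sep mulr_sumr; apply: eq_bigr => j _; rewrite mxE exprMn mulrCA.
Qed.

Lemma sep_inversion x : sep (inversion x) = (sep x)^-1.
Proof.
rewrite sepZ; have [->|s0] := eqVneq (sep x) 0; first by rewrite invr0 mulr0.
by field.
Qed.

Lemma inversionK x : sep x != 0 -> inversion (inversion x) = x.
Proof.
by move=> s0; rewrite {1}/inversion sep_inversion invrK /inversion scalerA divff // scale1r.
Qed.

Lemma Ck_on_sym (U : set V) (omega : V -> R) k p (f : V -> R) :
  sym U omega k p f -> Ck_on k U f.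
Proof.
move=> Hf; split=> [s i x sk Ux|s x sk Ux].
  have := sym_pder (ltnW sk) Hf.
  by rewrite -(subnSK sk) => /sym_derivable; apply.
by have := sym_pder sk Hf => /sym_continuous; apply.
Qed.

(** Smoothness is local. On a bounded neighbourhood where [sep] is bounded below, the weighted
    classes with the constant weight [fun=> M] merely express bounded derivatives, and their algebra
    applies at every order. *)
Lemma inversion_smooth j : smooth_on [set x | 0 < sep x] (fun x => inversion x 0 j).
Proof.
have main k x0 : 0 < sep x0 -> exists2 U : set V, U x0 & Ck_on k U (fun x => inversion x 0 j).
  move=> s0; pose M := `|x0| + 1.
  have M0 : 0 < M by rewrite ltr_wpDl.
  pose U0 := [set x : V | `|x| < M].
  have oU0 : open U0 by exact: open_norm_lt.
  have M0' (x : V) : U0 x -> 0 < M by [].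
  have HC i : forall k', sym U0 (fun=> M) k' 1 (fun x : V => x 0 i).
    move=> k'; apply: sym_coord => // x /ltW h; apply: le_trans h.
    exact: coord_le_norm.
  have HS k' : sym U0 (fun=> M) k' 2 (@sep R n).
    apply: sym_sum => // i _; apply: symZ => //.
    by have := symX oU0 M0' 2 (HC i k').
  pose U := U0 `&` [set x | sep x0 / 2 < sep x].
  have oU : open U.
    rewrite openE => x [Ux sx]; apply: filterI.
      by apply: open_nbhs_nbhs.
    have := sym_continuous (HS 0) Ux => /cvgr_gt; apply.
    exact: sx.
  exists U.
    split; first by rewrite /U0 /M /= ltrDl.
    by rewrite /=; lra.
  have M0'' (x : V) : U x -> 0 < M by [].
  have HC2 i k' : sym U (fun=> M) k' 1 (fun x : V => x 0 i).
    apply: sym_coord => // x [/ltW h _]; apply: le_trans h.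
    exact: coord_le_norm.
  have HS2 k' : sym U (fun=> M) k' 2 (@sep R n).
    apply: sym_sum => // i _; apply: symZ => //.
    by have := symX oU M0'' 2 (HC2 i k').
  have HI : sym U (fun=> M) k (- 2) (fun x => (sep x)^-1).
    apply: (symV oU M0'' (c := sep x0 / 2 / M ^ 2)) => //.
      by rewrite !divr_gt0 // exprz_gt0.
    move=> x [_ sx]; rewrite divfK ?expfz_neq0 ?gt_eqF //.
    by apply: le_trans (ler_norm _); exact: ltW sx.
  apply: (Ck_on_sym (omega := fun=> M) (p := - 2 + 1)).
  apply: (sym_eq oU _ (symM oU M0'' HI (HC2 j k))) => x _.
  by rewrite /inversion mxE.
move=> k; split=> [s i x sk /= sx|s x sk /= sx].
  by have [U Ux [H _]] := main k x sx; apply: H Ux.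
by have [U Ux [_ H]] := main k x sx; apply: H Ux.
Qed.

Lemma is_derive_coord x (i j : 'I_n.+1) :
  is_derive x (basis R i) (fun x : V => x 0 j) (i == j)%:R.
Proof.
have Hd : derivable (id : V -> V) x (basis R i) by exact: derivable_id.
split; first exact: ((derivable_mxP id x (basis R i)).1 Hd 0 j).
have /matrixP /(_ 0 j) := derive_mx Hd; rewrite [RHS]mxE => <-.
by rewrite derive_id /basis mxE eqxx eq_sym.
Qed.

Lemma is_derive_sep x (i : 'I_n.+1) :
  is_derive x (basis R i) (@sep R n) (2 * (sgn R i * x 0 i)).
Proof.
have -> : @sep R n = \sum_j (fun x : V => sgn R j * (x 0 j * x 0 j)).
  by apply/funext => y; rewrite fct_sumE; apply: eq_bigr => j _; rewrite expr2.
have H j : is_derive x (basis R i) (fun x : V => sgn R j * (x 0 j * x 0 j))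
    (sgn R j * (x 0 j * (i == j)%:R + x 0 j * (i == j)%:R)).
  exact: is_deriveZ (is_deriveM (is_derive_coord x i j) (is_derive_coord x i j)).
apply: (is_derive_eq (is_derive_sum H)).
rewrite (bigD1 i) //= eqxx big1 => [|j ji]; last by rewrite eq_sym (negbTE ji) !mulr0 addr0 mulr0.
by rewrite /=; ring.
Qed.

Lemma is_derive_inversion x (i j : 'I_n.+1) : sep x != 0 ->
  is_derive x (basis R i) (fun x => inversion x 0 j)
   ((sep x)^-1 * (i == j)%:R - 2 / sep x ^+ 2 * (sgn R i * x 0 i) * x 0 j).
Proof.
move=> s0.
have -> : (fun x => inversion x 0 j) = (fun x => (sep x)^-1 * x 0 j).
  by apply/funext => y; rewrite /inversion mxE.
have Hs := is_derive_sep x i.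
have HV : is_derive x (basis R i) (fun x => (sep x)^-1)
    (- (sep x) ^- 2 *: (2 * (sgn R i * x 0 i))).
  split; first by apply: derivableV => //; case: Hs.
  by rewrite deriveV //; case: Hs => _ ->.
have H := is_deriveM HV (is_derive_coord x i j).
apply: (is_derive_eq H).
rewrite -![_ *: _]/(_ * _); field.
by [].
Qed.

(** ['J] is built from the Fréchet differential, so partial derivatives give its entries only once
    differentiability is known. *)
Lemma differentiable_inversion x : sep x != 0 -> differentiable inversion x.
Proof.
move=> s0.
have -> : inversion = \sum_j (fun x => ((sep x)^-1 * x 0 j) *: basis R j).
  apply/funext => y; rewrite fct_sumE /inversion [X in _ *: X](row_sum_delta y) scaler_sumr.
  by apply: eq_bigr => j _; rewrite scalerA.
apply: differentiable_sum => j; apply: differentiableZl.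
apply: (differentiableM (f := fun x => (sep x)^-1) (g := fun x : V => x 0 j)).
  apply: differentiableV => //.
  have -> : @sep R n = \sum_j (sgn R j *: (fun x : V => x 0 j ^+ 2)).
    by apply/funext => y; rewrite fct_sumE.
  apply: differentiable_sum => l; apply: differentiableZ.
  by apply: (differentiableM (f := fun x : V => x 0 l) (g := fun x : V => x 0 l)); exact: differentiable_coord.
exact: differentiable_coord.
Qed.

(** Up to the factor [(sep x)^-1], this is the Lorentz reflection in the hyperplane orthogonal to
    [x], whence conformality for the flat metric. *)
Lemma jacobian_inversion x : sep x != 0 ->
  'J inversion x = (sep x)^-1 *: (1%:M - (2 / sep x) *: ((lower x)^T *m x)).
Proof.
move=> s0; apply/matrixP => i j.
have Hd := differentiable_inversion s0.
have := deriveEjacobian (basis R i) Hd.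
rewrite derive_mx; last exact: diff_derivable.
move=> /matrixP /(_ 0 j); rewrite mxE.
have [_ ->] := is_derive_inversion i j s0.
rewrite -rowE mxE => <-.
rewrite !mxE big_ord1 !mxE -[1 *+ _]/(_%:R).
by move: (_%:R) => b; field.
Qed.

End Inversion.

(** * Agreement with the Myers-Perry metric on the spacetime *)

Section Completion.
Variables (R : realType) (n : nat) (m : R) (a : 'I_n./2 -> R).
Hypothesis n_ge4 : (4 <= n)%N.
Local Notation V := 'rV[R]_n.+1.
Implicit Types (x y p : V).
Local Notation U := (pball a).

Lemma qvec0 : qvec a (0 : V) = 0.
Proof.
have E : lower (0 : V) = 0 by rewrite -mul_minkowski mul0mx.
have s0 : sep (0 : V) = 0.
  by rewrite /sep big1 // => j _; rewrite mxE expr0n /= mulr0.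
by rewrite /qvec s0 scale0r E scaler0 subr0.
Qed.

Lemma sep0 : sep (0 : V) = 0.
Proof. by rewrite /sep big1 // => j _; rewrite mxE expr0n /= mulr0. Qed.

Lemma dotZr (c : R) (u v : V) : dot u (c *: v) = c * dot u v.
Proof. by rewrite /dot mulr_sumr; apply: eq_bigr => j _; rewrite mxE mulrCA. Qed.

Lemma dotZl (c : R) (u v : V) : dot (c *: u) v = c * dot u v.
Proof. by rewrite dotC dotZr dotC. Qed.

Lemma dotBl (u u' v : V) : dot (u - u') v = dot u v - dot u' v.
Proof. by rewrite /dot -sumrB; apply: eq_bigr => j _; rewrite !mxE mulrBl. Qed.

Lemma sep_basis p (c : R) (j : 'I_n.+1) : j != ord0 ->
  sep (c *: basis R j + p) = sep p + 2 * c * p 0 j + c ^+ 2.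
Proof.
move=> j0; rewrite /sep (bigD1 j) //= [in RHS](bigD1 j) //=.
rewrite /sgn (negbTE j0) !mxE !eqxx /=.
rewrite (eq_bigr (fun i => (if i == ord0 then -1 else 1) * p 0 i ^+ 2)); last first.
  by move=> i ij; rewrite !mxE (negbTE ij) andbF mulr0 add0r.
by rewrite mulr1n; ring.
Qed.

Lemma continuous_sep : continuous (@sep R n).
Proof.
move=> x; apply: continuous_sum => j; apply: continuousM; first exact: cst_continuous.
apply: (continuousM (s := fun x : V => x 0 j) (t := fun x : V => x 0 j)); exact: coord_continuous.
Qed.

Section PhysicalPoint.
Variable y : V.
Hypothesis Uy : U y.
Hypothesis sy : 0 < sep y.
Local Notation w := (sep y).
Local Notation x := (inversion y).

Let xcE i : xc x i = w^-1 * xc y i. Proof. by rewrite /xc mxE. Qed.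
Let ycE i : yc x i = w^-1 * yc y i. Proof. by rewrite /yc mxE. Qed.
Let zcE : zc x = w^-1 * zc y. Proof. by rewrite /zc mxE. Qed.

(** As x = y / w, each fraction multiplied through by w^2 has denominator (s w)^2 + a_i^2 w^2;
    [sigma] drops out since w > 0. *)
Lemma rhat_secular s : 0 < s ->
  \sum_i (xc x i ^+ 2 + yc x i ^+ 2) / (s ^+ 2 + a i ^+ 2)
    + eps R n * (zc x ^+ 2 / s ^+ 2)
  = secular (fun j => rfam j y) (fun j => bfam a j y) ((s * w) ^+ 2).
Proof.
move=> s0; rewrite secular_fam sigma_eq0 ?ltW // addr0; congr (_ + _).
  apply: eq_bigr => i _; rewrite xcE ycE /rho.
  have h : s ^+ 2 + a i ^+ 2 != 0 by rewrite gt_eqF // ltr_pwDl ?exprn_gt0 // sqr_ge0.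
  have h' : (s * w) ^+ 2 + a i ^+ 2 * w ^+ 2 != 0.
    by rewrite exprMn -mulrDl mulf_neq0 // expf_neq0 // gt_eqF.
  field.
  by rewrite [(a i * w) ^+ 2]exprMn h' h gt_eqF.
by rewrite zcE; field; rewrite !gt_eqF.
Qed.

Lemma Rroot_gt0 : 0 < Rroot a y.
Proof. by rewrite sqrtr_gt0 Broot_gt0. Qed.

Lemma sqr_Rroot : Rroot a y ^+ 2 = Broot a y.
Proof. by rewrite sqr_sqrtr // ltW // Broot_gt0. Qed.

Lemma is_rhat_Rroot : is_rhat a x (Rroot a y / w).
Proof.
have s0 : 0 < Rroot a y / w by rewrite divr_gt0 ?Rroot_gt0.
split=> //; rewrite rhat_secular // divfK ?gt_eqF // sqr_Rroot.
by have [] := Broot_spec Uy.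
Qed.

(** Both sides are values picked by [xget]; they agree because the positive root is unique. *)
Lemma rhatE : rhat a x = Rroot a y / w.
Proof.
have [h0 h1] : is_rhat a x (rhat a x).
  by apply: (@xgetPex _ 0 [set s | is_rhat a x s]); exists (Rroot a y / w); exact: is_rhat_Rroot.
have [k0 k1] := is_rhat_Rroot.
rewrite rhat_secular // in h1; rewrite rhat_secular // in k1.
have S0 : 0 < \sum_j rfam j y.
  rewrite sum_rfam; have [y0 _] := Uy; apply: lt_le_trans (spat_sigma_ge y0).
  by rewrite divr_gt0 ?esq_gt0.
have p0 : 0 < rhat a x * w by rewrite mulr_gt0.
have q0 : 0 < Rroot a y / w * w by rewrite mulr_gt0.
have := secular_inj (fun j => rfam_ge0 j y) (fun j => bfam_ge0 a j y) S0
  (exprn_gt0 2 p0) (exprn_gt0 2 q0) (etrans k1 (esym h1)).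
move/eqP; rewrite eqrXn2 ?ltW // => /eqP /mulIf; apply.
by rewrite gt_eqF.
Qed.

Lemma rhat_sqrD i : rhat a x ^+ 2 + a i ^+ 2 =
  (Broot a y + a i ^+ 2 * w ^+ 2) / w ^+ 2.
Proof. by rewrite rhatE expr_div_n sqr_Rroot; field; rewrite gt_eqF. Qed.

Lemma mp_kE : mp_k a x = Kvec a y.
Proof.
have w0 : w != 0 by rewrite gt_eqF.
rewrite /mp_k /Kvec; congr (_ + _ + _); last first.
  congr (_ *: (_ *: _)); rewrite zcE rhatE; field.
  by rewrite w0 gt_eqF // Rroot_gt0.
apply: eq_bigr => i _.
have b0 : Broot a y + a i ^+ 2 * w ^+ 2 != 0 by rewrite gt_eqF // Bi_gt0.
rewrite rhat_sqrD rhatE xcE ycE.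
move: (basis R (xidx i)) (basis R (yidx i)) => e f.
apply/rowP => j; rewrite !mxE; field.
by rewrite exprMn b0 w0.
Qed.

Lemma mp_FE : mp_F a x = Fhat a y.
Proof.
have w0 : w != 0 by rewrite gt_eqF.
rewrite /mp_F /Fhat; congr (_ - _); apply: eq_bigr => i _.
have b0 : Broot a y + a i ^+ 2 * w ^+ 2 != 0 by rewrite gt_eqF // Bi_gt0.
rewrite rhat_sqrD xcE ycE /rho; field.
by rewrite exprMn b0 w0.
Qed.

Lemma mp_PiE : mp_Pi a x = Pihat a y / (w ^+ 2) ^+ n./2.
Proof.
rewrite /mp_Pi /Pihat -[X in _ / _ ^+ X]card_ord -prodr_const -prodf_div.
by apply: eq_bigr => i _; rewrite rhat_sqrD.
Qed.

Lemma mp_hE : mp_h m a x = Hhat m a y * w ^+ 2.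
Proof.
have w0 : w != 0 by rewrite gt_eqF.
have P0 : Pihat a y != 0 by rewrite gt_eqF // Pihat_gt0.
have F0 : Fhat a y != 0 by rewrite gt_eqF // Fhat_gt0.
rewrite /mp_h mp_PiE mp_FE rhatE /Hhat expr_div_n -exprM.
have -> : w ^+ (2 * n./2) = w ^+ (2 - odd n) * w ^+ (n - 4) * w ^+ 2.
  rewrite -!exprD; congr (_ ^+ _).
  have := odd_double_half n; rewrite -muln2; case: (odd n) => /=; lia.
have := expf_neq0 (2 - odd n) w0; have := expf_neq0 (n - 4) w0.
move: (w ^+ (2 - odd n)) (w ^+ (n - 4)) (Rroot a y ^+ (2 - odd n)) => u v r v0 u0.
by field; rewrite P0 F0 w0 u0 v0.
Qed.

(** The Jacobian is w times a reflection. The reflection preserves the flat metric and sends q to w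
    K, so the perturbation is pulled back to w^4 [Hhat] times K (x) K, that is, w^2 h K (x) K. *)
Lemma conformal_inversion :
  'J (@inversion R n) x *m gres m a y *m ('J (@inversion R n) x)^T =
  w ^+ 2 *: myers_perry m a x.
Proof.
have w0 : w != 0 by rewrite gt_eqF.
have sx : sep x = w^-1 by rewrite sep_inversion.
have sx0 : sep x != 0 by rewrite sx invr_eq0.
have yx : y = w *: x by rewrite scalerA divff // scale1r.
rewrite jacobian_inversion // sx invrK.
set u := lower x; set N := u^T *m x.
have NT : N^T = x^T *m u by rewrite rank1_tr.
have PT : (1%:M - (2 * w) *: N)^T = 1%:M - (2 * w) *: (x^T *m u).
  by rewrite linearB /= trmx1 linearZ /= NT.
(* [qvec] is w times the reflection of K in the same hyperplane, and a reflection is its own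
   inverse. *)
have qN : qvec a y *m (1%:M - (2 * w) *: N)^T = w *: Kvec a y.
  rewrite PT mulmxBr mulmx1 -scalemxAr mulmxA.
  rewrite mul_tr_dot mul_scalar_mx.
  set K := Kvec a y; have -> : qvec a y = w *: K - (2 * w ^+ 2 * dot K x) *: u.
    have ly : lower y = w *: u by rewrite {1}yx /u -!mul_minkowski scalemxAl.
    have dK : dot K y = w * dot K x.
      by rewrite {1}yx dotZr.
    by rewrite /qvec -/K ly dK scalerA; congr (_ - _ *: _); ring.
  have -> : dot (w *: K - (2 * w ^+ 2 * dot K x) *: u) x = - (w * dot K x).
    have -> : dot (w *: K - (2 * w ^+ 2 * dot K x) *: u) x =
        w * dot K x - 2 * w ^+ 2 * dot K x * dot u x.
      by rewrite dotBl !dotZl.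
    by rewrite /u dot_lower sx; field.
  by apply/rowP => j; rewrite !mxE; ring.
have eN : (1%:M - (2 * w) *: N) *m minkowski R n *m (1%:M - (2 * w) *: N)^T = minkowski R n.
  rewrite PT.
  rewrite mulmxBl mul1mx -scalemxAl /N rank1_minkowski -/u.
  rewrite mulmxBl !mulmxBr !mulmx1 -!scalemxAr minkowski_rank1 -/u.
  rewrite -scalemxAl rank1_mul /u dot_lower sx.
  by move: (_^T *m lower x) => M; apply/matrixP => i j; rewrite !mxE; field.
set M := 1%:M - (2 * w) *: N in qN eN *.
have MT : (w *: M)^T = w *: M^T by rewrite linearZ.
rewrite MT -!scalemxAl -scalemxAr scalerA -expr2.
congr (_ *: _); rewrite /gres mulmxDr mulmxDl eN /myers_perry; congr (_ + _).
rewrite -scalemxAr -scalemxAl mp_kE mp_hE.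
have -> : M *m ((qvec a y)^T *m qvec a y) *m M^T
   = (w *: Kvec a y)^T *m (w *: Kvec a y).
  by rewrite -qN trmx_mul trmxK !mulmxA.
have -> : (w *: Kvec a y)^T = w *: (Kvec a y)^T by rewrite linearZ.
by rewrite -scalemxAl -scalemxAr !scalerA -mulrA -expr2.
Qed.

End PhysicalPoint.

(** The larger manifold is a full ball: it includes timelike [y], which belong neither to the image
    of the spacetime nor to its boundary. *)
Definition mp_completion (delta : R) : completion R n :=
  @Completion R n [set x | 0 < sep x /\ `|inversion x| < delta]
    [set y | `|y| < delta] (@inversion R n) 0 (@sep R n) (gres m a).

(** The last condition bounds minus the determinant of [gres] away from 0; it yields both the
    signature and the regularity of the inverse metric. *)
Definition good_radius (delta : R) : Prop :=
  [/\ 0 < delta, delta <= radius0 a &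
      forall y, `|y| < delta -> 2^-1 <= 1 + Hhat m a y * sep (qvec a y)].

(** [Hhat * sep (qvec a y)] has weight n - 6 + 4, at least 1, hence is O(|y|). *)
Lemma good_radius_exists : exists delta, good_radius delta.
Proof.
have H : sym U (fun y => `|y|) 0 1 (fun y => Hhat m a y * sep (qvec a y)).
  have oU := @open_pball R n a; have oG := @norm_pball_gt0 R n a.
  have n0 : (0 < n)%N by apply: leq_trans n_ge4.
  have Hs : sym U (fun y => `|y|) 0 4 (fun y => sep (qvec a y)).
    apply: sym_sum => // j _; apply: symZ => //.
    by have := symX oU oG 2 (sym_qvec a n0 j).
  apply: (sym_le oG (@norm_pball_le1 R n a) _ (symM oU oG (sym_Hhat m a n_ge4 n0) Hs)).
  by lia.
have [C C0 HC] := sym_bound (@norm_pball_gt0 R n a) H.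
exists (Num.min (radius0 a) (2 * C)^-1); split.
- by rewrite lt_min radius0_gt0 invr_gt0 mulr_gt0.
- by rewrite ge_min lexx.
move=> y; rewrite lt_min => /andP[y1 y2].
have [->|y0] := eqVneq y 0; first by rewrite qvec0 sep0 mulr0 addr0; lra.
have := HC y (conj y0 y1); rewrite expr1z => h.
have h2 : C * `|y| <= 2^-1.
  have : `|y| * (2 * C) <= 1 by rewrite -ler_pdivlMr ?mulr_gt0 // mul1r ltW.
  by lra.
have := le_trans h h2; rewrite ler_norml => /andP[h3 _].
by lra.
Qed.

End Completion.

(** * The conformal completion *)

Section CompletionProof.
Variables (R : realType) (n : nat) (m : R) (a : 'I_n./2 -> R).
Hypothesis n_ge4 : (4 <= n)%N.
Local Notation V := 'rV[R]_n.+1.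
Implicit Types (x y p : V).
Variable delta : R.
Hypothesis delta_good : good_radius m a delta.
Local Notation C := (mp_completion m a delta).

Let delta_gt0 : 0 < delta. Proof. by case: delta_good. Qed.

Lemma sep_neq0 x : sep x != 0 -> x != 0.
Proof. by apply: contra_neq => ->; rewrite sep0. Qed.

Lemma pball_delta y : y != 0 -> `|y| < delta -> pball a y.
Proof. by move=> y0 yd; split=> //; case: delta_good => _ h _; apply: lt_le_trans h. Qed.

Lemma physicalE : physical C = [set y | 0 < sep y /\ `|y| < delta].
Proof.
apply/seteqP; split=> [y [x [/= x1 x2] <-]|y [/= y1 y2]] /=.
  by rewrite sep_inversion invr_gt0.
exists (inversion y) => /=; last by rewrite inversionK // gt_eqF.
by rewrite sep_inversion invr_gt0 inversionK ?gt_eqF.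
Qed.

Lemma physical_sub_pball : physical C `<=` pball a.
Proof.
by rewrite physicalE => y [/= y1 y2]; apply: pball_delta => //; apply: sep_neq0; rewrite gt_eqF.
Qed.

Lemma open_sep_gt0 : open [set y : V | 0 < sep y].
Proof.
have := @open_comp V R (@sep R n) [set x : R | 0 < x].
by apply; [move=> x _; exact: continuous_sep | exact: open_gt].
Qed.

Lemma open_physical : open (physical C).
Proof.
rewrite physicalE; apply: (openI (A := [set y | 0 < sep y])).
  exact: open_sep_gt0.
exact: open_norm_lt.
Qed.

Lemma open_region : open (region C).
Proof.
rewrite openE => x [/= x1 x2].
have c : {for x, continuous (@inversion R n)}.
  by apply: differentiable_continuous; apply: differentiable_inversion; rewrite gt_eqF.
have H1 : nbhs x [set y : V | 0 < sep y].
  by apply: open_nbhs_nbhs; split => //; exact: open_sep_gt0.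
have H2 : nbhs x (@inversion R n @^-1` [set y : V | `|y| < delta]).
  by apply: c; apply: open_nbhs_nbhs; split => //; exact: open_norm_lt.
exact: filterS2 H1 H2.
Qed.

Lemma line_cvg (p v : V) : h *: v + p @[h --> (0 : R)] --> p.
Proof.
suff : h *: v + p @[h --> (0 : R)] --> 0 *: v + p by rewrite scale0r add0r.
by apply: cvgD; [apply: cvgZr_tmp; exact: cvg_id | exact: cvg_cst].
Qed.

(** Moving a null point by h along the last coordinate, with h of the sign of that coordinate,
    changes [sep] from 0 to at least h^2. *)
Lemma closure_physical p : `|p| < delta -> sep p = 0 -> closure (physical C) p.
Proof.
move=> pd sp B Bp.
have n0 : (ord_max : 'I_n.+1) != ord0 by rewrite -val_eqE /= -lt0n; apply: leq_trans n_ge4.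
have Bp' : nbhs p (B `&` [set y | `|y| < delta]).
  by apply: filterI => //; apply: open_nbhs_nbhs; split => //; exact: open_norm_lt.
have /= [e /= e0 He] := line_cvg (basis R ord_max) Bp'.
have step (h : R) : h != 0 -> `|h| < e -> 0 <= h * p 0 ord_max -> physical C `&` B !=set0.
  move=> h0 he hp; exists (h *: basis R ord_max + p).
  have [|h1 /= h2] := He h; first by rewrite /= sub0r normrN.
  split=> //; rewrite physicalE; split=> //=.
  rewrite sep_basis // sp add0r.
  have : 0 < h ^+ 2 by rewrite exprn_even_gt0.
  by rewrite -mulrA; move: hp; lra.
have e2 : `|e / 2| < e by rewrite gtr0_norm ?divr_gt0 //; lra.
have e20 : e / 2 != 0 by rewrite gt_eqF // divr_gt0.
have [h|h] := leP 0 (p 0 ord_max).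
  by apply: (step (e / 2)) => //; rewrite mulr_ge0 // ltW // divr_gt0.
apply: (step (- (e / 2))); rewrite ?oppr_eq0 ?normrN //.
by rewrite mulNr -mulrN mulr_ge0 ?oppr_ge0 // ltW // divr_gt0.
Qed.

Lemma closure_physical_sep p : closure (physical C) p -> 0 <= sep p.
Proof.
move=> cp; rewrite leNgt; apply/negP => sp.
have /cp [q []] : nbhs p [set y | sep y < 0].
  by have := @continuous_sep R n p => /cvgr_lt; apply.
by rewrite physicalE => -[/= q1 _] q2; have := lt_trans q1 q2; rewrite ltxx.
Qed.

Lemma addedE : added C = [set p | `|p| < delta /\ sep p = 0].
Proof.
apply/seteqP; split=> [p [/= p1 [p2 p3]]|p [/= p1 p2]].
  split=> //; apply/eqP; rewrite eq_le closure_physical_sep // andbT leNgt.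
  by apply/negP => sp; apply: p3; rewrite physicalE.
split=> //; split; first exact: closure_physical.
by rewrite physicalE => -[/=]; rewrite p2 ltxx.
Qed.

Lemma null_tc p : p != 0 -> sep p = 0 -> tc p != 0.
Proof.
move=> p0 sp; have := esq_gt0 p0; rewrite -[esq p](subrK (2 * tc p ^+ 2)) -sep_esq sp add0r.
by apply: contraTneq => ->; rewrite expr0n /= mulr0 ltxx.
Qed.

(** The spacetime point above [q] has time [tc q / sep q], whose numerator stays away from 0 while
    the denominator tends to 0 from above. The signs s = 1 and s = -1 treat future and past null
    infinity together. *)
Lemma near_scri p (s A : R) : s ^+ 2 = 1 -> `|p| < delta -> sep p = 0 -> 0 < s * tc p ->
  \forall q \near p, forall x, region C x -> emb C x = q -> A < s * tc x.
Proof.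
move=> s2 pd sp tp.
(* With [sep q < e], the product [(|A| + 1) * sep q] stays below half of [s * tc p], which is below
   [s * tc q]. *)
pose e := s * tc p / (2 * (`|A| + 1)).
have A0 : 0 < `|A| + 1 by rewrite ltr_wpDl.
have e0 : 0 < e by rewrite divr_gt0 // mulr_gt0.
have H1 : \forall q \near p, sep q < e.
  by have := @continuous_sep R n p => /cvgr_lt; apply; rewrite sp.
have H2 : \forall q \near p, s * tc p / 2 < s * tc q.
  have : {for p, continuous (fun q : V => s * tc q)}.
    by apply: continuousM; [exact: cst_continuous | exact: coord_continuous].
  by move=> /cvgr_gt; apply; lra.
apply: filterS2 H1 H2 => q H1 H2 x [/= x1 x2] xq.
have sq : 0 < sep q by rewrite -xq sep_inversion invr_gt0.
have -> : x = inversion q by rewrite -xq inversionK // gt_eqF.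
rewrite /tc mxE -/(tc q) mulrCA mulrC ltr_pdivlMr //.
apply: le_lt_trans H2; apply: (@le_trans _ _ ((`|A| + 1) * e)); last first.
  rewrite /e (_ : (`|A| + 1) * (s * tc p / (2 * (`|A| + 1))) = s * tc p / 2) //.
  by field; rewrite gt_eqF.
apply: (@le_trans _ _ ((`|A| + 1) * sep q)).
  rewrite ler_wpM2r ?(ltW sq) //; have := ler_norm A; lra.
by rewrite ler_wpM2l ?ltW.
Qed.

Lemma scriE : scri C = [set p | [/\ `|p| < delta, sep p = 0 & p != 0]].
Proof.
apply/seteqP; split=> [p|p [/= p1 p2 p3]].
  by rewrite /scri /scri_plus /scri_minus addedE => -[] [] [].
have tp := null_tc p3 p2.
have ap : added C p by rewrite addedE.
have [t0|t0] := ltP 0 (tc p); [left|right]; split=> // A.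
  have := @near_scri p 1 A (expr1n _ _) p1 p2; rewrite mul1r => /(_ t0).
  by apply: filterS => q H x xr xq; rewrite -[tc x]mul1r; apply: H.
have t0' : 0 < -1 * tc p by rewrite mulN1r oppr_gt0 lt_neqAle tp.
have s1 : (-1) ^+ 2 = 1 :> R by rewrite sqrrN expr1n.
apply: filterS (@near_scri p (-1) (- A) s1 p1 p2 t0') => q H x xr xq.
by have := H x xr xq; rewrite mulN1r ltrN2.
Qed.

(** With r = [rad x] and t = [tc x], the norm of x is at most r + |t| and [sep x] is (r - |t|) (r +
    |t|), so the inverse point has norm at most 1 / (r - |t|). *)
Lemma spatial_infinity_inversion (W : set V) : nbhs (0 : V) W -> exists r0 : R,
  forall x, `|tc x| + r0 < rad x -> region C x /\ W (inversion x).
Proof.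
move=> /nbhs_normP [e /= e0 He].
pose e' := Num.min e delta.
have e'0 : 0 < e' by rewrite lt_min e0 delta_gt0.
exists e'^-1 => x xr.
have r0 : 0 < e'^-1 by rewrite invr_gt0.
have t0 : 0 <= `|tc x| by [].
have R0 : 0 <= rad x by exact: sqrtr_ge0.
have R2 : rad x ^+ 2 = spat x by rewrite sqr_sqrtr // spat_ge0.
have sx : sep x = (rad x - `|tc x|) * (rad x + `|tc x|).
  by rewrite sepE -R2 -(real_normK (num_real (tc x))); ring.
have Rp : 0 < rad x + `|tc x| by lra.
have s1 : e'^-1 * (rad x + `|tc x|) < sep x by rewrite sx ltr_pM2r //; lra.
have s0 : 0 < sep x by apply: lt_trans s1; rewrite mulr_gt0.
have nx : `|x| <= rad x + `|tc x|.
  rewrite -(ler_pXn2r (n := 2)) ?nnegrE ?normr_ge0 ?(ltW Rp) //.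
  apply: le_trans (esq_ge_norm x) _.
  rewrite esqE -R2 -(real_normK (num_real (tc x))).
  have : 0 <= rad x * `|tc x| by rewrite mulr_ge0.
  rewrite sqrrD; lra.
have H : `|inversion x| < e'.
  rewrite normrZ normfV (gtr0_norm s0) mulrC ltr_pdivrMr //.
  rewrite -ltr_pdivrMl // .
  apply: le_lt_trans s1; apply: ler_wpM2l => //; exact: ltW.
move: H; rewrite lt_min => /andP[h1 h2]; split; first by split.
by apply: He; rewrite /= sub0r normrN.
Qed.

Lemma mp_conformal_completion :
  conformal_completion (mp_domain a) (myers_perry m a) C.
Proof.
have inv_pball x : region C x -> pball a (inversion x) /\ 0 < sep (inversion x).
  move=> [/= x1 x2]; split; last by rewrite sep_inversion invr_gt0.
  by apply: pball_delta => //; apply: sep_neq0; rewrite sep_inversion invr_eq0 gt_eqF.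
have invK x : region C x -> inversion (inversion x) = x.
  by move=> [/= x1 _]; rewrite inversionK // gt_eqF.
split.
- exact: open_region.
- move=> x xr; have [h1 h2] := inv_pball x xr.
  by exists (Rroot a (inversion x) / sep (inversion x)); rewrite -{1}(invK x xr); exact: is_rhat_Rroot.
- exact: open_norm_lt.
- by rewrite physicalE => y [].
- move=> x y; rewrite !inE => xr yr /= E.
  by rewrite -(invK x xr) -(invK y yr) E.
- move=> j k; have [h1 h2] := inversion_smooth R j k; split.
    by move=> s i x sk [/= x1 _]; exact: h1.
  by move=> s x sk [/= x1 _]; exact: h2.
- exact: open_physical.
- by rewrite addedE; split; rewrite /= ?normr0 // sep0.
- rewrite addedE scriE; apply/seteqP; split=> [p [/= p1 p2]|p [/= ->|[/= p1 p2 _]]] //.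
    by have [->|p0] := eqVneq p 0; [left | right].
  by rewrite normr0 sep0.
- exact: spatial_infinity_inversion.
- by move=> p _; exact: continuous_sep.
- by rewrite physicalE => y [].
- by rewrite addedE => p [].
- move=> y yd; apply: lorentzian_rank1; case: delta_good => _ _ H.
  by apply: lt_le_trans (H y yd); lra.
- move=> x xr; have [h1 h2] := inv_pball x xr.
  have := conformal_inversion m n_ge4 h1 h2.
  by rewrite (invK x xr).
Qed.

End CompletionProof.

(** * Regularity *)

Section PuncturedBall.
Variables (R : realType) (n : nat).
Local Notation V := 'rV[R]_n.+1.
Local Notation omega := (fun y : V => `|y|).
Implicit Types (x y z : V) (f : V -> R).
Variable r : R.
Hypothesis r_gt0 : 0 < r.
Local Notation U := [set y : V | y != 0 /\ `|y| < r].
Local Notation sym := (sym U omega).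

Lemma norm_basis (j : 'I_n.+1) : `|basis R j| <= 1.
Proof.
have b0 : basis R j != 0.
  by apply/eqP => /rowP /(_ j) /eqP; rewrite !mxE !eqxx oner_eq0.
have [l ->] := norm_attained b0.
by rewrite mxE eqxx /=; case: (_ == _); rewrite ?normr1 ?normr0.
Qed.


Lemma is_derive_0_flat f C (v : V) : f 0 = 0 ->
  (forall x, U x -> `|f x| <= C * `|x| ^ 2) -> is_derive (0 : V) v f 0.
Proof.
move=> f0 HC.
suff lim : h^-1 *: ((f \o shift 0) (h *: v) - f 0) @[h --> 0^'] --> (0 : R^o).
  by split; [apply/cvg_ex; eexists; exact: lim | exact: cvg_lim lim].
have HC' x : `|x| < r -> `|f x| <= `|C| * `|x| ^ 2.
  move=> xr; have [->|x0] := eqVneq x 0.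
    by rewrite f0 normr0 mulr_ge0 ?exprz_ge0.
  by apply: le_trans (HC x _) _; rewrite ?ler_wpM2r ?exprz_ge0 ?ler_norm.
pose D := `|v| + 1; have D0 : 0 < D by rewrite ltr_wpDl.
apply/cvgrPdist_lt => e e0; apply: cvg_within.
pose d := Num.min (r / D) (e / ((`|C| + 1) * D ^+ 2)).
have C1 : 0 < `|C| + 1 by rewrite ltr_wpDl.
have d0 : 0 < d by rewrite lt_min !divr_gt0 // mulr_gt0 // exprn_gt0.
exists d => //= h; rewrite /ball_ /= !sub0r !normrN /d lt_min => /andP[h1 h2].
have [->|hn0] := eqVneq h 0; first by rewrite invr0 scale0r normr0.
have hp : 0 < `|h| by rewrite normr_gt0.
rewrite addr0 f0 subr0 normrZ normfV.
have vD : `|v| <= D by rewrite lerDl.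
have hv : `|h *: v| <= `|h| * D by rewrite normrZ ler_wpM2l.
have hr : `|h *: v| < r by apply: le_lt_trans hv _; rewrite -ltr_pdivlMr.
rewrite ltr_pdivrMl //; apply: le_lt_trans (HC' _ hr) _.
apply: (@le_lt_trans _ _ (`|C| * (`|h| * D) ^+ 2)).
  rewrite ler_wpM2l // -exprnP; apply: lerXn2r => //; rewrite nnegrE //.
  by rewrite mulr_ge0 // ltW.
have -> : `|C| * (`|h| * D) ^+ 2 = `|h| * (`|h| * (`|C| * D ^+ 2)) by ring.
rewrite ltr_pM2l //.
apply: (@le_lt_trans _ _ (`|h| * ((`|C| + 1) * D ^+ 2))).
  by rewrite ler_wpM2l // ler_wpM2r ?exprn_ge0 ?(ltW D0) // lerDl.
by rewrite -ltr_pdivlMr // mulr_gt0 // exprn_gt0.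
Qed.

Lemma is_derive_line f (z v : V) (t : R) : derivable f (t *: v + z) v ->
  is_derive t 1 (fun t : R => f (t *: v + z)) ('D_v f (t *: v + z)).
Proof.
move=> df.
have E : (fun h : R => h^-1 *: (((fun t : R => f (t *: v + z)) \o shift t) (h *: (1 : R)) - f (t *: v + z)))
       = (fun h : R => h^-1 *: ((f \o shift (t *: v + z)) (h *: v) - f (t *: v + z))).
  apply/funext => h /=; congr (_ *: (f _ - _)).
  by rewrite -[_ *: (1 : R)]/(h * 1) mulr1 scalerDl addrA.
split; first by rewrite /derivable E.
by rewrite /derive E.
Qed.

(** The mean value theorem applies when the segment avoids the origin, where [f] need not be
    differentiable. Otherwise the bound [C * |x|] at both endpoints does the job. *)
Lemma axis_lipschitz f j C z (c : R) : f 0 = 0 -> sym 1 1 f -> 0 <= C ->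
  (forall x, U x -> `|f x| <= C * `|x|) ->
  (forall x, U x -> `|'D_(basis R j) f x| <= C) ->
  0 <= c -> `|z| < r -> `|c *: basis R j + z| < r ->
  `|f (c *: basis R j + z) - f z| <= C * c.
Proof.
move=> f0 Hf C0 HC HD c0 zr czr.
set e := basis R j.
have HC' x : `|x| < r -> `|f x| <= C * `|x|.
  move=> xr; have [->|x0] := eqVneq x 0; first by rewrite f0 !normr0 mulr0.
  exact: HC.
have seg t : 0 <= t <= c -> `|t *: e + z| < r.
  move=> /andP[t0 tc]; have [c00|cn0] := eqVneq c 0.
    by have -> : t = 0 by [lra]; rewrite scale0r add0r.
  have cp : 0 < c by rewrite lt0r cn0.
  have -> : t *: e + z = (t / c) *: (c *: e + z) + (1 - t / c) *: z.
    by rewrite scalerDr scalerA divfK // -addrA -scalerDl addrCA subrr addr0 scale1r.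
  have tc1 : t / c <= 1 by rewrite ler_pdivrMr // mul1r.
  have tc0 : 0 <= t / c by rewrite divr_ge0.
  have A1 : 0 <= 1 - t / c by rewrite subr_ge0.
  apply: le_lt_trans (ler_normD _ _) _.
  move: (t / c) tc0 A1 => u u0 A1.
  rewrite (normrZ u) (normrZ (1 - u)) (ger0_norm u0) (ger0_norm A1).
  have [->|un] := eqVneq u 0; first by rewrite mul0r add0r subr0 mul1r.
  have -> : r = u * r + (1 - u) * r by ring.
  apply: ltr_leD; first by rewrite ltr_pM2l // lt0r un.
  by apply: ler_wpM2l => //; exact: ltW.
(* If the origin is met at time b, the endpoints have norms at most b and c - b, which add up to
   c. *)
have [[b [/andP[b0 b1] bz]]|no0] := pselect (exists t, 0 <= t <= c /\ t *: e + z = 0).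
  have zE : z = - b *: e by rewrite scaleNr; apply/eqP; rewrite -addr_eq0 addrC bz.
  apply: le_trans (ler_normB _ _) _.
  apply: le_trans (lerD (HC' _ czr) (HC' _ zr)) _.
  rewrite zE -scalerDl !normrZ normrN !ger0_norm ?subr_ge0 // -mulrDr -mulrDl subrK.
  by apply: ler_wpM2l => //; rewrite ler_piMr // norm_basis.
have inU t : 0 <= t <= c -> U (t *: e + z).
  by move=> tc; split; [apply/eqP => E; apply: no0; exists t | exact: seg].
have [||t /andP[t0 tc] E] := @MVT_segment R (fun t : R => f (t *: e + z))
  (fun t : R => 'D_e f (t *: e + z)) 0 c c0.
- move=> t; rewrite in_itv /= => /andP[/ltW t0 /ltW tc]; apply: is_derive_line.
  by apply: sym_derivable Hf _; apply: inU; rewrite t0.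
- apply: (@continuous_in_subspaceT _ _ `[0, c]) => t.
  rewrite inE /= in_itv /= => tc.
  apply: (@continuous_comp _ _ _ (fun t : R => t *: e + z) f).
    apply: (@cvgD _ V); first by apply: cvgZr_tmp; exact: cvg_id.
    exact: cvg_cst.
  by apply: sym_continuous Hf _; exact: inU.
move: E; rewrite scale0r add0r subr0 => ->.
rewrite normrM (ger0_norm c0) ler_wpM2r // HD //; apply: inU.
by move: t0 tc; rewrite !bnd_simp => -> ->.
Qed.

(** Coordinates are changed one at a time: balls of the sup norm are boxes, so the intermediate
    points stay inside. *)
Lemma sym_lipschitz f : f 0 = 0 -> sym 1 1 f ->
  exists2 L, 0 <= L & forall x y, `|x| < r -> `|y| < r -> `|f x - f y| <= L * `|x - y|.
Proof.
move=> f0 Hf.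
have oG y : U y -> 0 < `|y| by case; rewrite normr_gt0.
have [C1 C10 HC1] := sym_bound oG Hf.
have H j := sym_bound oG (sym_D j Hf).
have [c Hc] := choice (fun j => (let: ex_intro2 c0 h1 h2 := H j in
  ex_intro (fun c0 => 0 < c0 /\ _) c0 (conj h1 h2))).
pose C := C1 + \sum_j c j.
have c0 j : 0 <= c j by apply: ltW; apply: (Hc j).1.
have cs j : c j <= C.
  rewrite /C (bigD1 j) //= addrCA lerDl; apply: addr_ge0; first exact: ltW.
  exact: sumr_ge0.
have C0 : 0 <= C by apply: addr_ge0; [exact: ltW | exact: sumr_ge0].
have HC x : U x -> `|f x| <= C * `|x|.
  move=> Ux; apply: le_trans (HC1 x Ux) _; rewrite expr1z ler_wpM2r // lerDl.
  exact: sumr_ge0.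
have HD j x : U x -> `|'D_(basis R j) f x| <= C.
  move=> Ux; apply: le_trans ((Hc j).2 x Ux) _.
  by rewrite subrr expr0z mulr1.
have axis j z (d : R) : `|z| < r -> `|d *: basis R j + z| < r ->
    `|f (d *: basis R j + z) - f z| <= C * `|d|.
  move=> zr dzr; have [d0|d0] := leP 0 d; first by rewrite (ger0_norm d0); exact: (axis_lipschitz f0 Hf C0 HC (HD j) d0 zr dzr).
  have zE : z = (- d) *: basis R j + (d *: basis R j + z).
    by rewrite scaleNr addrA addNr add0r.
  have nd : 0 <= - d by rewrite oppr_ge0 ltW.
  have zr' : `|- d *: basis R j + (d *: basis R j + z)| < r by rewrite -zE.
  have := axis_lipschitz f0 Hf C0 HC (HD j) nd dzr zr'.
  by rewrite -zE distrC (ltr0_norm d0).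
exists (n.+1%:R * C); first by rewrite mulr_ge0.
move=> x y xr yr.
pose zz k : V := \row_j (if (j < k)%N then x 0 j else y 0 j).
have zr k : `|zz k| < r.
  have [->|z0] := eqVneq (zz k) 0; first by rewrite normr0.
  have [j ->] := norm_attained z0; rewrite mxE.
  by case: ifP => _; [apply: le_lt_trans xr | apply: le_lt_trans yr]; exact: coord_le_norm.
have z0 : zz 0%N = y by apply/rowP => j; rewrite mxE ltn0.
have zn : zz n.+1 = x by apply/rowP => j; rewrite mxE ltn_ord.
have zS (j : 'I_n.+1) : zz j.+1 = (x 0 j - y 0 j) *: basis R j + zz j.
  apply/rowP => l; rewrite !mxE eqxx /= ltnS leq_eqVlt.
  have [lj|lj] := eqVneq l j; first by rewrite lj eqxx ltnn /= mulr1 subrK.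
  by rewrite val_eqE (negbTE lj) /= mulr0 add0r.
have -> : f x - f y = \sum_(0 <= k < n.+1) (f (zz k.+1) - f (zz k)).
  by rewrite telescope_sumr // zn z0.
rewrite big_mkord; apply: le_trans (ler_norm_sum _ _ _) _.
apply: (@le_trans _ _ (\sum_(j < n.+1) C * `|x - y|)); last first.
  by rewrite sumr_const card_ord -[leLHS]mulr_natl mulrA.
apply: ler_sum => j _; rewrite zS.
apply: le_trans (axis j (zz j) _ (zr j) _) _; first by rewrite -zS.
apply: ler_wpM2l => //.
by have := coord_le_norm (x - y) j; rewrite !mxE.
Qed.

Hypothesis r_le1 : r <= 1.

(** A derivative of order at most k - 2 has weight at least 2, hence is O(|y|^2); since it vanishes
    at the origin, so do its own partial derivatives there. Induction on the order starts from
    [f 0 = 0]. *)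
Lemma sym_pder0 k f s : f 0 = 0 -> sym k k%:Z f -> (size s < k)%N ->
  pder s f 0 = 0 /\ ((size s).+1 < k -> forall i, derivable (pder s f) 0 (basis R i))%N.
Proof.
move=> f0 Hf.
have oG y : U y -> 0 < `|y| by case; rewrite normr_gt0.
have oL y : U y -> `|y| <= 1 by case=> _ /ltW h; apply: le_trans h r_le1.
have flat t i : ((size t).+1 < k)%N -> pder t f 0 = 0 ->
    is_derive (0 : V) (basis R i) (pder t f) 0.
  move=> tk t0; have tk' := ltnW (ltnW tk).
  have Ht := sym_pder tk' Hf.
  have Ht2 : sym (k - size t) 2 (pder t f).
    by apply: (sym_le oG oL _ Ht); lia.
  have [C _ HC] := sym_bound oG Ht2.
  exact: is_derive_0_flat HC.
elim: s => [|i s IH] /= sk.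
  by split=> // k1 i; case: (flat [::] i k1 f0).
have [s0 _] := IH (ltnW sk).
have E : 'D_(basis R i) (pder s f) 0 = 0 by case: (flat s i sk s0).
by split=> // k2 j; case: (flat (i :: s) j k2 E).
Qed.

End PuncturedBall.

(** * The Hölder class of the rescaled metric *)

Section Regularity.
Variables (R : realType) (n : nat) (m : R) (a : 'I_n./2 -> R).
Hypothesis n_ge4 : (4 <= n)%N.
Local Notation V := 'rV[R]_n.+1.
Implicit Types (x y p : V).
Variable delta : R.
Hypothesis delta_good : good_radius m a delta.
Local Notation C := (mp_completion m a delta).
Local Notation U := [set y : V | y != 0 /\ `|y| < delta].
Local Notation omega := (fun y : V => `|y|).
Local Notation sym := (sym U omega).

(** The deviation from the flat metric. It is isolated because it has weight n - 2, whereas a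
    constant only has weight 0. *)
Definition Tres i j y : R := Hhat m a y * (qvec a y 0 i * qvec a y 0 j).

Lemma delta_gt0 : 0 < delta. Proof. by case: delta_good. Qed.

Lemma delta_le1 : delta <= 1.
Proof. by case: delta_good => _ h _; apply: le_trans h (radius0_le1 a). Qed.

Lemma ball_sub_pball : U `<=` pball a.
Proof. by move=> y [y0 yd]; exact: (pball_delta delta_good). Qed.

Lemma open_ball : open U.
Proof.
have -> : U = [set y | 0 < `|y|] `&` [set y | `|y| < delta].
  by apply/seteqP; split=> y [/=]; rewrite normr_gt0.
by apply: openI; [exact: open_norm_gt | exact: open_norm_lt].
Qed.

Lemma norm_ball_gt0 y : U y -> 0 < omega y.
Proof. by case; rewrite normr_gt0. Qed.

Lemma norm_ball_le1 y : U y -> omega y <= 1.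
Proof. by case=> _ /ltW h; apply: le_trans h delta_le1. Qed.

Lemma sym_T i j : sym (n - 2) (n - 2)%N (Tres i j).
Proof.
have k : (n - 2 < n)%N by lia.
have := sym_sub ball_sub_pball (sym_Tres m a n_ge4 k i j).
by have -> : n%:Z - 2 = (n - 2)%N by lia.
Qed.

Lemma Tres0 i j : Tres i j 0 = 0.
Proof. by rewrite /Tres qvec0 !mxE !mulr0. Qed.

Lemma gres_Tres i j : (fun y => gres m a y i j) = (fun y => minkowski R n i j + Tres i j y).
Proof. by apply/funext => y; rewrite gresE. Qed.

Lemma derive_addl (f : V -> R) (c : R) x v :
  'D_v (fun y => c + f y) x = 'D_v f x.
Proof.
have E : (fun h : R => h^-1 *: (((fun y => c + f y) \o shift x) (h *: v) - (c + f x)))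
       = (fun h : R => h^-1 *: ((f \o shift x) (h *: v) - f x)).
  by apply/funext => h /=; rewrite opprD addrACA subrr add0r.
by rewrite /derive E.
Qed.

Lemma pder_addl (f : V -> R) (c : R) s : s != [::] ->
  pder s (fun y => c + f y) = pder s f.
Proof.
case/lastP: s => // s i _; rewrite /pder !foldr_rcons; congr foldr.
by apply/funext => x; rewrite derive_addl.
Qed.

Lemma pder_gres_diff i j s x y :
  pder s (fun y => gres m a y i j) x - pder s (fun y => gres m a y i j) y
  = pder s (Tres i j) x - pder s (Tres i j) y.
Proof.
rewrite gres_Tres; have [->|s0] := eqVneq s [::]; last by rewrite pder_addl.
by rewrite /= opprD addrACA subrr add0r.
Qed.

(** At order at most n - 3, weight at least 1 and one more derivative are left, which is what
    [sym_lipschitz] asks for. *)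
Lemma pder_T_lipschitz i j s : (size s <= n - 3)%N ->
  exists2 L, 0 <= L & forall x y, `|x| < delta -> `|y| < delta ->
    `|pder s (Tres i j) x - pder s (Tres i j) y| <= L * `|x - y|.
Proof.
move=> sn; apply: sym_lipschitz; first exact: delta_gt0.
  have sk : (size s < n - 2)%N by lia.
  by have [] := sym_pder0 delta_gt0 delta_le1 (Tres0 i j) (sym_T i j) sk.
have s2 : (size s <= n - 2)%N by lia.
have := sym_pder s2 (sym_T i j) => H.
apply: (symW (k := n - 2 - size s)); first by lia.
by apply: (sym_le norm_ball_gt0 norm_ball_le1 _ H); lia.
Qed.

Lemma gres_Ck_holder i j :
  Ck_holder_on (n - 3) 1 (manifold C) (fun y => gtilde C y i j).
Proof.
split.
  move=> s l x sn /= xd; rewrite gres_Tres.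
  have Hd : derivable (pder s (Tres i j)) x (basis R l).
    have [->|x0] := eqVneq x 0.
      have sk : (size s < n - 2)%N by lia.
      have [_ H] := sym_pder0 delta_gt0 delta_le1 (Tres0 i j) (sym_T i j) sk.
      by apply: H; lia.
    have [H _] := Ck_on_sym (sym_T i j).
    by apply: (H s l x) => //; lia.
  have [s0|s0] := eqVneq s [::]; last by rewrite pder_addl.
  rewrite s0 /=; apply: derivableD; first exact: derivable_cst.
  by rewrite s0 in Hd.
move=> s sn; have [L L0 HL] := pder_T_lipschitz i j sn.
exists L => // x y xd yd; rewrite powRr1 // pder_gres_diff.
exact: HL.
Qed.

Lemma gres_extends i j s : (size s <= n - 3)%N ->
  extends_continuously (physical C) ([set i0 C] `|` scri C)
    (pder s (fun y => gtilde C y i j)).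
Proof.
(* The derivative exists on the whole chart and is Lipschitz there, so it is its own extension. *)
move=> sn; exists (pder s (fun y => gtilde C y i j)); split=> // p Ap.
have pd : `|p| < delta.
  by case: Ap => [->|]; [rewrite /= normr0 delta_gt0 | rewrite (scriE m a n_ge4) => -[]].
have [L L0 HL] := pder_T_lipschitz i j sn.
apply: cvg_within_filter; apply/(@cvgrPdist_lt _ _ _ (nbhs p)) => e e0.
have L1 : 0 < L + 1 by rewrite ltr_wpDl.
have H1 : \forall y \near p, `|y| < delta.
  by apply: open_nbhs_nbhs; split => //; exact: open_norm_lt.
have H2 : \forall y \near p, `|p - y| < e / (L + 1).
  by apply/nbhs_normP; exists (e / (L + 1)) => //=; rewrite divr_gt0.
apply: filterS2 H1 H2 => y yd py; rewrite pder_gres_diff.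
apply: le_lt_trans (HL _ _ pd yd) _.
apply: (@le_lt_trans _ _ ((L + 1) * `|p - y|)); first by rewrite ler_wpM2r // lerDl.
by rewrite mulrC -ltr_pdivlMr.
Qed.

Lemma sym_gres i j : sym (n - 2) 0 (fun y => gres m a y i j).
Proof.
rewrite gres_Tres; apply: symD; [exact: open_ball|exact: sym_cst open_ball _ _|].
by apply: (sym_le norm_ball_gt0 norm_ball_le1 _ (sym_T i j)); lia.
Qed.

Lemma physical_sub_ball : physical C `<=` U.
Proof.
by rewrite physicalE => y [/= y1 y2]; split=> //; apply: sep_neq0; rewrite gt_eqF.
Qed.

Lemma gres_Ck i j : Ck_on (n - 2) (physical C) (fun y => gtilde C y i j).
Proof.
have [h1 h2] := Ck_on_sym (sym_gres i j).
split=> [s l x sn /physical_sub_ball xp|s x sn /physical_sub_ball xp].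
  exact: h1.
exact: h2.
Qed.

(** Order n - 2 exhausts the weight n - 2: weight 0 means bounded. *)
Lemma gres_bounded i j s : (size s <= n - 2)%N ->
  bounded_near (physical C) (i0 C) (pder s (fun y => gtilde C y i j)).
Proof.
move=> sn; have [->|s0] := eqVneq s [::].
  have [M M0 HM] := sym_bound norm_ball_gt0 (sym_gres i j).
  exists M; apply: (@filterE _ (nbhs (i0 C)) (nbhs_filter _)) => y /physical_sub_ball yp.
  by have := HM y yp; rewrite expr0z mulr1.
rewrite /= gres_Tres pder_addl //.
have H : sym (n - 2 - size s) 0 (pder s (Tres i j)).
  by apply: (sym_le norm_ball_gt0 norm_ball_le1 _ (sym_pder sn (sym_T i j))); lia.
have [M M0 HM] := sym_bound norm_ball_gt0 H.
exists M; apply: (@filterE _ (nbhs (i0 C)) (nbhs_filter _)) => y /physical_sub_ball yp.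
by have := HM y yp; rewrite expr0z mulr1.
Qed.

End Regularity.

(** * Null geodesics through i0 *)

Section Gronwall.
Variable R : realType.

(** The function e(s) exp(- K s) is nonincreasing and starts from 0. *)
Lemma gronwall0 (e de : R -> R) (K b : R) : 0 <= b ->
  (forall s, 0 <= s <= b -> is_derive s 1 e (de s)) ->
  (forall s, 0 <= s <= b -> de s <= K * e s) -> e 0 = 0 -> e b <= 0.
Proof.
move=> b0 De Hde e0.
pose phi s := e s * expR (- K * s).
have Dphi s : 0 <= s <= b -> is_derive s 1 phi ((de s - K * e s) * expR (- K * s)).
  move=> sb.
  have DK : is_derive s 1 (fun s : R => - K * s) (- K).
    have H := is_deriveZ (- K) (is_derive_id s (1 : R)).
    by apply: (is_derive_eq H); rewrite -[_ *: _]/(_ * _) mulr1.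
  have Dx : is_derive s 1 (expR \o (fun s : R => - K * s)) (expR (- K * s) * - K).
    by apply: is_derive1_comp.
  have H := is_deriveM (De s sb) Dx.
  apply: (is_derive_eq H); rewrite -![_ *: _]/(_ * _) /=; ring.
have : phi b <= phi 0.
  apply: (@ler0_derive1_nincr R phi 0 b) => //.
  - by move=> s; rewrite in_itv /= => /andP[/ltW s0 /ltW s1]; have [] := Dphi s; rewrite ?s0.
  - move=> s; rewrite in_itv /= => /andP[/ltW s0 /ltW s1].
    have sb : 0 <= s <= b by rewrite s0.
    rewrite derive1E; have [_ ->] := Dphi s sb.
    by rewrite mulr_le0_ge0 ?expR_ge0 // subr_le0 Hde.
  - apply: (@continuous_in_subspaceT _ _ `[0, b]) => s.
    rewrite inE /= in_itv /= => sb; have [h _] := Dphi s sb.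
    by apply: differentiable_continuous; apply/derivable1_diffP.
rewrite /phi e0 mul0r pmulr_lle0 // expR_gt0 //.
Qed.

End Gronwall.

Section Curves.
Variables (R : realType) (n : nat).
Local Notation V := 'rV[R]_n.+1.

Lemma is_derive_curve_coord (gam : R -> V) s l : derivable gam s 1 ->
  is_derive s 1 (fun t => gam t 0 l) (derive1 gam s 0 l).
Proof.
move=> dg; split; first exact: ((derivable_mxP gam s 1).1 dg 0 l).
by rewrite derive1E (derive_mx dg) mxE.
Qed.

Lemma is_derive_ray (v : V) (t : R) :
  derivable (fun t : R => t *: v) t 1 /\ derive1 (fun t : R => t *: v) t = v.
Proof.
have H : is_diff t (fun t : R => t *: v) ( *:%R^~ v) by exact: is_diff_scalel.
have d : differentiable (fun t : R => t *: v) t by case: H.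
split; first exact/derivable1_diffP.
by rewrite derive1E' // diff_val scale1r.
Qed.

(* The difference f of two solutions satisfies |f''| <= c (|f| + |f'|). *)
Lemma geodesic_ray_unique (G : 'I_n.+1 -> 'I_n.+1 -> 'I_n.+1 -> V -> R)
    (r L : R) (gam : R -> V) (v : V) (b : R) :
  0 < r -> 0 <= L ->
  (forall l i j x y, `|x| < r -> `|y| < r -> `|G l i j x - G l i j y| <= L * `|x - y|) ->
  (forall l i j, G l i j 0 = 0) ->
  (forall l s, `|s *: v| < r -> \sum_i \sum_j G l i j (s *: v) * v 0 i * v 0 j = 0) ->
  0 <= b -> `|b *: v| < r ->
  (forall s, 0 <= s <= b ->
    [/\ `|gam s| < r, derivable gam s 1, derivable (derive1 gam) s 1 &
      forall l, derive1 (derive1 gam) s 0 l =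
        - \sum_i \sum_j G l i j (gam s) * derive1 gam s 0 i * derive1 gam s 0 j]) ->
  gam 0 = 0 -> derive1 gam 0 = v -> gam b = b *: v.
Proof.
move=> r0 L0 GL G0 Gv b0 bv Hg g0 dg0.
have sv s : 0 <= s <= b -> `|s *: v| < r.
  move=> /andP[s0 sb]; apply: le_lt_trans bv; rewrite !normrZ ler_wpM2r //.
  by rewrite !ger0_norm.
pose f l s := gam s 0 l - s * v 0 l.
pose df l s := derive1 gam s 0 l - v 0 l.
pose ddf l s := derive1 (derive1 gam) s 0 l.
have Df l s : 0 <= s <= b -> is_derive s 1 (f l) (df l s).
  move=> sb; have [_ d1 _ _] := Hg s sb.
  have H := is_deriveZ (v 0 l) (is_derive_id s (1 : R)).
  have H2 := is_deriveB (is_derive_curve_coord l d1) H.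
  have -> : f l = (fun t => gam t 0 l) - (v 0 l \*: (id : R -> R)).
    by apply/funext => t; exact: (congr1 (fun z => gam t 0 l - z) (mulrC t (v 0 l))).
  by apply: (is_derive_eq H2); rewrite -[_ *: _]/(_ * _) mulr1.
have Ddf l s : 0 <= s <= b -> is_derive s 1 (df l) (ddf l s).
  move=> sb; have [_ _ d2 _] := Hg s sb.
  have H2 := is_deriveB (is_derive_curve_coord l d2) (is_derive_cst (v 0 l) s (1 : R)).
  by apply: (is_derive_eq H2); rewrite subr0.
(* The geodesic equation is quadratic in the velocity, hence only locally Lipschitz; the velocity is
   first bounded on the compact interval. *)
have [W W0 HW] : exists2 W, 0 <= W & forall s i, 0 <= s <= b ->
    `|derive1 gam s 0 i| <= W.
  have cn i : {within `[0, b], continuous (fun s => `|derive1 gam s 0 i|)}.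
    apply: (@continuous_in_subspaceT _ _ `[0, b]) => s.
    rewrite inE /= in_itv /= => sb; have [_ _ d2 _] := Hg s sb.
    apply: (@continuous_comp _ _ _ (fun s => derive1 gam s 0 i) (fun x : R => `|x|)).
      apply: differentiable_continuous; apply/derivable1_diffP.
      by case: (is_derive_curve_coord i d2).
    exact: norm_continuous.
  have [c Hc] := choice (fun i => let: ex_intro2 c h1 h2 := EVT_max b0 (cn i) in
    ex_intro (fun c => _) c h2).
  exists (\sum_i `|derive1 gam (c i) 0 i|); first exact: sumr_ge0.
  move=> s i sb; apply: le_trans (Hc i s _) _; first by rewrite in_itv.
  by rewrite (bigD1 i) //= lerDl sumr_ge0.
have vW i : `|v 0 i| <= W by rewrite -dg0; apply: HW; rewrite lexx.
(* A sum of squares, since the sup norm of the difference is not differentiable. *)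
pose e s := \sum_l (f l s ^+ 2 + df l s ^+ 2).
pose de s := \sum_l (2 * (f l s * df l s) + 2 * (df l s * ddf l s)).
have De s : 0 <= s <= b -> is_derive s 1 e (de s).
  move=> sb.
  have -> : e = \sum_l (f l * f l + df l * df l).
    by apply/funext => t; rewrite fct_sumE; apply: eq_bigr => l _; rewrite !expr2.
  have H l : is_derive s 1 (f l * f l + df l * df l)
      (2 * (f l s * df l s) + 2 * (df l s * ddf l s)).
    have H := is_deriveD (is_deriveM (Df l s sb) (Df l s sb)) (is_deriveM (Ddf l s sb) (Ddf l s sb)).
    by apply: (is_derive_eq H); rewrite -![_ *: _]/(_ * _); ring.
  exact: (is_derive_sum H).
have e_ge0 s : 0 <= e s.
  by apply: sumr_ge0 => l _; rewrite addr_ge0 ?sqr_ge0.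
have fe l s : `|f l s| <= Num.sqrt (e s) /\ `|df l s| <= Num.sqrt (e s).
  have H : f l s ^+ 2 + df l s ^+ 2 <= e s.
    rewrite /e (bigD1 l) //= lerDl; apply: sumr_ge0 => i _.
    by rewrite addr_ge0 ?sqr_ge0.
  have := sqr_ge0 (f l s); have := sqr_ge0 (df l s) => h1 h2.
  by split; rewrite -sqrtr_sqr; apply: ler_wsqrtr; apply: le_trans H; rewrite ?lerDl ?lerDr.
have gf s : `|gam s - s *: v| <= Num.sqrt (e s).
  have [->|x0] := eqVneq (gam s - s *: v) 0; first by rewrite normr0 sqrtr_ge0.
  by have [l ->] := norm_attained x0; rewrite !mxE; case: (fe l s).
pose c := L * W * W + L * r * (W + W).
pose K := n.+1%:R * (2 + 2 * (n.+1%:R * n.+1%:R * c)).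
have c0 : 0 <= c by rewrite addr_ge0 // !mulr_ge0 ?addr_ge0 // ltW.
have ddfE l s : 0 <= s <= b -> `|ddf l s| <= n.+1%:R * n.+1%:R * c * Num.sqrt (e s).
  move=> sb; have [g1 _ _ g2] := Hg s sb.
  have mu0 : 0 <= Num.sqrt (e s) by exact: sqrtr_ge0.
  have svr := sv s sb.
  rewrite /ddf g2 -[X in `|X|]sub0r -[X in `|X - _|](Gv l s svr) -sumrB.
  apply: le_trans (ler_norm_sum _ _ _) _.
  apply: (@le_trans _ _ (\sum_(i < n.+1) \sum_(j < n.+1) c * Num.sqrt (e s))); last first.
    by rewrite !sumr_const card_ord -!(mulr_natl (c * _)) -[leLHS]mulr_natl !mulrA.
  apply: ler_sum => i _; rewrite -sumrB; apply: le_trans (ler_norm_sum _ _ _) _.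
  apply: ler_sum => j _; set w := derive1 gam s.
  (* The change of [G] at fixed velocity costs L W^2, and the change of velocity at fixed [G] costs
     2 W times |G|, which is at most L r because [G] vanishes at 0. Their sum is [c]. *)
  have -> : G l i j (s *: v) * v 0 i * v 0 j - G l i j (gam s) * w 0 i * w 0 j =
    - ((G l i j (gam s) - G l i j (s *: v)) * w 0 i * w 0 j
    + G l i j (s *: v) * ((w 0 i - v 0 i) * w 0 j + v 0 i * (w 0 j - v 0 j))) by ring.
  have -> : c * Num.sqrt (e s) = L * W * W * Num.sqrt (e s) + L * r * (W + W) * Num.sqrt (e s).
    by rewrite /c mulrDl.
  rewrite normrN; apply: le_trans (ler_normD _ _) _; apply: lerD.
    rewrite !normrM.
    have -> : L * W * W * Num.sqrt (e s) = L * Num.sqrt (e s) * W * W by ring.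
    apply: ler_pM; rewrite ?mulr_ge0 //; last exact: HW.
    apply: ler_pM; rewrite ?mulr_ge0 //; last exact: HW.
    by apply: le_trans (GL _ _ _ _ _ g1 svr) _; rewrite ler_wpM2l.
  rewrite normrM -[leRHS]mulrA; apply: ler_pM => //.
    rewrite -[G l i j _]subr0 -(G0 l i j); apply: le_trans (GL _ _ _ _ _ svr _) _.
      by rewrite normr0.
    by rewrite subr0 ler_wpM2l // ltW.
  apply: le_trans (ler_normD _ _) _; rewrite [leRHS]mulrDl !normrM; apply: lerD.
    by rewrite mulrC; apply: ler_pM => //; [exact: HW | case: (fe i s)].
  by apply: ler_pM => //; case: (fe j s).
have He : e b <= 0.
  apply: (@gronwall0 R e de K b b0 De) => [s sb|]; last first.
    rewrite /e big1 // => l _; rewrite /f /df g0 dg0 mxE mul0r !subrr.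
    by rewrite expr0n /= addr0.
  have mu0 : 0 <= Num.sqrt (e s) by exact: sqrtr_ge0.
  have mu2 : Num.sqrt (e s) * Num.sqrt (e s) = e s by rewrite -expr2 sqr_sqrtr.
  have -> : K * e s = \sum_(l < n.+1) (2 + 2 * (n.+1%:R * n.+1%:R * c)) * e s.
    by rewrite sumr_const card_ord -[RHS]mulr_natl /K -[LHS]mulrA.
  apply: ler_sum => l _; have [h1 h2] := fe l s; have h3 := ddfE l s sb.
  rewrite [leRHS]mulrDl -mu2; apply: lerD.
    rewrite ler_wpM2l //; apply: le_trans (ler_norm _) _.
    by rewrite normrM; apply: ler_pM.
  rewrite -[in leRHS](mulrA 2) ler_wpM2l //; apply: le_trans (ler_norm _) _.
  by rewrite normrM mulrA [leRHS]mulrC; apply: ler_pM.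
have e0 : e b = 0 by apply/eqP; rewrite eq_le He e_ge0.
apply/rowP => l; rewrite mxE; apply/eqP; rewrite -subr_eq0 -normr_le0.
by have [h _] := fe l b; move: h; rewrite e0 sqrtr0.
Qed.

End Curves.

(** * The null cone of [i0] *)

Section NullCone.
Variables (R : realType) (n : nat) (m : R) (a : 'I_n./2 -> R).
Hypothesis n_ge4 : (4 <= n)%N.
Local Notation V := 'rV[R]_n.+1.
Implicit Types (x y p : V).
Variable delta : R.
Hypothesis delta_good : good_radius m a delta.
Local Notation C := (mp_completion m a delta).
Local Notation U := [set y : V | y != 0 /\ `|y| < delta].
Local Notation omega := (fun y : V => `|y|).
Local Notation sym := (sym U omega).
Local Notation T := (Tres m a).
Let oU := @open_ball R n delta.
Let oG := @norm_ball_gt0 R n delta.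
Let oL := norm_ball_le1 delta_good.

Definition Ginv l s y : R :=
  minkowski R n l s - Hhat m a y / (1 + Hhat m a y * sep (qvec a y))
    * (lower (qvec a y) 0 l * lower (qvec a y) 0 s).

(** The Christoffel symbols on the chart, with the inverse metric made explicit and the constant
    part of the metric dropped under the derivatives, so that the weighted classes apply. *)
Definition chr l i j y : R :=
  2^-1 * \sum_(s < n.+1) Ginv l s y *
   ('D_(basis R i) (T j s) y + 'D_(basis R j) (T i s) y - 'D_(basis R s) (T i j) y).

Lemma chrE l i j y : `|y| < delta -> christoffel (gres m a) y l i j = chr l i j y.
Proof.
move=> yd; rewrite /christoffel /chr; congr (_ * _); apply: eq_bigr => s _.
rewrite !gres_Tres !derive_addl; congr (_ * _).
rewrite /gres invmx_rank1; first by rewrite /Ginv !mxE big_ord1 !mxE.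
by rewrite gt_eqF //; case: delta_good => _ _ H; apply: lt_le_trans (H y yd); lra.
Qed.

Lemma TresC i j : T i j = T j i.
Proof. by apply/funext => y; rewrite /Tres (mulrC (qvec a y 0 i)). Qed.

Lemma DTres0 i j s : 'D_(basis R s) (T i j) 0 = 0.
Proof.
have s1 : (size [:: s] < n - 2)%N by rewrite /=; lia.
by have [] := sym_pder0 (delta_gt0 delta_good) (delta_le1 delta_good) (Tres0 m a i j) (sym_T n_ge4 delta_good i j) s1.
Qed.

Lemma chr0 l i j : chr l i j 0 = 0.
Proof.
by rewrite /chr big1 ?mulr0 // => s _; rewrite !DTres0 addr0 subrr mulr0.
Qed.

(** The weight is n - 3, at least 1 as n >= 4, and a second derivative is still available; this is
    what makes the Christoffel symbols Lipschitz. *)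
Lemma sym_DT i j s : sym 1 1 ('D_(basis R s) (T i j)).
Proof.
have h1 : (n - 2 = (n - 3).+1)%N by lia.
have := sym_T n_ge4 delta_good i j; rewrite {1}h1 => /sym_D => /(_ s) H.
apply: (symW (k := (n - 3)%N)); first by lia.
by apply: (sym_le oG oL _ H); lia.
Qed.

Lemma sym_Ginv l s : sym 1 0 (Ginv l s).
Proof.
have k1 : (1 < n)%N by lia.
have sub := ball_sub_pball delta_good.
have HH : sym 1 (n%:Z - 6) (Hhat m a) := sym_sub sub (sym_Hhat m a n_ge4 k1).
have Hq j : sym 1 2 (fun y => qvec a y 0 j) := sym_sub sub (sym_qvec a k1 j).
have Hlq j : sym 1 2 (fun y => lower (qvec a y) 0 j).
  apply: (sym_eq oU (f := fun y => sgn R j * qvec a y 0 j)) => [y _|]; first by rewrite [RHS]mxE.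
  by apply: (symZ oU oG).
have Hk : sym 1 4 (fun y => sep (qvec a y)).
  apply: (sym_sum oU) => j _; apply: (symZ oU oG).
  by have := symX oU oG 2 (Hq j).
have H1 : sym 1 0 (fun y => 1 + Hhat m a y * sep (qvec a y)).
  apply: (symD oU); first exact: (sym_cst _ oU).
  by apply: (sym_le oG oL _ (symM oU oG HH Hk)); lia.
have H2 : sym 1 (- 0) (fun y => (1 + Hhat m a y * sep (qvec a y))^-1).
  apply: (symV oU oG (c := 2^-1)) H1 => // y [_ yd]; rewrite expr0z mulr1.
  by case: delta_good => _ _ H; apply: le_trans (H y yd) (ler_norm _).
apply: (symB oU oG); first exact: (sym_cst _ oU).
by apply: (sym_le oG oL _ (symM oU oG (symM oU oG HH H2) (symM oU oG (Hlq l) (Hlq s)))); lia.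
Qed.

Lemma sym_chr l i j : sym 1 1 (chr l i j).
Proof.
apply: (symZ oU oG); apply: (sym_sum oU) => s _.
rewrite -[1%R](add0r (1 : int)); apply: (symM oU oG); first exact: sym_Ginv.
apply: (symB oU oG); last exact: sym_DT.
by apply: (symD oU); exact: sym_DT.
Qed.

Lemma chr_lipschitz : exists2 L, 0 <= L & forall l i j x y,
  `|x| < delta -> `|y| < delta -> `|chr l i j x - chr l i j y| <= L * `|x - y|.
Proof.
have H (t : 'I_n.+1 * 'I_n.+1 * 'I_n.+1) :=
  sym_lipschitz (delta_gt0 delta_good) (chr0 t.1.1 t.1.2 t.2) (sym_chr t.1.1 t.1.2 t.2).
have [f Hf] := choice (fun t => let: ex_intro2 c h1 h2 := H t in
  ex_intro (fun c => 0 <= c /\ _) c (conj h1 h2)).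
exists (\sum_t f t); first by apply: sumr_ge0 => t _; apply: (Hf t).1.
move=> l i j x y xd yd; apply: le_trans ((Hf (l, i, j)).2 x y xd yd) _.
apply: ler_wpM2r => //; rewrite (bigD1 (l, i, j)) //= lerDl.
by apply: sumr_ge0 => t _; apply: (Hf t).1.
Qed.

(* On the ray, both q.v and its gradient vanish. *)
Lemma DT_null (v : V) (t : R) i s : sep v = 0 -> U (t *: v) ->
  \sum_j v 0 j * 'D_(basis R i) (T j s) (t *: v) = 0.
Proof.
move=> v0 Uy; set y := t *: v in Uy *.
have k1 : (1 < n)%N by lia.
have Uy' := ball_sub_pball delta_good Uy.
have oP := @open_pball R n a; have oPG := @norm_pball_gt0 R n a.
have dH : derivable (Hhat m a) y (basis R i) := sym_derivable (sym_Hhat m a n_ge4 k1) Uy'.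
have dq j : derivable (fun y => qvec a y 0 j) y (basis R i) :=
  sym_derivable (sym_qvec a k1 j) Uy'.
have dT j : derivable (T j s) y (basis R i) :=
  sym_derivable (sym_Tres m a n_ge4 k1 j s) Uy'.
have dKv : derivable (fun x => dot (Kvec a x) v) y (basis R i).
  apply: (sym_derivable (p := 0) (k := 0) _ Uy'); apply: (sym_sum oP) => j _.
  apply: (sym_eq oP (f := fun x => v 0 j * Kvec a x 0 j)) => [x _|]; first by rewrite mulrC.
  by apply: (symZ oP oPG); exact: sym_Kvec.
have dKx : derivable (fun x => dot (Kvec a x) x) y (basis R i) :=
  sym_derivable (sym_dotK a k1) Uy'.
pose Q x := dot (qvec a x) v.
pose ell x := dot x (lower v).
(* Both [sep] and [ell] vanish on the ray, so only their own derivatives survive in the gradient of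
   [Q]. *)
have QE : Q = (fun x => sep x * dot (Kvec a x) v - 2 * (dot (Kvec a x) x * ell x)).
  apply/funext => x; rewrite /Q /qvec dotBl !dotZl dot_lowerl /ell; ring.
have Dell : is_derive y (basis R i) ell (lower v 0 i).
  have -> : ell = \sum_j (lower v 0 j \*: (fun x : V => x 0 j)).
    by apply/funext => x; rewrite fct_sumE; apply: eq_bigr => j _; rewrite mulrC.
  have H j := is_deriveZ (lower v 0 j) (is_derive_coord y i j).
  apply: (is_derive_eq (is_derive_sum H)).
  rewrite (bigD1 i) //= eqxx big1 => [|j ji]; last by rewrite eq_sym (negbTE ji) scaler0.
  by rewrite addr0 -[_ *: _]/(_ * _) mulr1.
have sy : sep y = 0 by rewrite /y sepZ v0 mulr0.
have ely : ell y = 0 by rewrite /ell /y dotZl -dot_lowerl dot_lower v0 mulr0.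
have Q0 : Q y = 0 by rewrite QE sy ely !mulr0 mul0r subrr.
have DQ : is_derive y (basis R i) Q 0.
  rewrite QE.
  have H1 := is_deriveM (is_derive_sep y i) (derivableP dKv).
  have H2 := is_deriveZ 2 (is_deriveM (derivableP dKx) Dell).
  apply: (is_derive_eq (is_deriveB H1 H2)).
  rewrite -![_ *: _]/(_ * _) sy ely.
  (* With y = t v, both remaining terms equal 2 t (K.v) times the lowered v, and they cancel. *)
  have -> : dot (Kvec a y) y = t * dot (Kvec a y) v by rewrite {2}/y dotZr.
  have -> : y 0 i = t * v 0 i by rewrite mxE.
  by rewrite mxE; ring.
have E : (fun x => Hhat m a x * qvec a x 0 s * Q x) = \sum_j (v 0 j \*: T j s).
  apply/funext => x; rewrite fct_sumE /Q /dot mulr_sumr; apply: eq_bigr => j _.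
  by rewrite -[(v 0 j \*: T j s) x]/(v 0 j * T j s x) /Tres; ring.
have D1 : is_derive y (basis R i) (fun x => Hhat m a x * qvec a x 0 s * Q x) 0.
  have H := is_deriveM (is_deriveM (derivableP dH) (derivableP (dq s))) DQ.
  by apply: (is_derive_eq H); rewrite Q0 scaler0 scale0r addr0.
have D2 : is_derive y (basis R i) (\sum_j (v 0 j \*: T j s))
    (\sum_j v 0 j * 'D_(basis R i) (T j s) y).
  by apply: is_derive_sum => j; exact: is_deriveZ (derivableP (dT j)).
rewrite E in D1; have [_ e1] := D1; have [_ e2] := D2.
exact: etrans (esym e2) e1.
Qed.

(** After exchanging sums, each of the three terms of the Christoffel symbol contains a derivative
    of [T] contracted with [v] in one of the indices of [T], to which [DT_null] applies. *)
Lemma chr_null (v : V) l (t : R) : sep v = 0 -> `|t *: v| < delta ->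
  \sum_i \sum_j chr l i j (t *: v) * v 0 i * v 0 j = 0.
Proof.
move=> v0 yd; have [->|y0] := eqVneq (t *: v) 0.
  by rewrite big1 // => i _; rewrite big1 // => j _; rewrite chr0 !mul0r.
have H i s := DT_null i s v0 (conj y0 yd).
set y := t *: v in H *.
pose S1 s := \sum_i v 0 i * \sum_j v 0 j * 'D_(basis R i) (T j s) y.
pose S2 s := \sum_j v 0 j * \sum_i v 0 i * 'D_(basis R j) (T i s) y.
pose S3 s := \sum_i v 0 i * \sum_j v 0 j * 'D_(basis R s) (T j i) y.
have E : \sum_i \sum_j chr l i j y * v 0 i * v 0 j =
    2^-1 * \sum_s Ginv l s y * (S1 s + S2 s - S3 s).
  transitivity (\sum_i \sum_j \sum_s 2^-1 * (Ginv l s y *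
     (v 0 i * (v 0 j * 'D_(basis R i) (T j s) y) + v 0 j * (v 0 i * 'D_(basis R j) (T i s) y)
       - v 0 i * (v 0 j * 'D_(basis R s) (T j i) y)))).
    apply: eq_bigr => i _; apply: eq_bigr => j _.
    rewrite /chr -mulrA mulr_sumr mulr_suml; apply: eq_bigr => s _.
    by rewrite (TresC i j); ring.
  under eq_bigr do rewrite exchange_big /=.
  rewrite exchange_big /= mulr_sumr; apply: eq_bigr => s _.
  have -> : S1 s = \sum_i \sum_j v 0 i * (v 0 j * 'D_(basis R i) (T j s) y).
    by apply: eq_bigr => i _; rewrite mulr_sumr.
  have -> : S2 s = \sum_i \sum_j v 0 j * (v 0 i * 'D_(basis R j) (T i s) y).
    by rewrite exchange_big /=; apply: eq_bigr => i _; rewrite mulr_sumr.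
  have -> : S3 s = \sum_i \sum_j v 0 i * (v 0 j * 'D_(basis R s) (T j i) y).
    by apply: eq_bigr => i _; rewrite mulr_sumr.
  rewrite -big_split /= -sumrB !mulr_sumr; apply: eq_bigr => i _.
  by rewrite -big_split /= -sumrB !mulr_sumr.
rewrite E big1 ?mulr0 // => s _.
have -> : S1 s = 0 by rewrite /S1 big1 // => i _; rewrite H mulr0.
have -> : S2 s = 0 by rewrite /S2 big1 // => i _; rewrite H mulr0.
have -> : S3 s = 0 by rewrite /S3 big1 // => i _; rewrite H mulr0.
by rewrite addr0 subrr mulr0.
Qed.

Lemma gres0 : gres m a (0 : V) = minkowski R n.
Proof. by rewrite /gres qvec0 mulmx0 scaler0 addr0. Qed.

Lemma null_vector_sep v : null_vector (gres m a (0 : V)) v <-> v != 0 /\ sep v = 0.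
Proof.
rewrite /null_vector gres0 mul_minkowski mul_tr_dot dot_lower.
split=> -[v0 h]; split=> //; last by rewrite h; apply/matrixP => i j; rewrite !mxE mul0rn.
by move/matrixP: h => /(_ 0 0); rewrite !mxE eqxx mulr1n.
Qed.

Lemma null_cone_scri : scri C = null_cone (gtilde C) (manifold C) (i0 C).
Proof.
have d0 := delta_gt0 delta_good.
rewrite (scriE m a n_ge4); apply/seteqP; split=> q /=.
  move=> [qd sq q0]; have qn : 0 < `|q| by rewrite normr_gt0.
  (* The largest interval on which the ray stays in the ball; [q] is reached at parameter 1. *)
  exists (fun t : R => t *: q), (- (delta / `|q|)), (delta / `|q|), 1.
  split.
    split; [by rewrite oppr_lt0 divr_gt0 | exact: ltr01 | by rewrite ltr_pdivlMr // mul1r |].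
    move=> s s1 s2; have [h1 h2] := is_derive_ray q s.
    have D1 : derive1 (fun t : R => t *: q) = cst q.
      by apply/funext => t; have [_] := is_derive_ray q t.
    have sd : `|s *: q| < delta.
      by rewrite normrZ -ltr_pdivlMr // ltr_norml s1.
    split; [exact: sd | exact: h1 | by rewrite D1; exact: derivable_cst |].
    move=> l; rewrite D1 derive1_cst [LHS]mxE.
    transitivity (- (0 : R)); first by rewrite oppr0.
    congr (- _); rewrite -[LHS](chr_null l sq sd).
    by apply: eq_bigr => i _; apply: eq_bigr => j _; rewrite (chrE l i j sd).
  have [_ ->] := is_derive_ray q 0.
  by split; [rewrite scale0r | apply/null_vector_sep | rewrite scale1r].
move=> [gam [A [b [s [[A0 s0 sb Hg] [g0 Hv gs]]]]]].
set v := derive1 gam 0 in Hv.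
have /null_vector_sep [v0 sv] := Hv.
have vn : 0 < `|v| by rewrite normr_gt0.
have [L L0 HL] := chr_lipschitz.
have ray t : 0 <= t -> t < b -> `|t *: v| < delta -> gam t = t *: v.
  move=> t0 tb td.
  apply: (@geodesic_ray_unique R n chr delta L gam v t) => //.
  - exact: chr0.
  - by move=> l s' h; exact: chr_null.
  move=> s' /andP[s1 s2].
  have [h1 h2 h3 h4] := Hg s' (lt_le_trans A0 s1) (le_lt_trans s2 tb).
  split; [exact: h1 | exact: h2 | exact: h3 | move=> l; rewrite h4; congr (- _)].
  by apply: eq_bigr => i _; apply: eq_bigr => j _; rewrite chrE.
(* If the ray left the ball at a time t <= s, the geodesic would coincide with it just before t, and
   its norm would tend to [delta]; but [gam t] lies in the open ball. *)
have gsd : `|s *: v| < delta.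
  rewrite ltNge; apply/negP => sd.
  pose t := delta / `|v|.
  have t0 : 0 < t by rewrite divr_gt0.
  have ts : t <= s by rewrite ler_pdivrMr //; move: sd; rewrite normrZ gtr0_norm.
  have tb : t < b by apply: le_lt_trans sb.
  have [/= h1 h2 _ _] := Hg t (lt_trans A0 t0) tb.
  pose c := (`|gam t| + delta) / 2.
  have c1 : `|gam t| < c by rewrite /c; lra.
  have c2 : c < delta by rewrite /c; lra.
  have gc : {for t, continuous (fun t => `|gam t|)}.
    apply: (@continuous_comp _ _ _ gam (fun x : V => `|x|)).
      by apply: differentiable_continuous; apply/derivable1_diffP.
    exact: norm_continuous.
  have : \forall u \near t, `|gam u| < c by move/cvgr_lt: gc; apply.
  move=> [e /= e0 He].
  (* A time before t, within e of it, but late enough for the ray to have norm above [c]. *)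
  pose u := Num.max (t - e / 2) ((c / `|v| + t) / 2).
  have ct : c / `|v| < t by rewrite ltr_pM2r // invr_gt0.
  have cv0 : 0 <= c / `|v| by rewrite divr_ge0 // ltW // (le_lt_trans _ c1).
  have u1 : t - e / 2 <= u by rewrite le_max lexx.
  have u2 : (c / `|v| + t) / 2 <= u by rewrite le_max lexx orbT.
  have u3 : u < t by rewrite gt_max; apply/andP; split; lra.
  have u0 : 0 <= u by lra.
  have ud : `|u *: v| < delta by rewrite normrZ -ltr_pdivlMr // ger0_norm.
  have := He u; rewrite /ball_ /= ger0_norm ?subr_ge0 ?(ltW u3) //.
  move=> /(_ _); rewrite (ray u u0 (lt_trans u3 tb) ud) normrZ (ger0_norm u0).
  rewrite -ltr_pdivlMr //; have h : t - u < e by lra.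
  by move=> /(_ h); lra.
have gE := ray s (ltW s0) sb gsd.
rewrite -gs gE; split=> //; first by rewrite sepZ sv mulr0.
by rewrite scaler_eq0 negb_or v0 gt_eqF.
Qed.

End NullCone.

(** * Discontinuity at i0 *)

Section Discontinuity.
Variables (R : realType) (n : nat).
Hypothesis n_ge4 : (4 <= n)%N.
Local Notation V := 'rV[R]_n.+1.
Implicit Types (x y p : V).
Local Notation a := (fun _ : 'I_n./2 => 0 : R).

Lemma derive_along (f : V -> R) (y v : V) :
  'D_v f y = 'D_1 (fun h : R => f (h *: v + y)) 0.
Proof.
have E : (fun h : R => h^-1 *: ((f \o shift y) (h *: v) - f y)) =
   (fun h : R => h^-1 *: (((fun h : R => f (h *: v + y)) \o shift 0) (h *: (1 : R)) - f (0 *: v + y))).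
  apply/funext => h /=; rewrite addr0 scale0r add0r.
  by rewrite -[h *: (1 : R)]/(h * 1) mulr1.
by rewrite /derive E.
Qed.

(** The function p such that the time-time perturbation is r^(n-2) p(t / r) for m = 1, a = 0. The
    sign turns both factors into powers of monic polynomials. *)
Definition profile : {poly R} :=
  (2 * (-1) ^+ (n - 4)) *: (('X - 1%:P) ^+ (n - 4) * ('X - (-1)%:P) ^+ n).

Lemma profileE s : profile.[s] = 2 * (1 - s) ^+ (n - 4) * (1 + s) ^+ n.
Proof.
rewrite /profile hornerZ hornerM !horner_exp !hornerXsubC opprK -!mulrA.
by congr (2 * _); rewrite mulrA -exprMn mulN1r opprB (addrC s).
Qed.

(** The index is the degree (n - 4) + n, split so as to match coefficient n - 2 of the derivative of
    order n - 2. *)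
Lemma profile_coef : profile`_(n - 2 + (n - 2)) != 0.
Proof.
set M := ('X - 1%:P) ^+ (n - 4) * ('X - (-1)%:P) ^+ n : {poly R}.
have Mm : M \is monic by rewrite monicMl monic_exp // monicXsubC.
have sM : size M = (n - 2 + (n - 2)).+1.
  rewrite /M size_Mmonic ?monic_exp ?monicXsubC ?size_exp_XsubC //; first by lia.
  by rewrite -size_poly_eq0 size_exp_XsubC.
rewrite /profile -/M coefZ; have -> : M`_(n - 2 + (n - 2)) = 1.
  by move/monicP: Mm; rewrite lead_coefE sM.
by rewrite mulr1 mulf_neq0 ?pnatr_eq0 // expf_neq0 // oppr_eq0 oner_eq0.
Qed.

Lemma poly_const_interval (p : {poly R}) (c : R) :
  (forall s, `|s| < 1 -> p.[s] = c) -> p = c%:P.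
Proof.
move=> H; apply/eqP; rewrite -subr_eq0; apply/negPn/negP => q0.
(* Distinct points of the interval, as many as the size of the polynomial, hence more than it can
   have roots. *)
pose rs := [seq (i.+2%:R)^-1 : R | i <- iota 0 (size (p - c%:P))].
have := max_poly_roots (rs := rs) q0; rewrite size_map size_iota ltnn.
suff : all (root (p - c%:P)) rs && uniq rs by move=> /andP[-> ->] /(_ isT isT).
apply/andP; split.
  apply/allP => _ /mapP [i _ ->]; rewrite rootE hornerD hornerN hornerC H ?subrr //.
  by rewrite ger0_norm ?invr_ge0 // invf_lt1 ?ltr0n // ltr1n.
rewrite map_inj_uniq ?iota_uniq // => i j /invr_inj /eqP.
by rewrite eqr_nat => /eqP [].
Qed.

Variable delta : R.
Hypothesis delta_good : good_radius 1 a delta.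
Local Notation C := (mp_completion 1 a delta).
Local Notation r y := (Num.sqrt (spat y)).

Section AtPoint.
Variable y : V.
Hypothesis Py : physical C y.

Let Uy : pball a y. Proof. exact: physical_sub_pball Py. Qed.
Let sy : 0 < sep y. Proof. by move: Py; rewrite physicalE => -[]. Qed.

Lemma spat_gt0 : 0 < spat y.
Proof. by have := sy; rewrite sepE subr_gt0; apply: le_lt_trans; rewrite sqr_ge0. Qed.

Lemma r_gt0 : 0 < r y. Proof. by rewrite sqrtr_gt0 spat_gt0. Qed.

Lemma r_sqr : r y ^+ 2 = spat y. Proof. by rewrite sqr_sqrtr // ltW // spat_gt0. Qed.

Lemma Broot_spherical : Broot a y = spat y.
Proof.
have [B0 B1 _ _] := Broot_spec Uy.
move: B1; rewrite secular_fam sigma_eq0 ?ltW ?sy // addr0.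
have -> : \sum_i rho i y / (Broot a y + 0 ^+ 2 * sep y ^+ 2) = (\sum_i rho i y) / Broot a y.
  by rewrite mulr_suml; apply: eq_bigr => i _; rewrite expr0n /= mul0r addr0.
rewrite -mulrDl -/(spat y) => H.
by rewrite -[LHS]mul1r -H divfK // gt_eqF.
Qed.

Lemma dot_basis j (v : V) : dot (basis R j) v = v 0 j.
Proof.
rewrite /dot (bigD1 j) //= big1 => [|i ij]; last by rewrite mxE (negbTE ij) andbF mul0r.
by rewrite mxE !eqxx mul1r addr0.
Qed.

Lemma dotDl (u u' v : V) : dot (u + u') v = dot u v + dot u' v.
Proof. by rewrite /dot -big_split; apply: eq_bigr => j _; rewrite mxE mulrDl. Qed.

Lemma dot_suml (I : finType) (f : I -> V) v : dot (\sum_i f i) v = \sum_i dot (f i) v.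
Proof.
rewrite /dot exchange_big /=; apply: eq_bigr => j _.
by rewrite summxE mulr_suml.
Qed.

(** Without rotation, K is dt + dr. *)
Lemma dotK_spherical : dot (Kvec a y) y = tc y + r y.
Proof.
have r0 : r y != 0 by rewrite gt_eqF // r_gt0.
rewrite /Kvec !dotDl dot_basis dot_suml !dotZl dot_basis -addrA /Rroot Broot_spherical.
congr (_ + _).
transitivity (spat y / r y); last by rewrite -{1}r_sqr; field.
have -> : spat y / r y = (\sum_i rho i y) / r y + eps R n * zc y ^+ 2 / r y.
  by rewrite {1}/spat mulrDl.
congr (_ + _); last by rewrite -/(zc y); field.
rewrite mulr_suml; apply: eq_bigr => i _.
rewrite expr0n /= !mul0r addr0 scale0r addr0 !dotZl dotDl !dotZl !dot_basis.
rewrite -/(xc y i) -/(yc y i) /rho.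
have := r_sqr; move: (r y) r0 => rr r0 <-; field.
exact: r0.
Qed.

Lemma Kvec_time : Kvec a y 0 ord0 = 1.
Proof.
have xi (i : 'I_n./2) : basis R (xidx i) 0 ord0 = 0 :> R.
  rewrite mxE eqxx /=; case: eqP => // /(congr1 val) /=; rewrite inordK //.
  have := ltn_ord i; have := odd_double_half n; rewrite -!muln2; lia.
have yi (i : 'I_n./2) : basis R (yidx i) 0 ord0 = 0 :> R.
  rewrite mxE eqxx /=; case: eqP => // /(congr1 val) /=; rewrite inordK //.
  have := ltn_ord i; have := odd_double_half n; rewrite -!muln2; lia.
have zi : basis R (zidx n) 0 ord0 = 0 :> R.
  by rewrite mxE eqxx /=; case: eqP => // /(congr1 val) /= E; move: n_ge4; rewrite -E.
rewrite Kvec_coord zi !mulr0 addr0 big1 ?addr0; first by rewrite mxE !eqxx.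
by move=> i _; rewrite xi yi !mulr0 addr0 subrr !mulr0 addr0 mulr0.
Qed.

Lemma qvec_time : qvec a y 0 ord0 = (r y + tc y) ^+ 2.
Proof.
rewrite qvec_coord Kvec_time dotK_spherical /sgn eqxx -/(tc y) sepE.
by have := r_sqr; move: (r y) => rr <-; ring.
Qed.

(** Here H is 2 r^(2-n) w^(n-4) with w = (r - t) (r + t), and q has time component (r + t)^2. *)
Lemma Tres_time :
  Tres 1 a ord0 ord0 y = r y ^+ (n - 2) * profile.[tc y / r y].
Proof.
have r0 : r y != 0 by rewrite gt_eqF // r_gt0.
have F1 : Fhat a y = 1.
  by rewrite /Fhat big1 ?subr0 // => i _; rewrite expr0n /= !mul0r.
have P1 : Pihat a y = r y ^+ (2 * n./2).
  rewrite exprM r_sqr.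
  have -> : spat y ^+ n./2 = \prod_(i < n./2) spat y by rewrite prodr_const card_ord.
  by apply: eq_bigr => i _; rewrite Broot_spherical expr0n /= mul0r addr0.
rewrite /Tres qvec_time /Hhat F1 P1 profileE /Rroot Broot_spherical.
have -> : sep y = (r y - tc y) * (r y + tc y) by rewrite sepE; have := r_sqr; move: (r y) => rr <-; ring.
have -> : 1 - tc y / r y = (r y - tc y) / r y by field.
have -> : 1 + tc y / r y = (r y + tc y) / r y by field.
have -> : (2 * n./2 = (2 - odd n) + (n - 4) + 2)%N.
  by have := odd_double_half n; rewrite -muln2; case: (odd n) => /=; lia.
have -> : (n - 2 = (n - 4) + 2)%N by lia.
have e : (r y + tc y) ^+ n = (r y + tc y) ^+ (n - 4) * (r y + tc y) ^+ 4.
  by rewrite -exprD; congr (_ ^+ _); lia.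
have e' : r y ^+ n = r y ^+ (n - 4) * r y ^+ 4.
  by rewrite -exprD; congr (_ ^+ _); lia.
rewrite !expr_div_n e e' !exprD exprMn.
have := expf_neq0 (n - 4) r0; have := expf_neq0 (2 - odd n) r0.
move: (r y ^+ (n - 4)) (r y ^+ (2 - odd n)) ((r y - tc y) ^+ (n - 4)) ((r y + tc y) ^+ (n - 4)).
move=> A B c d A0 B0; field.
by rewrite r0 A0 B0.
Qed.

End AtPoint.

Lemma spat_time (h : R) y : spat (h *: basis R ord0 + y) = spat y.
Proof.
have sE v : spat v = esq v - tc v ^+ 2 by rewrite esqE; ring.
rewrite !sE /esq (bigD1 ord0) //= [in RHS](bigD1 ord0) //= /tc.
rewrite (eq_bigr (fun i => y 0 i ^+ 2)); first by ring.
by move=> i i0; rewrite !mxE (negbTE i0) andbF mulr0 add0r.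
Qed.

Lemma tc_time (h : R) y : tc (h *: basis R ord0 + y) = h + tc y.
Proof. by rewrite /tc !mxE !eqxx mulr1. Qed.

(** A time derivative leaves r fixed, so each one differentiates the polynomial and contributes a
    factor 1 / r. *)
Lemma pder_time k y : physical C y ->
  pder (nseq k ord0) (Tres 1 a ord0 ord0) y =
  r y ^+ (n - 2) / r y ^+ k * (profile^`(k)).[tc y / r y].
Proof.
elim: k y => [|k IH] y Py; first by rewrite /= expr0 divr1 Tres_time.
have r0 : r y != 0 by rewrite gt_eqF // (r_gt0 Py).
have -> : pder (nseq k.+1 ord0) (Tres 1 a ord0 ord0) y =
   'D_(basis R ord0) (fun y => r y ^+ (n - 2) / r y ^+ k * (profile^`(k)).[tc y / r y]) y.
  rewrite [LHS]/=; apply: near_eq_derive.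
  have := open_nbhs_nbhs (conj (@open_physical R n 1 a delta) Py).
  by apply: filterS => x Px; exact: IH.
rewrite derive_along.
have -> : (fun h : R => r (h *: basis R ord0 + y) ^+ (n - 2) / r (h *: basis R ord0 + y) ^+ k *
    (profile^`(k)).[tc (h *: basis R ord0 + y) / r (h *: basis R ord0 + y)]) =
    (fun h : R => r y ^+ (n - 2) / r y ^+ k * (profile^`(k)).[(h + tc y) / r y]).
  by apply/funext => h; rewrite spat_time tc_time.
set c := r y ^+ (n - 2) / r y ^+ k; set Q := profile^`(k).
have D1 : is_derive (0 : R) 1 (fun h : R => (h + tc y) / r y) (r y)^-1.
  have -> : (fun h : R => (h + tc y) / r y) = (r y)^-1 \*: ((id : R -> R) + cst (tc y)).
    by apply/funext => h; exact: mulrC.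
  have H := is_deriveZ (r y)^-1 (is_deriveD (is_derive_id (0 : R) (1 : R)) (is_derive_cst (tc y) (0 : R) (1 : R))).
  by apply: (is_derive_eq H); rewrite addr0 -[_ *: _]/(_ * _) mulr1.
have D2 : is_derive (0 : R) 1 (horner Q \o (fun h : R => (h + tc y) / r y))
    ((Q^`()).[(0 + tc y) / r y] * (r y)^-1).
  by apply: is_derive1_comp; exact: is_derive_poly.
have D3 := is_deriveZ c D2.
have [_ ->] : is_derive (0 : R) 1 (fun h : R => c * Q.[(h + tc y) / r y])
   (c *: ((Q^`()).[(0 + tc y) / r y] * (r y)^-1)) by exact: D3.
rewrite add0r derivnS -/Q /c -[_ *: _]/(_ * _) exprSr.
have := expf_neq0 k r0; move: (r y ^+ k) (r y ^+ (n - 2)) => A B A0.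
move: (_.[_]) => z; field.
by rewrite r0 A0.
Qed.

(** At order n - 2 the powers of r cancel and the derivative is a function of t / r alone.
    Approaching [i0] along rays of constant t / r = s would force the same value for every |s| < 1,
    against the positive degree of the polynomial. *)
Lemma not_extends :
  ~ extends_continuously (physical C) [set i0 C]
      (pder (nseq (n - 2) ord0) (fun y => gtilde C y ord0 ord0)).
Proof.
move=> [F [FE F0]].
have {}F0 := F0 (0 : V) erefl.
have d0 := delta_gt0 delta_good.
have gT : pder (nseq (n - 2) ord0) (fun y => gtilde C y ord0 ord0) =
    pder (nseq (n - 2) ord0) (Tres 1 a ord0 ord0).
  rewrite /= gres_Tres pder_addl //.
  by rewrite -size_eq0 size_nseq subn_eq0 -ltnNge (leq_trans _ n_ge4).
have n2 : (0 < n./2)%N by rewrite half_gt0; apply: leq_trans n_ge4.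
pose e1 := basis R (xidx (Ordinal n2)) : V.
have x0 : (xidx (Ordinal n2) : 'I_n.+1) != ord0.
  by rewrite -val_eqE /= inordK // ltnS; exact: leq_trans n_ge4.
suff const : forall s, `|s| < 1 -> (profile^`(n - 2)).[s] = F 0.
  have E := poly_const_interval const.
  have := profile_coef.
  have := congr1 (fun p : {poly R} => p`_(n - 2)) E.
  (* The coefficient of degree n - 2 is the leading coefficient of [profile] times a nonzero falling
     factorial, whereas a constant has coefficient 0 there. *)
  rewrite coef_derivn coefC; have -> : (n - 2 == 0)%N = false by apply/eqP; lia.
  move/eqP; rewrite mulrn_eq0 => /orP [|/eqP ->]; last by rewrite eqxx.
  by rewrite -leqn0 leqNgt ffact_gt0 leq_addr.
move=> s s1.
(* The ray with t / r = s in the plane of t and x_1; it is spacelike since |s| < 1. *)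
pose q (l : R) : V := l *: (s *: basis R ord0 + e1).
have qe l : q l = (l * s) *: basis R ord0 + (l *: e1 + 0).
  by rewrite /q scalerDr scalerA addr0.
have spq l : spat (q l) = l ^+ 2.
  rewrite qe spat_time.
  have := sepE (l *: e1 + 0); rewrite sep_basis // sep0 mxE mulr0 add0r add0r.
  have -> : tc (l *: e1 + 0) = 0 by rewrite /tc !mxE eq_sym (negbTE x0) andbF mulr0 addr0.
  by rewrite expr0n /= subr0 => ->.
have tq l : tc (q l) = l * s.
  rewrite qe tc_time.
  have -> : tc (l *: e1 + 0) = 0 by rewrite /tc !mxE eq_sym (negbTE x0) andbF mulr0 addr0.
  by rewrite addr0.
have D (l : R) : 0 < l -> `|q l| < delta ->
    physical C (q l) /\ F (q l) = (profile^`(n - 2)).[s].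
  move=> l0 ld.
  have Pq : physical C (q l).
    rewrite physicalE; split=> //=; rewrite sepE spq tq exprMn.
    have : s ^+ 2 < 1.
      by rewrite -(real_normK (num_real s)) expr_lt1.
    have : 0 < l ^+ 2 by rewrite exprn_gt0.
    by move=> h1 h2; rewrite subr_gt0 gtr_pMr.
  split=> //; rewrite FE // gT pder_time // spq tq sqrtr_sqr gtr0_norm //.
  by rewrite divff ?expf_neq0 ?gt_eqF // mul1r mulrAC divff ?gt_eqF // mul1r.
have lim0 : q l @[l --> (0 : R)] --> (0 : V).
  suff : q l @[l --> (0 : R)] --> 0 *: (s *: basis R ord0 + e1) by rewrite scale0r.
  by apply: cvgZr_tmp; exact: cvg_id.
apply/eqP; rewrite -subr_eq0 -normr_le0; apply/ler_addgt0Pr => e e0; rewrite add0r.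
have : \forall y \near (0 : V), (physical C `|` [set i0 C]) y -> `|F 0 - F y| < e.
  by move/cvgrPdist_lt: F0 => /(_ e e0).
move=> H1.
have H2 : \forall y \near (0 : V), `|y| < delta.
  by apply: open_nbhs_nbhs; split; [exact: open_norm_lt | rewrite /= normr0].
have [e' /= e'0 He] := lim0 _ (filterI H1 H2).
have l0 : 0 < e' / 2 by rewrite divr_gt0.
have [|h1 h2] := He (e' / 2).
  by rewrite /ball_ /= sub0r normrN gtr0_norm //; lra.
have [Pq Fq] := D _ l0 h2.
by rewrite -Fq distrC; apply/ltW/h1; left.
Qed.

End Discontinuity.

Theorem mainTheorem1 (R : realType) (n : nat) (hn : (4 <= n)%N) :
  exists C : R -> ('I_n./2 -> R) -> completion R n,
    (forall (m : R) (a : 'I_n./2 -> R),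
       [/\ conformal_completion (mp_domain a) (myers_perry m a) (C m a),
           scri (C m a) =
             null_cone (gtilde (C m a)) (manifold (C m a)) (i0 (C m a)) &
           forall mu nu : 'I_n.+1,
             let G := fun y => gtilde (C m a) y mu nu in
             [/\ Ck_holder_on (n - 3) 1 (manifold (C m a)) G,
                 forall s, (size s <= n - 3)%N ->
                   extends_continuously (physical (C m a))
                     ([set i0 (C m a)] `|` scri (C m a)) (pder s G),
                 Ck_on (n - 2) (physical (C m a)) G &
                 forall s, (size s <= n - 2)%N ->
                   bounded_near (physical (C m a)) (i0 (C m a)) (pder s G)]])
    /\
    (* Derivatives of order n - 3 are Lipschitz and hence extend; n - 2 is the
       first order at which continuity at i0 can fail. *)
    (exists (m : R) (a : 'I_n./2 -> R) (mu nu : 'I_n.+1) (s : seq 'I_n.+1),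
       [/\ m != 0, size s = (n - 2)%N &
           ~ extends_continuously (physical (C m a)) [set i0 (C m a)]
               (pder s (fun y => gtilde (C m a) y mu nu))]).

Proof.
have [delta Hd] := choice (fun p : R * ('I_n./2 -> R) => good_radius_exists p.1 p.2 hn).
exists (fun m a => mp_completion m a (delta (m, a))); split=> [m a|].
  have good := Hd (m, a).
  split; first exact: mp_conformal_completion.
    exact: null_cone_scri.
  move=> mu nu G; split.
  - exact: gres_Ck_holder.
  - by move=> s sn; exact: gres_extends.
  - exact: gres_Ck.
  - by move=> s sn; exact: gres_bounded.
exists 1, (fun=> 0), ord0, ord0, (nseq (n - 2) ord0); split.
- exact: oner_neq0.
- by rewrite size_nseq.
- exact: not_extends (Hd (1, fun=> 0)).
Qed.
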